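(* Let $(X(t))_{t\in\mathbb{R}}$ be a centered real-valued Gaussian process with stationary increments and semi-variogram $V$, and let $\delta_n=n^{-\alpha}$ with $0<\alpha\le 1$ fixed. Assume: (i) $V$ is $C^\infty$ on $(0,+\infty)$; (ii) $V$ is $2D$ times differentiable on $\mathbb{R}$ for some integer $D\ge 0$, and there exist $C>0$ and $0<s<2$ such that for all $h\in\mathbb{R}$, $V^{(2D)}(h)=V^{(2D)}(0)+C(-1)^D|h|^s+r(h)$, with $r(h)=o(|h|^s)$ as $h\to 0$; if $\alpha<1$, assume in addition that there is a constant $K$ with $|r(h)|\le K|h|^s$ for all $|h|>1$; (iii) with $d=2$ if $s<3/2$ and $d=3$ if $s\ge 3/2$, there exist $\beta$ with $s-d<\beta<-1/2$ and a constant $K'$ such that $|r^{(d)}(h)|\le K'|h|^\beta$ for all $0<|h|<1$ if $\alpha=1$, and for all $h\ne 0$ if $\alpha<1$. Let $a^{(1)},\dots,a^{(k)}$ be $k$ non-zero finitely supported real sequences with zero sum, each with order greater than $D+s/2+1/4$. Assume also that, as $n\to\infty$, the $k\times k$ matrix with $(i,j)$ entry $$\frac{1}{n\delta_n^{4D+2s}}\mathrm{Cov}\big(V_{a^{(i)},n},V_{a^{(j)},n}\big)$$ converges to an invertible matrix $\Lambda_\infty$. Then the vector $W_n=(V_{a^{(1)},n},\dots,V_{a^{(k)},n})^\top$ satisfies, as $n\to\infty$, $$\frac{W_n-\mathbb{E}[W_n]}{n^{1/2}\delta_n^{2D+s}}\longrightarrow\mathcal{N}(0,\Lambda_\infty)\quad\text{in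 distribution}.$$
   Context: The semi-variogram is $V(h)=\frac12\mathbb{E}[(X(t+h)-X(t))^2]$, which does not depend on $t$ by stationarity of increments. A sequence $a$ is written $(a_0,\dots,a_{L-1})$ with $a_0\ne0$, $a_{L-1}\neq 0$; $L=L(a)$ is its length. Its order $M(a)$ is the integer such that $\sum_j a_j j^k=0$ for $0\le k<M(a)$ and $\sum_j a_j j^{M(a)}\ne 0$. The discrete $a$-differences of $X$ are $\Delta_{a,i}(X)=\sum_{j=0}^{L(a)-1}a_jX((i+j)\delta_n)$, $i=1,\dots,n'$, with $n'=n-L(a)+1$, and the quadratic $a$-variation is $V_{a,n}=\sum_{i=1}^{n'}(\Delta_{a,i}(X))^2$. *)

(* Defs.v *)
From HB Require Import structures.
From mathcomp Require Import all_boot all_order all_algebra.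
From mathcomp Require Import all_classical all_reals all_analysis.

Set Implicit Arguments.
Unset Strict Implicit.
Unset Printing Implicit Defensive.

Import Order.TTheory GRing.Theory Num.Theory.
Import numFieldNormedType.Exports.

Local Open Scope classical_set_scope.
Local Open Scope ring_scope.

(* [normal_prob m 0] of the library is a placeholder (the uniform law on [0, 1]),
   so the degenerate Gaussian law with standard deviation 0 is given apart. *)
Definition normal_law (R : realType) (m sigma : R) : set R -> \bar R :=
  if sigma == 0 then dirac m else normal_prob m sigma.

Definition is_normal (d : measure_display) (T : measurableType d)
    (R : realType) (P : probability T R) (Y : T -> R) (m sigma : R) : Prop :=
  forall A : set R, measurable A -> P (Y @^-1` A) = normal_law m sigma A.

Definition gaussian_process (d : measure_display) (T : measurableType d)
    (R : realType) (P : probability T R) (X : R -> {RV P >-> R}) : Prop :=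
  forall (m : nat) (c t : 'I_m -> R), exists mean sigma : R,
    is_normal P (fun w => \sum_(i < m) c i * X (t i) w) mean sigma.

Definition centered (d : measure_display) (T : measurableType d)
    (R : realType) (P : probability T R) (X : R -> {RV P >-> R}) : Prop :=
  forall t : R, ('E_P[X t] = 0)%E.

(* The finite-dimensional laws of the increments are invariant under
   translation of time. *)
Definition stationary_increments (d : measure_display) (T : measurableType d)
    (R : realType) (P : probability T R) (X : R -> {RV P >-> R}) : Prop :=
  forall (m : nat) (t u : 'I_m -> R) (h : R) (A : set (m.-tuple R)),
    measurable A ->
    P [set w | A [tuple X (t i + h) w - X (u i + h) w | i < m]] =
    P [set w | A [tuple X (t i) w - X (u i) w | i < m]].

Definition is_semivariogram (d : measure_display) (T : measurableType d)
    (R : realType) (P : probability T R) (X : R -> {RV P >-> R})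
    (V : R -> R) : Prop :=
  forall t h : R,
    (V h)%:E =
      ((1 / 2)%:E * 'E_P[fun w => ((X (t + h) w - X t w) ^+ 2)%R])%E.

Definition smooth_on_pos (R : realType) (f : R -> R) : Prop :=
  forall (m : nat) (x : R), 0 < x -> derivable (f^`(m)%classic) x 1.

Definition times_differentiable (R : realType) (p : nat) (f : R -> R) : Prop :=
  forall m : nat, (m < p)%N -> forall x : R, derivable (f^`(m)%classic) x 1.

(* A finitely supported sequence (a_0, ..., a_{L-1}) is the list of its values,
   normalized by a_0 != 0 and a_{L-1} != 0; its length is [size a]. *)
Definition is_difference_sequence (R : realType) (a : seq R) : Prop :=
  a`_0 != 0 /\ a`_(size a).-1 != 0.

Definition has_order (R : realType) (a : seq R) (M : nat) : Prop :=
  (forall k : nat, (k < M)%N -> \sum_(j < size a) a`_j * j%:R ^+ k = 0) /\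
  \sum_(j < size a) a`_j * j%:R ^+ M != 0.

Definition mesh (R : realType) (alpha : R) (n : nat) : R := n%:R `^ (- alpha).

Definition a_difference (R : realType) (T : Type) (X : R -> T -> R)
    (delta : R) (a : seq R) (i : nat) (w : T) : R :=
  \sum_(j < size a) a`_j * X ((i + j)%:R * delta) w.

(* The upper index n - L + 1 is computed as n.+1 - L, so that with truncated
   subtraction the sum is empty when n < L. *)
Definition quad_variation (R : realType) (T : Type) (X : R -> T -> R)
    (alpha : R) (a : seq R) (n : nat) (w : T) : R :=
  \sum_(1 <= i < (n.+1 - size a).+1) a_difference X (mesh alpha n) a i w ^+ 2.

(* [mu] is the law N(m, S) on R^k: the linear form z |-> u . z has law
   N(u . m, u S u^T) for every u. *)
Definition is_mvnormal (R : realType) (k : nat) (m : 'rV[R]_k) (S : 'M[R]_k)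
    (mu : probability (k.-tuple R) R) : Prop :=
  forall u : 'rV[R]_k,
    is_normal mu (fun z => \sum_(i < k) u 0 i * tnth z i)
      ((u *m m^T) 0 0) (Num.sqrt ((u *m S *m u^T) 0 0)).

(* The law [mu] lives on tuples, which carry the product sigma-algebra, and
   test functions on row vectors, which carry the topology of R^k. *)
Definition cvg_in_distribution (d : measure_display) (T : measurableType d)
    (R : realType) (P : probability T R) (k : nat) (Y : nat -> T -> 'rV[R]_k)
    (mu : probability (k.-tuple R) R) : Prop :=
  forall f : 'rV[R]_k -> R, continuous f ->
    (exists B : R, forall x, `|f x| <= B) ->
    'E_P[f \o Y n]%E @[n --> \oo] -->
      (\int[mu]_z (f (\row_(i < k) tnth z i))%:E)%E.

(* Main.v *)
(** By the Cramer-Wold device it is enough to treat one linear form of [W_n],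
    i.e. a quadratic form [Q = \sum_i w_i (z_i^2 - E z_i^2)] in the Gaussian
    vector [z] of the discrete differences. Gaussian integration by parts gives
      [E Q^(p+1) = \sum_(1 <= i <= p) 2^i p^_i tr (N^(i+1)) E Q^(p-i)]
    with [N = diag(w) Cov(z)], so all moments converge to those of a centered
    Gaussian law as soon as [tr (N^2)] converges to half of its variance and
    [tr (N^r) --> 0] for [r > 2]. The first condition is the hypothesis on the
    covariances. For the second one, a Taylor expansion of the variogram to an
    order killed by the difference sequences shows that the entries of [N] are
    [O (n^(-1/2) |i - j|^gam)] with [gam < -1/2], whence
    [tr (N^r) = O ((n^(-1/2) \sum_(m <= n) m^gam)^(r-2))].

    Convergence of the moments yields that of [E (cos (u . Y_n + t))], then that of
    [E (f (Y_n))] for every bounded continuous [f], since on a box [f] is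
    uniformly close to a Bernstein polynomial in the variables
    [(1 + sin (y_j / l)) / 2], which is a trigonometric polynomial bounded by the
    bound of [f].

    The limit law is the law of a vector taken in the Gaussian space spanned by
    the process itself: this space has infinite dimension, because on a space of
    dimension [m] one would have [tr (N^2)^2 <= m tr (N^4)], and its elements are
    normal by hypothesis, so that no product measure is needed. *)

Require Import Defs.
From HB Require Import structures.
From mathcomp Require Import all_boot all_order all_algebra.
From mathcomp Require Import all_classical all_reals all_analysis.
From mathcomp Require Import measurable_realfun ring lra zify.

Set Implicit Arguments.
Unset Strict Implicit.
Unset Printing Implicit Defensive.

Import Order.TTheory GRing.Theory Num.Theory.
Import numFieldNormedType.Exports.

Local Open Scope classical_set_scope.
Local Open Scope ring_scope.

(** * Random variables with moments of all orders *)

Section moments.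
Context {d : measure_display} {T : measurableType d} {R : realType}.
Variable P : probability T R.
Implicit Types f g : T -> R.

(** Integration by parts never touches a density: a Gaussian space is known only through E exp(t f)
    = exp(t^2 v / 2), and identities are differentiated by comparing expansions a + b e + O(e^2) of
    their two sides, so that no theorem on derivation under the integral sign is called. The
    exponent -1/2 is critical in the trace bound. Below it the squares m^(2 gam) are summable, and
    two factors n^(-1/2) then pay for the k n diagonal terms of the trace; below it also the row
    sums, of order n^(1 + gam), are o(n^(1/2)), and each further factor tends to 0. The decay comes
    from two regimes. For distant indices the variogram is smooth between the sampling times and is
    expanded to order 2D + d, which two filters together annihilate; for close indices it is
    expanded at 0, where only 2D derivatives are available. Moments determine the limit because the
    Gaussian moment of order 2N over (2N)! is (v/2)^N / N!, so that Taylor remainders of cosines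
    vanish. The trigonometric approximation has an error quadratic in y, so bounded variances
    replace tightness. *)

Definition Ex f : R := (\int[P]_w f w)%R.

(** Asking for every power makes the class an algebra: |f^p g^p| <= f^(2p) + g^(2p) gives products,
    and the binomial formula gives sums. Integrability side conditions then follow from the syntax,
    which is what [hm] exploits. *)
Definition has_moments f : Prop :=
  measurable_fun setT f /\
  forall p : nat, P.-integrable setT (fun w => (f w ^+ p)%:E).

Lemma has_moments_measurable f : has_moments f -> measurable_fun setT f.
Proof. by case. Qed.

Lemma has_moments_integrable f :
  has_moments f -> P.-integrable setT (EFin \o f).
Proof. by move=> [_ /(_ 1%N)]. Qed.

Lemma eq_Ex f g : f =1 g -> Ex f = Ex g.
Proof. by move=> /funext ->. Qed.

Lemma fine_expectation f : fine ('E_P[f])%E = Ex f.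
Proof. by rewrite unlock. Qed.

Lemma expectation_Ex f : has_moments f -> ('E_P[f])%E = (Ex f)%:E.
Proof.
move=> hf; rewrite -fine_expectation fineK// unlock.
exact: integrable_fin_num (has_moments_integrable hf).
Qed.

Lemma integral_Ex f : has_moments f -> (\int[P]_w (f w)%:E)%E = (Ex f)%:E.
Proof. by move=> hf; rewrite -(expectation_Ex hf) unlock. Qed.

Lemma dominated_integrable f g : measurable_fun setT f ->
  (forall w, `|f w| <= g w) -> P.-integrable setT (EFin \o g) ->
  P.-integrable setT (EFin \o f).
Proof.
move=> mf fg; apply: le_integrable => //; first exact/measurable_EFinP.
by move=> w _ /=; rewrite lee_fin (le_trans (fg w))// ler_norm.
Qed.

Lemma has_moments_dominated f g : measurable_fun setT f ->
  (forall w, `|f w| <= g w) -> has_moments g -> has_moments f.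
Proof.
move=> mf fg [mg ig]; split => // p.
apply: (@dominated_integrable _ (fun w => g w ^+ p)) => //.
  exact: measurable_funX.
by move=> w; rewrite normrX lerXn2r// nnegrE ?(le_trans _ (fg w)).
exact: ig.
Qed.

Lemma has_moments_cst (c : R) : has_moments (fun=> c).
Proof.
split=> [|p]; first exact: measurable_cst.
exact: finite_measure_integrable_cst.
Qed.

Lemma has_momentsM f g : has_moments f -> has_moments g ->
  has_moments (fun w => f w * g w).
Proof.
move=> [mf If] [mg Ig]; split=> [|p]; first exact: measurable_funM.
apply: (@dominated_integrable _ (fun w => f w ^+ (p * 2) + g w ^+ (p * 2))).
- by apply: measurable_funX; exact: measurable_funM.
- move=> w; rewrite exprMn normrM !exprM.
  rewrite -(real_normK (num_real (f w ^+ p))) -(real_normK (num_real (g w ^+ p))).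
  have := normr_ge0 (f w ^+ p); have := normr_ge0 (g w ^+ p).
  by move: (`|_|) (`|_|) => a b ? ?; nra.
- have /= := integrableD measurableT (If (p * 2)%N) (Ig (p * 2)%N).
  by apply: eq_integrable => // w _ /=; rewrite EFinD.
Qed.

Lemma has_momentsX f p : has_moments f -> has_moments (fun w => f w ^+ p).
Proof.
move=> hf; elim: p => [|p IH]; first exact: has_moments_cst.
under eq_fun do rewrite exprS; exact: has_momentsM.
Qed.

Lemma integrable_sumR (I : Type) (s : seq I) (h : I -> T -> R) :
  (forall i, P.-integrable setT (EFin \o h i)) ->
  P.-integrable setT (fun w => (\sum_(i <- s) h i w)%:E).
Proof.
move=> ih; under eq_fun do rewrite -sumEFin.
by apply: integrable_sum => // i _; exact: ih.
Qed.

Lemma has_momentsD f g : has_moments f -> has_moments g ->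
  has_moments (fun w => f w + g w).
Proof.
move=> hf hg; split=> [|p].
  by apply: measurable_funD; exact: has_moments_measurable.
under eq_fun do rewrite exprDn.
apply: integrable_sumR => i; apply: has_moments_integrable.
under eq_fun do rewrite -mulr_natr.
by apply: has_momentsM (has_moments_cst _); apply: has_momentsM; exact: has_momentsX.
Qed.

Lemma has_momentsZ c f : has_moments f -> has_moments (fun w => c * f w).
Proof. by move=> hf; apply: has_momentsM => //; exact: has_moments_cst. Qed.

Lemma has_momentsN f : has_moments f -> has_moments (fun w => - f w).
Proof.
by move=> /(has_momentsZ (-1)); under eq_fun do rewrite mulN1r.
Qed.

Lemma has_momentsB f g : has_moments f -> has_moments g ->
  has_moments (fun w => f w - g w).
Proof. by move=> hf /has_momentsN; exact: has_momentsD. Qed.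

Lemma has_moments_sum (I : Type) (s : seq I) (Q : pred I) (h : I -> T -> R) :
  (forall i, Q i -> has_moments (h i)) ->
  has_moments (fun w => \sum_(i <- s | Q i) h i w).
Proof.
move=> hh; elim: s => [|i s IH].
  by under eq_fun do rewrite big_nil; exact: has_moments_cst.
case Qi: (Q i); under eq_fun do rewrite big_cons Qi; last exact: IH.
by apply: has_momentsD => //; exact: hh.
Qed.

Lemma Ex_cst c : Ex (fun=> c) = c.
Proof.
have := @Rintegral_cst _ _ _ P setT measurableT c.
by rewrite /Ex => ->; rewrite [X in fine X](@probability_setT _ _ _ P)/= mulr1.
Qed.

Lemma ExD f g : has_moments f -> has_moments g ->
  Ex (fun w => f w + g w) = Ex f + Ex g.
Proof. by move=> hf hg; apply: RintegralD => //; exact: has_moments_integrable. Qed.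

Lemma ExZ c f : has_moments f -> Ex (fun w => c * f w) = c * Ex f.
Proof. by move=> hf; apply: RintegralZl => //; exact: has_moments_integrable. Qed.

Lemma ExN f : has_moments f -> Ex (fun w => - f w) = - Ex f.
Proof.
by move=> hf; rewrite -mulN1r -ExZ//; under [in RHS]eq_fun do rewrite mulN1r.
Qed.

Lemma ExB f g : has_moments f -> has_moments g ->
  Ex (fun w => f w - g w) = Ex f - Ex g.
Proof. by move=> hf hg; rewrite ExD ?ExN//; exact: has_momentsN. Qed.

Lemma Ex_sum (I : Type) (s : seq I) (Q : pred I) (h : I -> T -> R) :
  (forall i, Q i -> has_moments (h i)) ->
  Ex (fun w => \sum_(i <- s | Q i) h i w) = \sum_(i <- s | Q i) Ex (h i).
Proof.
move=> hh; elim: s => [|i s IH].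
  by under eq_fun do rewrite big_nil; rewrite Ex_cst big_nil.
case Qi: (Q i); under eq_fun do rewrite big_cons Qi; rewrite big_cons Qi; last exact: IH.
rewrite ExD ?IH//; first exact: hh.
exact: has_moments_sum.
Qed.

Lemma Ex_le f g : has_moments f -> has_moments g ->
  (forall w, f w <= g w) -> Ex f <= Ex g.
Proof.
by move=> hf hg fg; apply: le_Rintegral => //; exact: has_moments_integrable.
Qed.

Lemma Ex_ge0 f : (forall w, 0 <= f w) -> 0 <= Ex f.
Proof. by move=> f0; apply: Rintegral_ge0. Qed.

Lemma Ex_norm_le f g : has_moments f -> has_moments g ->
  (forall w, `|f w| <= g w) -> `|Ex f| <= Ex g.
Proof.
move=> hf hg fg; rewrite ler_norml lerNl -ExN//; apply/andP; split.
  apply: Ex_le => [||w]; [exact: has_momentsN|by []|].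
  by rewrite (le_trans (ler_norm _))// normrN.
by apply: Ex_le => // w; rewrite (le_trans (ler_norm _)).
Qed.

End moments.

Ltac hm := by repeat first [ assumption | apply: has_moments_cst
  | apply: has_momentsB | apply: has_momentsN | apply: has_momentsD
  | apply: has_momentsX | apply: has_momentsM ].

(** * Gaussian spaces and integration by parts *)

Section normal_mgf.
Context {R : realType}.
Notation leb := (@lebesgue_measure R).
Implicit Types m s t : R.

(** The Radon-Nikodym derivative of [normal_prob] and [normal_pdf] have the same integral on every
    measurable set, hence agree almost everywhere. *)
Lemma ge0_integral_normal_prob m s (f : R -> \bar R) : s != 0 ->
  (forall x, 0 <= f x)%E -> measurable_fun setT f ->
  (\int[normal_prob m s]_x f x = \int[leb]_x (f x * (normal_pdf m s x)%:E))%E.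
Proof.
move=> s0 f0 mf; have dom := normal_prob_dominates m s.
rewrite -(Radon_Nikodym_SigmaFinite.change_of_variables dom)//.
have fi := Radon_Nikodym_SigmaFinite.f_integrable dom.
have mpdf : measurable_fun setT (fun x : R => (normal_pdf m s x)%:E).
  by apply/measurable_EFinP; exact: measurable_normal_pdf.
apply: ae_eq_integral => //.
- by apply: emeasurable_funM => //; exact: measurable_int fi.
- exact: emeasurable_funM.
apply: ae_eqe_mul2l; apply: integral_ae_eq => // E _ mE.
by rewrite -Radon_Nikodym_SigmaFinite.f_integral.
Qed.

(** Completing the square: exp(t x) times the density of N(m, s^2) is a constant times the density
    of N(m + t s^2, s^2), whose integral is 1. *)
Lemma normal_prob_mgf m s t : s != 0 ->
  (\int[normal_prob m s]_x (expR (t * x))%:E =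
    (expR (t * m + t ^+ 2 * s ^+ 2 / 2))%:E)%E.
Proof.
move=> s0; have mexp : measurable_fun setT (fun x : R => (expR (t * x))%:E).
  apply/measurable_EFinP; apply: (measurableT_comp (@measurable_expR _)).
  exact: mulrl_measurable.
rewrite ge0_integral_normal_prob//.
transitivity (\int[leb]_x ((expR (t * m + t ^+ 2 * s ^+ 2 / 2))%:E *
    (normal_pdf (m + t * s ^+ 2) s x)%:E))%E.
  apply: eq_integral => x _; rewrite -!EFinM; congr EFin.
  rewrite !normal_pdfE// mulrCA [RHS]mulrCA; congr (_ * _).
  rewrite /normal_fun -!expRD; congr expR.
  by field.
rewrite ge0_integralZl//.
- by rewrite integral_normal_pdf mule1.
- by apply/measurable_EFinP; exact: measurable_normal_pdf.
- by move=> x _; rewrite lee_fin normal_pdf_ge0.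
Qed.

End normal_mgf.

(** * First-order expansions with quadratic remainder *)

Section jets.
Context {R : realType}.
Implicit Types (F G : R -> R) (a b c e u : R).

(** A value [a] and a derivative [b] at 0, given by an explicit estimate that a dominated
    expectation inherits at once. Expanding one function in two ways and applying [jet_uniq]
    differentiates an identity. *)
Definition jet F a b : Prop :=
  exists K : R, forall e, `|e| <= 1 -> `|F e - a - b * e| <= K * e ^+ 2.

Lemma jet_uniq F a b a' b' : jet F a b -> jet F a' b' -> b = b'.
Proof.
move=> [K hK] [K' hK'].
have hab e : `|e| <= 1 -> `|(a - a') + (b - b') * e| <= (`|K| + `|K'|) * e ^+ 2.
  move=> e1; have -> : (a - a') + (b - b') * e =
    (F e - a' - b' * e) - (F e - a - b * e) by ring.
  rewrite (le_trans (ler_normB _ _))// mulrDl addrC lerD//.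
    by rewrite (le_trans (hK _ e1))// ler_wpM2r ?sqr_ge0 ?ler_norm.
  by rewrite (le_trans (hK' _ e1))// ler_wpM2r ?sqr_ge0 ?ler_norm.
have aa : a - a' = 0.
  have := hab 0; rewrite normr0 ler01 mulr0 addr0 expr0n/= mulr0 => /(_ isT).
  by rewrite normr_le0 => /eqP.
apply/eqP; rewrite -subr_eq0; apply/negPn/negP => bb.
set L := `|K| + `|K'| in hab; set B := `|b - b'|.
have B0 : 0 < B by rewrite normr_gt0.
have L0 : 0 <= L by rewrite addr_ge0.
(* Chosen so that [e <= 1] and [L * e < B], against the inequality [B <= L * e] that [hab]
   yields. *)
pose e := B / (B + L + L + 1).
have den : 0 < B + L + L + 1 by lra.
have e0 : 0 < e by rewrite divr_gt0.
have e1 : `|e| <= 1 by rewrite gtr0_norm// ler_pdivrMr//; lra.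
have := hab e e1; rewrite aa add0r normrM (gtr0_norm e0) -/B expr2 (mulrA L) ler_pM2r//.
rewrite /e mulrA ler_pdivlMr// => /[!mulrC B] hB.
have : B + L + L + 1 <= L by rewrite -(ler_pM2r B0).
lra.
Qed.

Lemma jet_eq F G a b : F =1 G -> jet F a b -> jet G a b.
Proof. by move=> /funext ->. Qed.

Lemma jet_id c b : jet (fun e => c + e * b) c b.
Proof.
by exists 0 => e _; rewrite (_ : _ - _ = 0) ?normr0 ?mul0r//; ring.
Qed.

Lemma jetD F G a b a' b' : jet F a b -> jet G a' b' ->
  jet (fun e => F e + G e) (a + a') (b + b').
Proof.
move=> [K hK] [K' hK']; exists (K + K') => e e1.
rewrite (_ : _ - _ = (F e - a - b * e) + (G e - a' - b' * e)); last by ring.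
by rewrite (le_trans (ler_normD _ _))// mulrDl lerD// ?hK ?hK'.
Qed.

Lemma jetM F G a b a' b' : jet F a b -> jet G a' b' ->
  jet (fun e => F e * G e) (a * a') (a * b' + b * a').
Proof.
move=> [K hK] [K' hK'].
exists (`|K| * (`|a'| + `|b'| + `|K'|) + (`|a| + `|b|) * `|K'| + `|b * b'|) => e e1.
have e21 : e ^+ 2 <= 1 by rewrite -real_normK ?num_real// expr_le1.
have e20 := sqr_ge0 e.
have hK1 : `|F e - a - b * e| <= `|K| * e ^+ 2.
  by rewrite (le_trans (hK _ e1))// ler_wpM2r// ler_norm.
have hK'1 : `|G e - a' - b' * e| <= `|K'| * e ^+ 2.
  by rewrite (le_trans (hK' _ e1))// ler_wpM2r// ler_norm.
have hG : `|G e| <= `|a'| + `|b'| + `|K'|.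
  rewrite (_ : G e = (a' + b' * e) + (G e - a' - b' * e)); last by ring.
  rewrite (le_trans (ler_normD _ _))// lerD//.
    rewrite (le_trans (ler_normD _ _))// lerD2l// normrM.
    by rewrite ler_piMr.
  by rewrite (le_trans hK'1)// ler_piMr.
have hF : `|a + b * e| <= `|a| + `|b|.
  by rewrite (le_trans (ler_normD _ _))// lerD2l// normrM ler_piMr.
rewrite (_ : _ - _ = (F e - a - b * e) * G e +
  (a + b * e) * (G e - a' - b' * e) + (b * b') * e ^+ 2); last by ring.
rewrite (le_trans (ler_normD _ _))// [X in _ <= X]mulrDl.
rewrite [X in _ + X <= _]normrM [`|e ^+ 2|]ger0_norm// lerD2r.
rewrite (le_trans (ler_normD _ _))// [X in _ <= X]mulrDl lerD//.
  by rewrite normrM mulrAC ler_pM.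
by rewrite normrM -mulrA ler_pM.
Qed.

(** Only [1 + u <= expR u] at u and -u is used: (1 - u) e^u <= 1 gives e^u - 1 - u <= u (e^u - 1),
    which is at most u^2 e^u if u >= 0 and at most u^2 if u < 0. *)
Lemma expR_taylor2 u : `|expR u - 1 - u| <= u ^+ 2 * (expR u + expR (- u)).
Proof.
have h1 := expR_ge1Dx u; have h2 := expR_ge1Dx (- u).
have p1 := expR_gt0 u; have p2 := expR_gt0 (- u).
have h3 : expR u * expR (- u) = 1 by rewrite -expRD subrr expR0.
rewrite ger0_norm; last by rewrite -addrA -opprD subr_ge0.
have h4 : expR u - 1 - u <= u * (expR u - 1) by nra.
have [u0|u0] := leP 0 u; first by nra.
have : u * (expR u - 1) <= u ^+ 2 by nra.
nra.
Qed.

Lemma expR_norm_le u : expR `|u| <= expR u + expR (- u).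
Proof.
by case: (ler0P u) => _; rewrite ?lerDl ?lerDr ?expR_ge0.
Qed.

(** Serves for the closed form of E exp(h + e x) in a Gaussian space: there [a] is half the variance
    of h, [b] the covariance of h and x, and [c] half the variance of x. *)
Lemma jet_expR_quad a b c :
  jet (fun e => expR (a + b * e + c * e ^+ 2)) (expR a) (expR a * b).
Proof.
pose M := `|b| + `|c|.
exists (expR a * (M ^+ 2 * (expR M + expR M) + `|c|)) => e e1.
have e20 := sqr_ge0 e.
set u := b * e + c * e ^+ 2.
have uM : `|u| <= M * `|e|.
  rewrite (le_trans (ler_normD _ _))// mulrDl !normrM lerD2l//.
  by rewrite mulrA ler_piMr ?mulr_ge0.
have uM1 : `|u| <= M by rewrite (le_trans uM)// ler_piMr// addr_ge0.
rewrite -(addrA a) -/u (expRD a).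
rewrite (_ : _ - _ = expR a * (expR u - 1 - u + c * e ^+ 2)); last by rewrite /u; ring.
rewrite normrM ger0_norm ?expR_ge0// -mulrA ler_pM2l ?expR_gt0//.
rewrite (le_trans (ler_normD _ _))// mulrDl.
rewrite (normrM c) [`|e ^+ 2|]ger0_norm// lerD2r.
rewrite (le_trans (expR_taylor2 u))//.
have h1 : u ^+ 2 <= M ^+ 2 * e ^+ 2.
  rewrite -[u ^+ 2]real_normK ?num_real// -[e ^+ 2]real_normK ?num_real//.
  by rewrite -exprMn lerXn2r// ?nnegrE ?mulr_ge0 ?addr_ge0.
rewrite [X in _ <= X]mulrAC; apply: ler_pM => //; first exact: sqr_ge0.
move: uM1; rewrite ler_norml => /andP[u1 u2].
by rewrite lerD// ler_expR// lerNl.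
Qed.

End jets.

Section gaussian_space.
Context {d : measure_display} {T : measurableType d} {R : realType}.
Variable P : probability T R.
Implicit Types (f g h x Y : T -> R) (l : seq (T -> R)).
Local Notation Ex := (Ex P).
Local Notation has_moments := (has_moments P).

(** Centering is the absence of a linear term in the exponent, and [v] is not tied to the second
    moment: [gs_var_mgf] recovers both the mean 0 and v = E f^2. Degenerate laws are included, with
    v = 0. *)
Record gaussian_space (H : (T -> R) -> Prop) : Prop := GaussianSpace {
  gs_zero : H (fun=> 0);
  gs_lin : forall (c : R) f g, H f -> H g -> H (fun w => c * f w + g w);
  gs_meas : forall f, H f -> measurable_fun setT f;
  gs_mgf : forall f, H f -> exists v : R, forall t : R,
    (\int[P]_w (expR (t * f w))%:E = (expR (t ^+ 2 * v / 2))%:E)%E }.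

Variable H : (T -> R) -> Prop.
Hypothesis gsH : gaussian_space H.

Lemma gs_scale c f : H f -> H (fun w => c * f w).
Proof.
move=> Hf; have := gs_lin gsH c Hf (gs_zero gsH).
by under eq_fun do rewrite addr0.
Qed.

Lemma gs_add f g : H f -> H g -> H (fun w => f w + g w).
Proof.
move=> Hf Hg; have := gs_lin gsH 1 Hf Hg.
by under eq_fun do rewrite mul1r.
Qed.

Lemma gs_sum (I : Type) (s : seq I) (Q : pred I) (h : I -> T -> R) :
  (forall i, Q i -> H (h i)) -> H (fun w => \sum_(i <- s | Q i) h i w).
Proof.
move=> hh; elim: s => [|i s IH].
  by under eq_fun do rewrite big_nil; exact: gs_zero gsH.
case Qi: (Q i); under eq_fun do rewrite big_cons Qi; last exact: IH.
by apply: gs_add => //; exact: hh.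
Qed.

Lemma gs_expR f : H f -> has_moments (fun w => expR (f w)).
Proof.
move=> Hf; have mf := gs_meas gsH Hf; split=> [|p].
  exact: measurableT_comp.
have [v hv] := gs_mgf gsH Hf.
under eq_fun do rewrite -expRM_natl.
apply/integrableP; split.
  apply/measurable_EFinP; apply: measurableT_comp => //.
  exact: measurable_funM.
under eq_integral do rewrite gee0_abs ?lee_fin ?expR_ge0//.
by rewrite hv ltry.
Qed.

(** By |f| <= e^|f| <= e^f + e^(-f). *)
Lemma gs_moments f : H f -> has_moments f.
Proof.
move=> Hf; apply: (@has_moments_dominated _ _ _ _ _
  (fun w => expR (f w) + expR (-1 * f w))).
- exact: gs_meas gsH _ Hf.
- move=> w; rewrite mulN1r (le_trans _ (expR_norm_le (f w)))//.
  by rewrite (le_trans _ (expR_ge1Dx _))// lerDr.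
- by apply: has_momentsD; apply: gs_expR => //; exact: gs_scale.
Qed.

(** Derivation under the expectation: by [expR_taylor2] the remainder is at most e^2 times |Y| e^h
    x^2 (e^(ex) + e^(-ex)), and for |e| <= 1 each of the last two exponentials is below e^x +
    e^(-x). In the dominating function [B], the factor [Y w ^+ 2 + 1] stands for |Y|. *)
Lemma Ex_expR_jet Y h x : has_moments Y -> H h -> H x ->
  jet (fun e => Ex (fun w => Y w * expR (h w + e * x w)))
    (Ex (fun w => Y w * expR (h w))) (Ex (fun w => Y w * x w * expR (h w))).
Proof.
move=> mY Hh Hx.
have mx := gs_moments Hx; have mh := gs_expR Hh.
have Hhe e : H (fun w => h w + e * x w).
  by have := gs_lin gsH e Hx Hh; under eq_fun do rewrite addrC.
have mhe e := gs_expR (Hhe e).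
pose B w := (Y w ^+ 2 + 1) * (x w ^+ 2 * (expR (h w) *
  (2 * (expR (x w) + expR (-1 * x w))))).
have mx1 := gs_expR Hx; have mx2 := gs_expR (gs_scale (-1) Hx).
have mB : has_moments B by hm.
exists (Ex B) => e e1; have {}mhe := mhe e.
rewrite mulrC -ExZ; last by hm.
rewrite -ExB; [|hm|hm].
rewrite -ExB; [|hm|hm].
rewrite mulrC -ExZ//; apply: Ex_norm_le; [hm|hm|].
move=> w; rewrite expRD.
rewrite (_ : _ - _ = Y w * (expR (h w) * (expR (e * x w) - 1 - e * x w))); last by ring.
rewrite !normrM [`|expR (h w)|]ger0_norm ?expR_ge0// /B [X in _ <= X]mulrCA.
apply: ler_pM => //.
  rewrite -[_ ^+ 2]real_normK ?num_real//; have := normr_ge0 (Y w).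
  by move: `|_| => y ?; nra.
rewrite [X in _ <= X](_ : _ = expR (h w) * (e ^+ 2 * x w ^+ 2 *
  (2 * (expR (x w) + expR (-1 * x w))))); last by ring.
rewrite ler_pM2l ?expR_gt0// (le_trans (expR_taylor2 _))// exprMn.
apply: ler_wpM2l; first by rewrite mulr_ge0 ?sqr_ge0.
rewrite mulN1r mulrDl mul1r.
have ex : `|e * x w| <= `|x w| by rewrite normrM ler_piMl.
have hexp u : `|u| <= `|x w| -> expR u <= expR (x w) + expR (- x w).
  move=> ux; rewrite (le_trans _ (expR_norm_le _))// ler_expR.
  by rewrite (le_trans (ler_norm _)).
by rewrite lerD// hexp ?normrN.
Qed.

(** Comparing jets of t |-> E exp(t f) gives E (f e^(t f)) = t v e^(t^2 v / 2); t = 0 yields the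
    mean, and one more comparison of jets at 0 yields v = E f^2. *)
Lemma gs_var_mgf f : H f ->
  Ex f = 0 /\ forall t, Ex (fun w => expR (t * f w)) = expR (t ^+ 2 * Ex (fun w => f w ^+ 2) / 2).
Proof.
move=> Hf; have [v hv] := gs_mgf gsH Hf.
have Ev t : Ex (fun w => expR (t * f w)) = expR (t ^+ 2 * v / 2).
  by rewrite /Ex /Rintegral hv.
have E1 t : Ex (fun w => f w * expR (t * f w)) = t * v * expR (t ^+ 2 * v / 2).
  have h1 := Ex_expR_jet (has_moments_cst P 1) (gs_scale t Hf) Hf.
  have h2 := jet_expR_quad (t ^+ 2 * v / 2) (t * v) (v / 2).
  transitivity (Ex (fun w => 1 * f w * expR (t * f w))).
    by apply: eq_Ex => w; rewrite mul1r.
  rewrite (jet_uniq (jet_eq _ h1) h2) 1?mulrC//.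
  move=> e /=; under eq_fun do rewrite mul1r -mulrDl.
  by rewrite Ev; congr expR; field.
have E2 := Ex_expR_jet (gs_moments Hf) (gs_zero gsH) Hf.
have h3 := jetM (jet_id 0 v) (jet_expR_quad 0 0 (v / 2)).
have h4 : Ex (fun w => f w ^+ 2) = v.
  transitivity (Ex (fun w => f w * f w * expR 0)).
    by apply: eq_Ex => w; rewrite expR0 mulr1.
  rewrite (jet_uniq (jet_eq _ E2) h3) ?expR0 ?mul0r ?mulr1 ?add0r//.
  move=> e /=; under eq_fun do rewrite add0r.
  by rewrite E1 !add0r mul0r add0r; congr (_ * expR _); field.
split=> [|t]; last by rewrite h4.
have := E1 0; rewrite !mul0r.
by under eq_fun do rewrite mul0r expR0 mulr1.
Qed.

Lemma gs_mean f : H f -> Ex f = 0.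
Proof. by case/gs_var_mgf. Qed.

Lemma gs_Ex_expR f : H f -> Ex (fun w => expR (f w)) = expR (Ex (fun w => f w ^+ 2) / 2).
Proof.
move=> /gs_var_mgf[_ /(_ 1)]; rewrite expr1n mul1r => <-.
by under [in RHS]eq_fun do rewrite mul1r.
Qed.

End gaussian_space.

(** * Wick's formula and Gaussian integration by parts for polynomials *)

Section wick.
Context {d : measure_display} {T : measurableType d} {R : realType}.
Variable P : probability T R.
Implicit Types (f g h x F G : T -> R) (l : seq (T -> R)).
Local Notation Ex := (Ex P).
Local Notation has_moments := (has_moments P).

(** No centering: the elements of a Gaussian space have mean 0. *)
Definition cov g h : R := Ex (fun w => g w * h w).

Lemma covC g h : cov g h = cov h g.
Proof. by apply: eq_Ex => w; rewrite mulrC. Qed.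

Fixpoint prodl l : T -> R :=
  if l is x :: l' then fun w => x w * prodl l' w else fun=> 1.

(* The derivative of a product of elements of a Gaussian space in the direction
   [g], i.e. the derivation with [x |-> cov g x]. *)
Fixpoint dprod g l : T -> R :=
  if l is x :: l' then fun w => cov g x * prodl l' w + x w * dprod g l' w
  else fun=> 0.

Fixpoint all_in (H : (T -> R) -> Prop) l : Prop :=
  if l is x :: l' then H x /\ all_in H l' else True.

Lemma prodl_cat l l' w : prodl (l ++ l') w = prodl l w * prodl l' w.
Proof. by elim: l => [|x l IH] /=; rewrite ?mul1r// IH mulrA. Qed.

Lemma dprod_cat g l l' w :
  dprod g (l ++ l') w = dprod g l w * prodl l' w + prodl l w * dprod g l' w.
Proof.
elim: l => [|x l IH] /=; first by rewrite mul0r add0r mul1r.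
by rewrite IH prodl_cat; ring.
Qed.

Lemma all_in_cat H l l' : all_in H l -> all_in H l' -> all_in H (l ++ l').
Proof. by elim: l => [|x l IH] //= [Hx Hl] Hl'; split => //; exact: IH. Qed.

Variable H : (T -> R) -> Prop.
Hypothesis gsH : gaussian_space P H.

Lemma prodl_moments l : all_in H l -> has_moments (prodl l).
Proof.
elim: l => [|x l IH] /=; first by move=> _; exact: has_moments_cst.
by move=> [Hx Hl]; apply: has_momentsM; [exact: gs_moments gsH _ Hx|exact: IH].
Qed.

Lemma dprod_moments g l : all_in H l -> has_moments (dprod g l).
Proof.
elim: l => [|x l IH] /=; first by move=> _; exact: has_moments_cst.
move=> [Hx Hl]; have := IH Hl; have := prodl_moments Hl.
by have := gs_moments gsH Hx => *; hm.
Qed.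

(** The exponential makes the induction on [l] run: a new factor x is the derivative at e = 0 of the
    induction hypothesis with [h] replaced by h + e x. Deriving the coefficient cov(g, h + e x) =
    cov(g, h) + e cov(g, x) produces the new term of [dprod]. *)
Lemma wick_expR l g h : all_in H l -> H g -> H h ->
  Ex (fun w => g w * prodl l w * expR (h w)) =
  Ex (fun w => dprod g l w * expR (h w)) +
  cov g h * Ex (fun w => prodl l w * expR (h w)).
Proof.
move=> Hl Hg; elim: l Hl h => [_|x l IH [Hx Hl]] h Hh.
  have mg := gs_moments gsH Hg; have mh := gs_moments gsH Hh.
  transitivity (Ex (fun w => 1 * g w * expR (h w))).
    by apply: eq_Ex => w /=; rewrite mulr1 mul1r.
  have h1 := Ex_expR_jet gsH (has_moments_cst P 1) Hh Hg.
  pose v f := Ex (fun w => f w ^+ 2).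
  have h2 := jet_expR_quad (v h / 2) (cov g h) (v g / 2).
  rewrite (jet_uniq (jet_eq _ h1) h2); last first.
    move=> e; under eq_fun do rewrite mul1r.
    rewrite (gs_Ex_expR gsH); last first.
      by have := gs_lin gsH e Hg Hh; under eq_fun do rewrite addrC.
    congr expR; rewrite (_ : Ex _ = v h + 2 * e * cov g h + e ^+ 2 * v g).
      by field.
    rewrite -!ExZ -?ExD; try by hm.
    by apply: eq_Ex => w; ring.
  rewrite mulrC /=; under eq_fun do rewrite mul0r.
  rewrite Ex_cst add0r -(gs_Ex_expR gsH Hh).
  by under [in RHS]eq_fun do rewrite mul1r.
have Hhe e : H (fun w => h w + e * x w).
  by have := gs_lin gsH e Hx Hh; under eq_fun do rewrite addrC.
have mg := gs_moments gsH Hg; have mx := gs_moments gsH Hx.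
have ml := prodl_moments Hl; have mdl := dprod_moments g Hl.
have meh := gs_expR gsH Hh.
have ml' : has_moments (fun w => g w * prodl l w) by hm.
have h1 := Ex_expR_jet gsH ml' Hh Hx.
have h2 := jetD (Ex_expR_jet gsH mdl Hh Hx)
  (jetM (jet_id (cov g h) (cov g x)) (Ex_expR_jet gsH ml Hh Hx)).
transitivity (Ex (fun w => g w * prodl l w * x w * expR (h w))).
  by apply: eq_Ex => w /=; ring.
rewrite (jet_uniq (jet_eq _ h1) h2) => [|e /=]; last first.
  rewrite IH//; congr (_ + _ * _).
  have mh := gs_moments gsH Hh.
  rewrite /cov -ExZ -?ExD; [|by hm..].
  by apply: eq_Ex => w; ring.
rewrite /= -!ExZ -?ExD; [|by hm..].
by apply: eq_Ex => w; ring.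
Qed.

Lemma wick l g : all_in H l -> H g ->
  Ex (fun w => g w * prodl l w) = Ex (dprod g l).
Proof.
move=> Hl Hg; have := wick_expR Hl Hg (gs_zero gsH).
rewrite (_ : cov g (fun=> 0) = 0) ?mul0r ?addr0; last first.
  by rewrite /cov; under eq_fun do rewrite mulr0; rewrite Ex_cst.
move=> h; transitivity (Ex (fun w => g w * prodl l w * expR 0)).
  by apply: eq_Ex => w; rewrite expR0 mulr1.
by rewrite h; apply: eq_Ex => w; rewrite expR0 mulr1.
Qed.

(* [wder g F F'] : [F] is a polynomial in elements of [H] and [F'] is its image
   under the derivation [x |-> cov g x]. *)
Inductive wder g : (T -> R) -> (T -> R) -> Prop :=
| wder_prodl l : all_in H l -> wder g (prodl l) (dprod g l)
| wder_lin (c : R) F F' G G' : wder g F F' -> wder g G G' ->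
    wder g (fun w => c * F w + G w) (fun w => c * F' w + G' w).

Lemma wder_moments g F F' : wder g F F' -> has_moments F /\ has_moments F'.
Proof.
elim=> [l Hl|c {}F {}F' G G' _ [? ?] _ [? ?]]; last by split; hm.
by split; [exact: prodl_moments|exact: dprod_moments].
Qed.

Theorem wder_ibp g F F' : H g -> wder g F F' ->
  Ex (fun w => g w * F w) = Ex F'.
Proof.
move=> Hg; have mg := gs_moments gsH Hg.
elim=> [l Hl|c {}F {}F' G G' wF IF wG IG]; first exact: wick.
have [? ?] := wder_moments wF; have [? ?] := wder_moments wG.
rewrite ExD ?ExZ; [|by hm..].
rewrite -IF -IG -ExZ -?ExD; [|by hm..].
by apply: eq_Ex => w; ring.
Qed.

Lemma wder_eq g F F' G G' : F =1 G -> F' =1 G' -> wder g F F' -> wder g G G'.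
Proof. by move=> /funext -> /funext ->. Qed.

Lemma wder_cst g c : wder g (fun=> c) (fun=> 0).
Proof.
have h := @wder_prodl g [::] I.
by apply: wder_eq (wder_lin (c - 1) h h) => w /=; ring.
Qed.

Lemma wderD g F F' G G' : wder g F F' -> wder g G G' ->
  wder g (fun w => F w + G w) (fun w => F' w + G' w).
Proof.
by move=> hF hG; apply: wder_eq (wder_lin 1 hF hG) => w; rewrite mul1r.
Qed.

Lemma wderZ g c F F' : wder g F F' ->
  wder g (fun w => c * F w) (fun w => c * F' w).
Proof.
move=> hF; apply: wder_eq (wder_lin c hF (wder_cst g 0)) => w; by rewrite addr0.
Qed.

Lemma wder_id g h : H h -> wder g h (fun=> cov g h).
Proof.
move=> Hh; have /wder_eq := @wder_prodl g [:: h] (conj Hh I).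
by apply=> w /=; rewrite ?mulr1 ?mulr0 ?addr0.
Qed.

Lemma wderM g F F' G G' : wder g F F' -> wder g G G' ->
  wder g (fun w => F w * G w) (fun w => F' w * G w + F w * G' w).
Proof.
move=> hF; elim: hF G G' => [l Hl|c {}F {}F' K K' _ IF _ IK] G G'; last first.
  by move=> hG; apply: wder_eq (wder_lin c (IF _ _ hG) (IK _ _ hG)) => w; ring.
elim=> [l' Hl'|c {}G {}G' K K' _ IG _ IK]; last first.
  by apply: wder_eq (wder_lin c IG IK) => w; ring.
apply: wder_eq (@wder_prodl g (l ++ l') (all_in_cat Hl Hl')) => w.
  exact: prodl_cat.
exact: dprod_cat.
Qed.

Lemma wderX g F F' p : wder g F F' ->
  wder g (fun w => F w ^+ p) (fun w => p%:R * F w ^+ p.-1 * F' w).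
Proof.
move=> hF; elim: p => [|p IH].
  by apply: wder_eq (wder_cst g 1) => w; rewrite ?expr0 ?mul0r.
apply: wder_eq (wderM hF IH) => w; first by rewrite exprS.
case: p {IH} => [|p] /=; first by rewrite expr0; ring.
by rewrite exprS -[in RHS]natr1; ring.
Qed.

Lemma wder_sum g (I : Type) (s : seq I) (F F' : I -> T -> R) :
  (forall i, wder g (F i) (F' i)) ->
  wder g (fun w => \sum_(i <- s) F i w) (fun w => \sum_(i <- s) F' i w).
Proof.
move=> hF; elim: s => [|i s IH].
  by apply: wder_eq (wder_cst g 0) => w; rewrite big_nil.
by apply: wder_eq (wderD (hF i) IH) => w; rewrite big_cons.
Qed.

End wick.

(** * Moments of quadratic forms *)

Section kernel_powers.
Context {R : realType} {I : finType}.
Implicit Types (N : I -> I -> R).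

(* [kpow N r] is the matrix power N^(r+1). *)
Fixpoint kpow N (r : nat) : I -> I -> R :=
  if r is r'.+1 then fun a b => \sum_c N a c * kpow N r' c b else N.

(** Shifted like [kpow]: [ktrace N 1] is tr (N^2) and [ktrace N 3] is tr (N^4). *)
Definition ktrace N (r : nat) : R := \sum_a kpow N r a a.

End kernel_powers.

Section quadratic_forms.
Context {d : measure_display} {T : measurableType d} {R : realType}.
Variables (P : probability T R) (H : (T -> R) -> Prop).
Hypothesis gsH : gaussian_space P H.
Local Notation Ex := (Ex P).
Local Notation cov := (cov P).

Section fixed_form.
Context {I : finType}.
Variables (z : I -> T -> R) (wt : I -> R).
Hypothesis Hz : forall i, H (z i).

Definition qform w := \sum_i wt i * (z i w ^+ 2 - cov (z i) (z i)).
Definition wcov a b := wt a * cov (z a) (z b).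

Lemma gs_moments_fin : forall i, has_moments P (z i).
Proof. by move=> i; exact: gs_moments gsH _ (Hz i). Qed.

Lemma qform_moments : has_moments P qform.
Proof.
apply: has_moments_sum => i _; apply: has_momentsZ; apply: has_momentsB.
  by apply: has_momentsX; exact: gs_moments_fin.
exact: has_moments_cst.
Qed.

Let mQ := qform_moments.

Lemma wder_qform a :
  wder P H (z a) qform (fun w => \sum_c 2 * wcov c a * z c w).
Proof.
apply: wder_sum => i.
apply: wder_eq (wderZ (wt i) (wderD (wderX 2 (wder_id P (z a) (Hz i)))
  (wder_cst P H (z a) (- cov (z i) (z i))))) => w //.
by rewrite /wcov (covC _ (z i)) expr1; ring.
Qed.

(** Integration by parts of z a against z b Q^p: the derivation along z a sends z b to a constant
    and Q to twice the sum over c of [wcov c a] z c. *)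
Lemma Ex_quad_qformX a b p :
  Ex (fun w => z a w * z b w * qform w ^+ p) =
  cov (z a) (z b) * Ex (fun w => qform w ^+ p) + (2 * p)%:R *
  \sum_c wcov c a * Ex (fun w => z c w * z b w * qform w ^+ p.-1).
Proof.
have mz := gs_moments_fin; have ma := mz a; have mb := mz b.
have := wder_ibp gsH (Hz a)
  (wderM (wder_id P (z a) (Hz b)) (wderX p (wder_qform a))).
move=> h; transitivity (Ex (fun w => z a w * (z b w * qform w ^+ p))).
  by apply: eq_Ex => w; rewrite mulrA.
rewrite h -ExZ; last by hm.
have -> : \sum_c wcov c a * Ex (fun w => z c w * z b w * qform w ^+ p.-1) =
    Ex (fun w => \sum_c wcov c a * (z c w * z b w * qform w ^+ p.-1)).
  rewrite Ex_sum => [|c _]; last by have mc := mz c; hm.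
  by apply: eq_bigr => c _; rewrite ExZ//; have mc := mz c; hm.
have ms : has_moments P (fun w => \sum_c wcov c a * (z c w * z b w * qform w ^+ p.-1)).
  by apply: has_moments_sum => c _; have := mz c => ?; hm.
rewrite -ExZ// -ExD; [|by hm..].
apply: eq_Ex => w; congr (_ + _).
rewrite mulr_sumr !mulr_sumr; apply: eq_bigr => c _.
by rewrite natrM; ring.
Qed.

(** Each application of [Ex_quad_qformX] produces a factor 2, one factor of p (p - 1) ... and one
    more matrix product. Multiplying by [wt a] beforehand turns the covariances into entries of
    powers of [wcov]. *)
Lemma wEx_quad_qformX p a b :
  wt a * Ex (fun w => z a w * z b w * qform w ^+ p) =
  \sum_(i < p.+1) (2 ^ i * p ^_ i)%:R * Ex (fun w => qform w ^+ (p - i)) *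
    kpow wcov i a b.
Proof.
elim: p a b => [|p IH] a b.
  rewrite big_ord_recl big_ord0 Ex_quad_qformX /= mulrDr muln0 mul0r mulr0 !addr0.
  by rewrite mul1r mulrA mulrC.
rewrite Ex_quad_qformX big_ord_recl /= mulrDr; congr (_ + _).
  by rewrite mul1r mulrA mulrC.
rewrite mulr_sumr mulr_sumr.
transitivity (\sum_c (2 * p.+1)%:R * wcov a c *
    (wt c * Ex (fun w => z c w * z b w * qform w ^+ p))).
  by apply: eq_bigr => c _; rewrite /wcov (covC _ (z c)); ring.
under [LHS]eq_bigr do rewrite IH mulr_sumr.
rewrite exchange_big /=; apply: eq_bigr => i _.
rewrite mulr_sumr; apply: eq_bigr => c _.
by rewrite ffactSS expnS subSS !natrM; ring.
Qed.

Lemma Ex_qformXS p :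
  Ex (fun w => qform w ^+ p.+1) =
  \sum_(i < p) (2 ^ i.+1 * p ^_ i.+1)%:R * Ex (fun w => qform w ^+ (p - i.+1)) *
    ktrace wcov i.+1.
Proof.
have mz := gs_moments_fin.
transitivity (\sum_a (wt a * Ex (fun w => z a w * z a w * qform w ^+ p) -
    wcov a a * Ex (fun w => qform w ^+ p))).
  transitivity (Ex (fun w => \sum_a (wt a * (z a w * z a w * qform w ^+ p) -
      wcov a a * qform w ^+ p))).
    apply: eq_Ex => w; rewrite exprS {1}/qform mulr_suml.
    by apply: eq_bigr => a _; rewrite /wcov; ring.
  rewrite Ex_sum => [|a _]; last by have ma := mz a; hm.
  by apply: eq_bigr => a _; have ma := mz a; rewrite ExB ?ExZ//; hm.
(* The term i = 0 is [wcov a a] times E Q^p, exactly what the centering of the squares subtracts. *)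
under eq_bigr do rewrite wEx_quad_qformX big_ord_recl /= subn0 expn0 ffactn0 muln1
  mul1r addrC mulrC addKr.
rewrite exchange_big /=; apply: eq_bigr => i _.
by rewrite -mulr_sumr.
Qed.

End fixed_form.
End quadratic_forms.

Section moment_limits.
Context {R : realType}.

Lemma cvg_sumR (I : Type) (s : seq I) (u : I -> nat -> R) (l : I -> R) :
  (forall i, u i @ \oo --> l i) ->
  (fun n => \sum_(i <- s) u i n) @ \oo --> \sum_(i <- s) l i.
Proof. by move=> ul; apply: cvg_big => // ; exact: add_continuous. Qed.

(** Moments of N(0, v), by the recursion that integration by parts gives (see
    [gaussian_moments]). *)
Fixpoint gauss_moment (v : R) (p : nat) : R :=
  match p with
  | 0 => 1
  | 1 => 0
  | p'.+2 => p'.+1%:R * v * gauss_moment v p'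
  end.

Lemma gauss_momentSS v p :
  gauss_moment v p.+2 = p.+1%:R * v * gauss_moment v p.
Proof. by []. Qed.

(** Strong induction on p. In the recursion for the moment p + 2 only i = 0 survives in the limit,
    and there 2 (p + 1) tr (N^2) tends to (p + 1) v: this is the recursion of [gauss_moment]. *)
Lemma cumulant_cvg (e : nat -> nat -> R) (tr : nat -> nat -> R) (v : R) :
  (forall n, e n 0%N = 1) ->
  (forall n p, e n p.+1 =
    \sum_(i < p) (2 ^ i.+1 * p ^_ i.+1)%:R * e n (p - i.+1)%N * tr n i.+1) ->
  tr ^~ 1%N @ \oo --> v / 2 ->
  (forall r, tr ^~ r.+2 @ \oo --> (0 : R)) ->
  forall p, e ^~ p @ \oo --> gauss_moment v p.
Proof.
move=> e0 eS tr1 trr p.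
elim/ltn_ind: p => -[|[|p]] IH.
- by under eq_cvg do rewrite e0; exact: cvg_cst.
- by under eq_cvg do rewrite eS big_ord0; exact: cvg_cst.
rewrite (_ : e ^~ p.+2 = fun n =>
    (2 ^ 1 * p.+1 ^_ 1)%:R * e n p * tr n 1%N +
    \sum_(i < p) (2 ^ i.+2 * p.+1 ^_ i.+2)%:R * e n (p - i.+1)%N * tr n i.+2);
  last by apply/funext => n; rewrite eS big_ord_recl subn1.
rewrite gauss_momentSS -[X in _ --> X]addr0; apply: cvgD.
  rewrite (_ : _ * _ * _ = (2 ^ 1 * p.+1 ^_ 1)%:R * gauss_moment v p * (v / 2)).
    by apply: cvgM => //; apply: cvgM; [exact: cvg_cst|exact: IH].
  by rewrite expn1 ffactn1 natrM; field.
rewrite -[X in _ --> X](@big1_eq _ 0 +%R _ (index_enum 'I_p) xpredT).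
apply: cvg_sumR => i.
rewrite (_ : 0 = (2 ^ i.+2 * p.+1 ^_ i.+2)%:R *
  gauss_moment v (p - i.+1) * 0); last by rewrite mulr0.
apply: cvgM; last exact: trr.
apply: cvgM; [exact: cvg_cst|apply: IH].
by rewrite ltnS (leq_trans (leq_subr _ _)).
Qed.

End moment_limits.

(** * From moments to cosines *)

Section taylor.
Context {R : realType}.
Implicit Types (G : nat -> R -> R) (c B t x y : R).

Definition taylor_poly (q : nat) (a : nat -> R) : {poly R} :=
  \poly_(l < q) (a l / l`!%:R).

Lemma taylor_polyE q a t :
  (taylor_poly q a).[t] = \sum_(l < q) a l * t ^+ l / l`!%:R.
Proof. by rewrite horner_poly; apply: eq_bigr => l _; rewrite mulrAC. Qed.

Lemma deriv_taylor_poly q a :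
  (taylor_poly q.+1 a)^`() = taylor_poly q (a \o succn).
Proof.
apply/polyP => i; rewrite coef_deriv !coef_poly ltnS.
case: ifP => _; last by rewrite mul0rn.
rewrite factS natrM -mulr_natr /=; field.
by rewrite nat1r !pnatr_eq0 -lt0n fact_gt0.
Qed.

Lemma is_derive_ge0_le (f df : R -> R) x y : x <= y ->
  (forall t, x <= t <= y -> is_derive t 1 f (df t)) ->
  (forall t, x <= t <= y -> 0 <= df t) -> f x <= f y.
Proof.
move=> xy hd h0; have [||c] := @MVT_segment R f df x y xy.
- by move=> t /[!in_itv]/= /andP[/ltW xt /ltW ty]; apply: hd; rewrite xt.
- apply: derivable_within_continuous => t /[!in_itv]/= xty.
  by have [] := hd t xty.
rewrite in_itv/= => hc e; rewrite -subr_ge0 e mulr_ge0 ?subr_ge0//.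
exact: h0.
Qed.

(** Induction on q by monotonicity: the bound on the derivative of G - S makes Z - (G - S) and Z +
    (G - S) nondecreasing, and both vanish at 0. *)
Lemma taylor_unit q G c B :
  (forall l t, (l < q)%N -> 0 <= t <= 1 -> is_derive t 1 (G l) (G l.+1 t)) ->
  (forall t, 0 <= t <= 1 -> `|G q t - c| <= B) ->
  forall t, 0 <= t <= 1 ->
  `|G 0%N t - (taylor_poly q.+1 (fun l => if (l < q)%N then G l 0 else c)).[t]| <=
    B * t ^+ q / q`!%:R.
Proof.
elim: q G => [|q IH] G dG hB t t01.
  rewrite taylor_polyE big_ord_recl big_ord0 expr0 fact0 invr1 !mulr1 addr0.
  exact: hB.
have {}IH := IH (G \o succn) _ hB; set a := (fun l => _).
pose S := taylor_poly q.+2 a.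
have dS (u : R) : is_derive u 1 (fun u => S.[u])
    (taylor_poly q.+1 (fun l => if (l < q)%N then G l.+1 0 else c)).[u].
  by rewrite -(deriv_taylor_poly _ a); exact: is_derive_poly.
pose Z := taylor_poly q.+2 (fun l => if (l < q.+1)%N then 0 else B).
have ZE (u : R) : Z.[u] = B * u ^+ q.+1 / q.+1`!%:R.
  rewrite taylor_polyE big_ord_recr /= ltnn big1 ?add0r// => i _.
  by rewrite ltn_ord !mul0r.
have dZ (u : R) : is_derive u 1 (fun u => Z.[u]) (B * u ^+ q / q`!%:R).
  have -> : B * u ^+ q / q`!%:R = Z^`().[u].
    rewrite deriv_taylor_poly taylor_polyE big_ord_recr /= ltnn big1 ?add0r// => i _.
    by rewrite ltnS ltn_ord !mul0r.
  exact: is_derive_poly.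
have S0 : S.[0] = G 0%N 0.
  rewrite taylor_polyE big_ord_recl big1 ?addr0 => [|i _].
    by rewrite /a /= expr0 fact0 invr1 !mulr1.
  by rewrite expr0n /= mulr0 mul0r.
have Z0 : Z.[0] = 0 by rewrite ZE expr0n mulr0 mul0r.
have [t0 t1] := andP t01.
have key (e : R) : `|e| = 1 -> e * (G 0%N t - S.[t]) <= Z.[t].
  move=> e1; rewrite -subr_ge0.
  have := @is_derive_ge0_le (fun u => Z.[u] - e * (G 0%N u - S.[u]))
   (fun u => B * u ^+ q / q`!%:R - e * (G 1%N u -
    (taylor_poly q.+1 (fun l => if (l < q)%N then G l.+1 0 else c)).[u])) 0 t t0.
  rewrite Z0 S0 subrr mulr0 subrr; apply.
    move=> u /andP[u0 ut]; have u01 : 0 <= u <= 1 by rewrite u0 (le_trans ut).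
    have d0 := dG 0%N u isT u01; have d1 := dS u; have d2 := dZ u.
    exact: is_deriveB.
  move=> u /andP[u0 ut]; have u01 : 0 <= u <= 1 by rewrite u0 (le_trans ut).
  rewrite subr_ge0 (le_trans (ler_norm _))// normrM e1 mul1r.
  by apply: IH => // l v lq; exact: dG.
rewrite -/S -ZE ler_norml -[X in _ && X]mul1r; apply/andP; split.
  by rewrite lerNl -mulN1r key// normrN1.
by rewrite -[X in X <= _]mul1r key// normr1.
Qed.

(** Freezing the last derivative at [c] bounds the remainder by the distance of [F q] to [c],
    without any derivative of [F q]. At 0 this allows q = 2D, where V^(2D) need not be
    differentiable. *)
Lemma taylor_bound q (F : nat -> R -> R) x0 x c B :
  (forall l y, (l < q)%N -> Num.min x0 x <= y <= Num.max x0 x ->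
     is_derive y 1 (F l) (F l.+1 y)) ->
  (forall y, Num.min x0 x <= y <= Num.max x0 x -> `|F q y - c| <= B) ->
  `|F 0%N x - (\sum_(l < q) F l x0 * (x - x0) ^+ l / l`!%:R +
      c * (x - x0) ^+ q / q`!%:R)| <= B * `|x - x0| ^+ q / q`!%:R.
Proof.
move=> dF hB; pose G l t := (x - x0) ^+ l * F l (x0 + t * (x - x0)).
have seg t : 0 <= t <= 1 ->
    Num.min x0 x <= x0 + t * (x - x0) <= Num.max x0 x.
  move=> /andP[t0 t1]; case: (leP x0 x) => h; nra.
have dG l t : (l < q)%N -> 0 <= t <= 1 -> is_derive t 1 (G l) (G l.+1 t).
  move=> lq t01; have dl := dF l _ lq (seg t t01).
  have d1 : is_derive t 1 (fun t => x0 + t * (x - x0)) (x - x0).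
    pose p : {poly R} := x0%:P + (x - x0) *: 'X.
    have -> : (fun t => x0 + t * (x - x0)) = (fun t => p.[t]).
      by apply/funext => u; rewrite hornerD hornerC hornerZ hornerX mulrC.
    suff <- : p^`().[t] = x - x0 by exact: is_derive_poly.
    by rewrite derivD derivC add0r derivZ derivX hornerZ hornerC mulr1.
  have d2 : is_derive t 1 (F l \o (fun t => x0 + t * (x - x0)))
      (F l.+1 (x0 + t * (x - x0)) * (x - x0)) by exact: is_derive1_comp.
  rewrite (_ : G l = (x - x0) ^+ l \*: (F l \o (fun t => x0 + t * (x - x0))))//.
  apply: is_derive_eq; rewrite /G exprSr /GRing.scale /=; ring.
have hG t : 0 <= t <= 1 ->
    `|G q t - (x - x0) ^+ q * c| <= `|x - x0| ^+ q * B.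
  move=> t01; rewrite -mulrBr normrM normrX ler_wpM2l ?exprn_ge0//.
  exact: hB (seg t t01).
have := @taylor_unit q G _ _ dG hG 1; rewrite ler01 lexx => /(_ isT).
rewrite /G expr0 mul1r mul1r subrKC taylor_polyE big_ord_recr /= ltnn expr1n.
rewrite !mulr1 [X in _ -> _ <= X](_ : _ = `|x - x0| ^+ q * B / q`!%:R); last by ring.
congr (`|_ - (_ + _)| <= _); last by ring.
apply: eq_bigr => i _; rewrite ltn_ord mul0r addr0 expr1n; ring.
Qed.

End taylor.

Section cos_convergence.
Context {d : measure_display} {T : measurableType d} {R : realType}.
Variable P : probability T R.
Local Notation Ex := (Ex P).
Local Notation has_moments := (has_moments P).
Implicit Types (Y G : T -> R) (th v y : R).

Lemma has_moments_bounded (f : T -> R) (c : R) : measurable_fun setT f ->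
  (forall w, `|f w| <= c) -> has_moments f.
Proof.
by move=> mf fc; apply: has_moments_dominated fc _ => //; exact: has_moments_cst.
Qed.

Lemma measurable_cosD Y th : measurable_fun setT Y ->
  measurable_fun setT (fun w => cos (Y w + th)).
Proof.
move=> mY; apply: (measurableT_comp (f := @cos R)); last exact: measurable_funD.
by apply: continuous_measurable_fun; exact: continuous_cos.
Qed.

Lemma has_moments_cos Y th : measurable_fun setT Y ->
  has_moments (fun w => cos (Y w + th)).
Proof.
move=> mY; apply: (@has_moments_bounded _ 1); first exact: measurable_cosD.
by move=> w; rewrite ler_norml cos_geN1 cos_le1.
Qed.

Lemma cos_taylor y th q :
  `|cos (y + th) - \sum_(l < q) cos (th + l%:R * (pi / 2)) * y ^+ l / l`!%:R| <=
    `|y| ^+ q / q`!%:R.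
Proof.
have := @taylor_bound R q (fun l y => cos (y + (th + l%:R * (pi / 2)))) 0 y 0 1.
rewrite subr0 mul0r mul0r addr0 mul0r addr0 mul1r.
under eq_bigr do rewrite add0r.
apply=> [l z _ _|z _]; last by rewrite subr0 ler_norml cos_geN1 cos_le1.
have d1 : is_derive z 1 (fun z => z + (th + l%:R * (pi / 2))) 1.
  by apply: is_derive_eq; rewrite addr0.
have -> : cos (z + (th + l.+1%:R * (pi / 2))) = - sin (z + (th + l%:R * (pi / 2))).
  by rewrite -cosDpihalf; congr cos; rewrite -(natr1 l); ring.
have d2 := is_derive_cos (z + (th + l%:R * (pi / 2))).
have := @is_derive1_comp R cos (fun z => z + (th + l%:R * (pi / 2))) z _ _ d2 d1.
by rewrite mulr1.
Qed.

(** An even order makes the Taylor remainder a moment, without absolute value. *)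
Lemma Ex_cos_moments Y th N : has_moments Y ->
  `|Ex (fun w => cos (Y w + th)) -
    \sum_(l < N.*2) cos (th + l%:R * (pi / 2)) / l`!%:R * Ex (fun w => Y w ^+ l)| <=
  Ex (fun w => Y w ^+ N.*2) / N.*2`!%:R.
Proof.
move=> mY; have mc := has_moments_cos th (has_moments_measurable mY).
have mS : has_moments (fun w => \sum_(l < N.*2) cos (th + l%:R * (pi / 2)) / l`!%:R * Y w ^+ l).
  by apply: has_moments_sum => l _; hm.
have -> : \sum_(l < N.*2) cos (th + l%:R * (pi / 2)) / l`!%:R * Ex (fun w => Y w ^+ l) =
    Ex (fun w => \sum_(l < N.*2) cos (th + l%:R * (pi / 2)) / l`!%:R * Y w ^+ l).
  rewrite Ex_sum => [|l _]; last by hm.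
  by apply: eq_bigr => l _; rewrite ExZ//; hm.
rewrite -ExB// [X in _ <= X]mulrC -ExZ; last by hm.
apply: Ex_norm_le; [hm|hm|] => w.
have := cos_taylor (Y w) th N.*2.
rewrite -normrX (ger0_norm (exprn_even_ge0 _ _)) ?odd_double// [X in _ <= X]mulrC.
congr (`|_ - _| <= _).
by apply: eq_bigr => l _; rewrite mulrAC.
Qed.

(** Since (2N)! is the product of (2N-1)(2N-3)...1 and 2^N N!, the Gaussian remainder is the general
    term of an exponential series, which tends to 0. *)
Lemma gauss_moment_double v N :
  gauss_moment v N.*2 / N.*2`!%:R = exp_coeff (v / 2) N.
Proof.
rewrite /exp_coeff /=; elim: N => [|N IH]; first by rewrite expr0.
rewrite doubleS gauss_momentSS exprS.
rewrite !factS !natrM invfM !invfM.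
have nz (n : nat) : (n.+1%:R : R) != 0 by rewrite pnatr_eq0.
have -> : (N.*2.+2%:R : R) = N.+1%:R * 2 by rewrite -natrM muln2 doubleS.
transitivity (v / 2 / N.+1%:R * (gauss_moment v N.*2 / N.*2`!%:R)).
  have := nz N.*2; have := nz N; have : (N.*2`!%:R : R) != 0.
    by rewrite pnatr_eq0 -lt0n fact_gt0.
  by move=> *; field; do ?[apply/andP; split].
rewrite IH; have : (N`!%:R : R) != 0 by rewrite pnatr_eq0 -lt0n fact_gt0.
by have := nz N => *; field; do ?[apply/andP; split].
Qed.

Lemma moments_cvg_cos (Y : nat -> T -> R) G v th :
  (forall n, has_moments (Y n)) -> has_moments G ->
  (forall p, Ex (fun w => G w ^+ p) = gauss_moment v p) ->
  (forall p, (fun n => Ex (fun w => Y n w ^+ p)) @ \oo --> gauss_moment v p) ->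
  (fun n => Ex (fun w => cos (Y n w + th))) @ \oo -->
    Ex (fun w => cos (G w + th)).
Proof.
move=> mY mG EG EY; apply/cvgrPdist_lt => e e0.
(* The degree 2N is fixed before n. The factor 2 counts the remainder of G and the limit of that of
   Y n. *)
have /cvgrPdist_lt : (fun N => 2 * exp_coeff (v / 2) N) @ \oo --> (0 : R).
  rewrite -(mulr0 2); apply: cvgM; first exact: cvg_cst.
  exact: cvg_series_cvg_0 (is_cvg_series_exp_coeff _).
move=> /(_ e e0) [N _ /(_ N (leqnn N))] /=; rewrite sub0r normrN => hN.
pose c l := cos (th + l%:R * (pi / 2)) / l`!%:R.
pose u n := `|\sum_(l < N.*2) c l * (gauss_moment v l - Ex (fun w => Y n w ^+ l))| +
  (Ex (fun w => Y n w ^+ N.*2) / N.*2`!%:R + exp_coeff (v / 2) N).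
have cu : u @ \oo --> `|\sum_(l < N.*2) (0 : R)| +
    (gauss_moment v N.*2 / N.*2`!%:R + exp_coeff (v / 2) N).
  apply: cvgD; last by apply: cvgD; [apply: cvgM => //|]; exact: cvg_cst.
  apply: cvg_norm; apply: cvg_sumR => l.
  rewrite -(mulr0 (c l)); apply: cvgM; first exact: cvg_cst.
  by rewrite -(subrr (gauss_moment v l)); apply: cvgB => //; exact: cvg_cst.
move: cu; rewrite big1// normr0 add0r gauss_moment_double => cu.
have le2 : exp_coeff (v / 2) N + exp_coeff (v / 2) N < e.
  by rewrite -mulr2n -[_ *+ 2]mulr_natl (le_lt_trans (ler_norm _)).
have := @cvgr_lt _ _ _ _ _ _ cu _ le2.
move=> /(_ _); apply: filterS => n; apply: le_lt_trans.
have h1 := Ex_cos_moments th N (mY n); have h2 := Ex_cos_moments th N mG.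
rewrite EG gauss_moment_double in h2.
rewrite (eq_bigr (fun l : 'I_ _ => c l * gauss_moment v l)) in h2; last first.
  by move=> l _; rewrite EG.
rewrite /u; set A := \sum_(l < _) _ * gauss_moment _ _ in h2.
set B := \sum_(l < _) _ * Ex _ in h1.
have -> : \sum_(l < N.*2) c l * (gauss_moment v l - Ex (fun w => Y n w ^+ l)) = A - B.
  by rewrite /A /B -sumrB; apply: eq_bigr => l _; rewrite mulrBr.
set EY' := Ex (fun w => cos (Y n w + th)) in h1 *.
set EG' := Ex (fun w => cos (G w + th)) in h2 *.
rewrite (_ : EG' - EY' = (A - B) + ((B - EY') + (EG' - A))); last by ring.
rewrite (le_trans (ler_normD _ _))// lerD2l (le_trans (ler_normD _ _))// lerD//.
by rewrite distrC.
Qed.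

End cos_convergence.

(** * From cosines to bounded continuous functions *)

Section uniform_continuity_box.
Context {R : realType} {k : nat}.

(** Heine's theorem on a compact box. Only y stays in the box: p may leave it, as the interpolation
    nodes of [trig_approx] do. *)
Lemma continuous_box (f : 'rV[R]_k -> R) (L e : R) : continuous f -> 0 < e ->
  exists2 eta : R, 0 < eta & forall y p : 'rV[R]_k,
    (forall j, `|y 0 j| <= L) -> (forall j, `|p 0 j - y 0 j| < eta) ->
    `|f p - f y| <= e.
Proof.
move=> cf e0.
have /compact_near_coveringP cK : compact [set v : 'rV[R]_k | forall j : 'I_k, `[- L, L]%classic (v ord0 j)].
  by apply: (@rV_compact R k (fun=> `[- L, L]%classic)) => j; exact: segment_compact.
pose Pr (eta : R) (y : 'rV[R]_k) := forall p : 'rV[R]_k,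
  (forall j, `|p 0 j - y 0 j| < eta) -> `|f p - f y| <= e.
have := cK _ (0:R)^'+ Pr _; case => [y _|eta /= eta0 h].
  have /cvgrPdist_lt /(_ (e / 2)) := cf y; rewrite divr_gt0// => /(_ isT).
  move=> /nbhs_ballP[r /= r0 hr].
  exists (ball y (r / 2), [set eta : R | 0 < eta < r / 2]) => /=.
    split; first by apply: nbhsx_ballx; rewrite divr_gt0.
    exists (r / 2) => /=; first by rewrite divr_gt0.
    by move=> t /=; rewrite sub0r normrN => + t0; rewrite gtr0_norm// t0.
  move=> [y' eta] /= [[_ by'] /andP[eta0 etar]] p hp.
  have h1 := hr y' (conj r0 _); have h2 := hr p (conj r0 _).
  rewrite (_ : f p - f y' = (f y - f y') - (f y - f p)); last by ring.
  rewrite (le_trans (ler_normB _ _))// [leRHS](splitr e) lerD// ltW//.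
    by apply: h1 => i j; apply: le_ball (by' i j); rewrite ler_pdivrMr// ler_pMr//; lra.
  apply: h2 => i j; rewrite (ord1 i) [X in ball _ X](splitr r).
  apply: ball_triangle (by' 0 j) _; rewrite /ball /= distrC.
  by rewrite (lt_trans (hp j)).
exists (eta / 2); first by rewrite divr_gt0.
move=> y p hy hp; have := h (eta / 2); apply => //=.
- by rewrite sub0r normrN gtr0_norm ?divr_gt0// ltr_pdivrMr// ltr_pMr//; lra.
- by rewrite divr_gt0.
- by move=> j; rewrite in_itv/= -ler_norml.
Qed.

End uniform_continuity_box.

Section sine_gap.
Context {R : realType}.

Lemma cos_ge_half (z : R) : `|z| <= 3 / 4 -> 1 / 2 <= cos z.
Proof.
move=> hz; have := cos_taylor z 0 2.
rewrite big_ord_recl big_ord_recl big_ord0 /= addr0 mul0r addr0 cos0 expr0.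
rewrite !mul1r fact0 invr1 mulr1 add0r cos_pihalf !mul0r addr0 addr0.
rewrite ler_norml => /andP[+ _].
have z0 := normr_ge0 z.
have : `|z| ^+ 2 <= (3 / 4) ^+ 2 by rewrite lerXn2r// nnegrE; lra.
by rewrite (_ : 2`! = 2%N)//; lra.
Qed.

(** On |t| <= 3/4 the function sin t - t/2 is nondecreasing, so moving from u to u + e gains e/2;
    sin is still nondecreasing from u + e to v, which may go up to pi/2. *)
Lemma sin_gap_le (u v e : R) : 0 <= e <= 1 / 4 -> - (1 / 2) <= u <= 1 / 2 ->
  u + e <= v -> v <= pi / 2 -> e / 2 <= sin v - sin u.
Proof.
move=> /andP[e0 e1] /andP[u1 u2] uv v1; have p1 := @pihalf_ge1 R.
have h1 : sin (u + e) <= sin v.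
  apply: (is_derive_ge0_le (df := cos)) => // t /andP[t1 t2].
  by apply: cos_ge0_pihalf; apply/andP; split; lra.
have h2 : sin u - u / 2 <= sin (u + e) - (u + e) / 2.
  apply: (is_derive_ge0_le (f := fun t => sin t - t / 2)
    (df := fun t => cos t - 1 / 2)) => [|t _|t /andP[t1 t2]]; first lra.
    pose p : {poly R} := (1 / 2) *: 'X.
    have dp : is_derive t 1 (fun t => t / 2) (1 / 2 : R).
      have -> : (fun t : R => t / 2) = (fun t => p.[t]).
        by apply/funext => x; rewrite hornerZ hornerX; lra.
      suff <- : p^`().[t] = 1 / 2 by exact: is_derive_poly.
      by rewrite derivZ derivX hornerZ hornerC mulr1.
    exact: is_deriveB.
  rewrite subr_ge0 cos_ge_half// ler_norml; apply/andP; split; lra.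
lra.
Qed.

(** A quantitative inverse of the sine: u is kept in [-1/2, 1/2], away from the points where the
    derivative vanishes, while v ranges over all values of the arcsine. *)
Lemma sin_gap (e : R) : 0 < e -> exists2 c : R, 0 < c & forall u v : R,
  `|u| <= 1 / 2 -> `|v| <= pi / 2 -> `|sin v - sin u| < c -> `|v - u| < e.
Proof.
move=> e0; pose e' := Num.min e (1 / 4).
have e'0 : 0 < e' by rewrite lt_min e0; lra.
have e'1 : e' <= 1 / 4 by rewrite ge_min lexx orbT.
exists (e' / 2); first by rewrite divr_gt0.
move=> u v; rewrite !ler_norml => /andP[u1 u2] /andP[v1 v2].
rewrite ltr_norml => /andP[s1 s2].
suff : `|v - u| < e' by move=> /lt_le_trans; apply; rewrite ge_min lexx.
rewrite ltr_norml; apply/andP; split; rewrite ltNge; apply/negP => h.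
  have := @sin_gap_le (- u) (- v) e'; rewrite !sinN.
  have -> : 0 <= e' <= 1 / 4 by rewrite ltW.
  have -> : - (1 / 2) <= - u <= 1 / 2 by apply/andP; split; lra.
  by move=> /(_ isT isT); lra.
have := @sin_gap_le u v e'.
have -> : 0 <= e' <= 1 / 4 by rewrite ltW.
have -> : - (1 / 2) <= u <= 1 / 2 by apply/andP; split; lra.
by move=> /(_ isT isT); lra.
Qed.

End sine_gap.

(** * Bernstein polynomials in several variables *)

Section bernstein.
Context {R : realType}.
Implicit Types (x : R) (N i : nat).

(** Binomial probabilities by Pascal's recursion on one more toss: [bmeanS] conditions on that toss,
    and mean and variance follow by induction without binomial coefficients. *)
Fixpoint bern N i x : R :=
  if N is N'.+1 then
    (if i is i'.+1 then x * bern N' i' x else 0) + (1 - x) * bern N' i x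
  else (i == 0%N)%:R.

Lemma bern_ge0 N i x : 0 <= x <= 1 -> 0 <= bern N i x.
Proof.
move=> /andP[x0 x1]; elim: N i => [|N IH] [|i] //=.
  by rewrite add0r mulr_ge0 ?subr_ge0.
by rewrite addr_ge0 ?mulr_ge0 ?subr_ge0.
Qed.

Lemma bern_gt N i x : (N < i)%N -> bern N i x = 0.
Proof.
elim: N i => [|N IH] [|i] //=; rewrite ltnS => Ni.
by rewrite !IH ?mulr0 ?addr0// ltnW.
Qed.

Definition bmean N x (g : nat -> R) : R := \sum_(i < N.+1) bern N i x * g i.

Lemma bmeanS N x g :
  bmean N.+1 x g = x * bmean N x (g \o succn) + (1 - x) * bmean N x g.
Proof.
rewrite /bmean.
transitivity (\sum_(i < N.+2) (if i : nat is i'.+1 then x * bern N i' x * g i else 0) +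
    \sum_(i < N.+2) (1 - x) * bern N i x * g i).
  by rewrite -big_split /=; apply: eq_bigr => -[[|i] ?] _ /=; ring.
rewrite big_ord_recl add0r [X in _ + X]big_ord_recr /= bern_gt// mulr0 mul0r addr0.
by rewrite !mulr_sumr; congr (_ + _); apply: eq_bigr => i _; ring.
Qed.

Lemma bmean_lin N x a b (g h : nat -> R) :
  bmean N x (fun i => a * g i + b * h i) = a * bmean N x g + b * bmean N x h.
Proof.
by rewrite /bmean !mulr_sumr -big_split; apply: eq_bigr => i _ /=; ring.
Qed.

Lemma bmean1 N x : bmean N x (fun=> 1) = 1.
Proof.
elim: N => [|N IH]; first by rewrite /bmean big_ord_recl big_ord0 /= addr0 mul1r.
by rewrite bmeanS /comp IH; ring.
Qed.

Lemma bmean_centered N x : bmean N x (fun i => i%:R - N%:R * x) = 0.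
Proof.
elim: N => [|N IH].
  by rewrite /bmean big_ord_recl big_ord0 /= mul0r subrr mulr0 addr0.
rewrite bmeanS.
transitivity (x * bmean N x (fun i => 1 * (i%:R - N%:R * x) + (1 - x) * 1) +
   (1 - x) * bmean N x (fun i => 1 * (i%:R - N%:R * x) + (- x) * 1)).
  congr (_ * _ + _ * _); rewrite /bmean; apply: eq_bigr => i _; rewrite /comp/=;
  by rewrite -?natr1; ring.
by rewrite !bmean_lin bmean1 IH; ring.
Qed.

Lemma bmean_var N x :
  bmean N x (fun i => (i%:R - N%:R * x) ^+ 2) = N%:R * (x * (1 - x)).
Proof.
elim: N => [|N IH].
  by rewrite /bmean big_ord_recl big_ord0 /= mul0r subrr expr0n mulr0 addr0 mul0r.
rewrite bmeanS.
transitivity (x * bmean N x (fun i => 1 * (1 * ((i%:R - N%:R * x) ^+ 2) +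
      (2 * (1 - x)) * (i%:R - N%:R * x)) + (1 - x) ^+ 2 * 1) +
   (1 - x) * bmean N x (fun i => 1 * (1 * ((i%:R - N%:R * x) ^+ 2) +
      (- 2 * x) * (i%:R - N%:R * x)) + x ^+ 2 * 1)).
  congr (_ * _ + _ * _); rewrite /bmean; apply: eq_bigr => i _; rewrite /comp/=;
  by rewrite -?natr1; ring.
by rewrite !bmean_lin bmean1 bmean_centered IH -natr1; ring.
Qed.

Context {k : nat}.

Definition mbern N (ph : {ffun 'I_k -> 'I_N.+1}) (x : 'I_k -> R) : R :=
  \prod_j bern N (ph j) (x j).

Lemma mbern_ge0 N (ph : {ffun 'I_k -> 'I_N.+1}) (x : 'I_k -> R) :
  (forall j, 0 <= x j <= 1) -> 0 <= mbern ph x.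
Proof. by move=> x01; apply: prodr_ge0 => j _; exact: bern_ge0. Qed.

Lemma mbern_sum N (x : 'I_k -> R) :
  \sum_(ph : {ffun 'I_k -> 'I_N.+1}) mbern ph x = 1.
Proof.
rewrite -(bigA_distr_bigA (fun j (i : 'I_N.+1) => bern N i (x j))) big1// => j _.
rewrite -[RHS](bmean1 N (x j)); by apply: eq_bigr => i _; rewrite mulr1.
Qed.

(** Independence of the coordinates: each coordinate other than [l] contributes its total mass 1. *)
Lemma mbern_var N (x : 'I_k -> R) l :
  \sum_(ph : {ffun 'I_k -> 'I_N.+1}) mbern ph x * ((ph l)%:R - N%:R * x l) ^+ 2 =
  N%:R * (x l * (1 - x l)).
Proof.
pose g j (i : 'I_N.+1) := if j == l then (i%:R - N%:R * x l) ^+ 2 else 1 : R.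
transitivity (\sum_(ph : {ffun 'I_k -> 'I_N.+1})
    \prod_j (bern N (ph j) (x j) * g j (ph j))).
  apply: eq_bigr => ph _; rewrite big_split /=; congr (_ * _).
  by rewrite (bigD1 l)//= /g eqxx big1 ?mulr1// => j /negbTE ->.
rewrite -(bigA_distr_bigA (fun j (i : 'I_N.+1) => bern N i (x j) * g j i)).
rewrite (bigD1 l)//= [X in _ * X]big1 ?mulr1 => [|j jl].
  by rewrite -bmean_var; apply: eq_bigr => i _; rewrite /g eqxx.
rewrite -[RHS](bmean1 N (x j)); apply: eq_bigr => i _.
by rewrite /g (negbTE jl).
Qed.

End bernstein.

Section trigonometric_approximation.
Context {R : realType} {k : nat}.
Implicit Types (F G f : 'rV[R]_k -> R) (y : 'rV[R]_k).

(** The phase [th] covers sines, and null frequencies give constants. The product-to-sum formula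
    makes this span an algebra ([trigM]), so it contains every polynomial in the [sine_coord]. *)
Inductive trig : ('rV[R]_k -> R) -> Prop :=
| trig_cos (u : 'I_k -> R) (th : R) :
    trig (fun y => cos (\sum_i u i * y 0 i + th))
| trig_lin (c : R) F G : trig F -> trig G -> trig (fun y => c * F y + G y).

Lemma trig_eq F G : F =1 G -> trig F -> trig G.
Proof. by move=> /funext ->. Qed.

Lemma trig_cst c : trig (fun=> c).
Proof.
have h := trig_cos (fun=> 0) 0.
apply: trig_eq (trig_lin (c - 1) h h) => y.
rewrite big1 => [|i _]; last by rewrite mul0r.
by rewrite addr0 cos0; ring.
Qed.

Lemma trigD F G : trig F -> trig G -> trig (fun y => F y + G y).
Proof. by move=> hF hG; apply: trig_eq (trig_lin 1 hF hG) => y; rewrite mul1r. Qed.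

Lemma trigZ c F : trig F -> trig (fun y => c * F y).
Proof. by move=> hF; apply: trig_eq (trig_lin c hF (trig_cst 0)) => y; rewrite addr0. Qed.

Lemma trigM F G : trig F -> trig G -> trig (fun y => F y * G y).
Proof.
move=> hF hG; elim: hF => [u th|c {}F F' _ IF _ IF']; last first.
  by apply: trig_eq (trig_lin c IF IF') => y; ring.
elim: hG => [v ph|c {}G G' _ IG _ IG']; last first.
  by apply: trig_eq (trig_lin c IG IG') => y; ring.
have h1 := trig_cos (fun i => u i + v i) (th + ph).
have h2 := trig_cos (fun i => u i - v i) (th - ph).
apply: trig_eq (trigZ (1 / 2) (trigD h1 h2)) => y.
set a := \sum_i u i * _ + th; set b := \sum_i v i * _ + ph.
rewrite (_ : _ + (th + ph) = a + b); last first.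
  rewrite /a /b addrACA -big_split /=; congr (_ + _).
  by apply: eq_bigr => i _; ring.
rewrite (_ : _ + (th - ph) = a - b); last first.
  rewrite /a /b opprD addrACA -sumrB; congr (_ + _).
  by apply: eq_bigr => i _; ring.
by rewrite cosD cosB; field.
Qed.

Lemma trig_prod (I : Type) (s : seq I) (F : I -> 'rV[R]_k -> R) :
  (forall i, trig (F i)) -> trig (fun y => \prod_(i <- s) F i y).
Proof.
move=> hF; elim: s => [|i s IH].
  by apply: trig_eq (trig_cst 1) => y; rewrite big_nil.
by apply: trig_eq (trigM (hF i) IH) => y; rewrite big_cons.
Qed.

Lemma trig_sum (I : Type) (s : seq I) (F : I -> 'rV[R]_k -> R) :
  (forall i, trig (F i)) -> trig (fun y => \sum_(i <- s) F i y).
Proof.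
move=> hF; elim: s => [|i s IH].
  by apply: trig_eq (trig_cst 0) => y; rewrite big_nil.
by apply: trig_eq (trigD (hF i) IH) => y; rewrite big_cons.
Qed.

Lemma trig_bern N i F : trig F -> trig (fun y => bern N i (F y)).
Proof.
move=> hF; elim: N i => [|N IH] i /=; first exact: trig_cst.
have h : trig (fun y => (1 - F y) * bern N i (F y)).
  apply: trigM => //; apply: trigD; first exact: trig_cst.
  by apply: trig_eq (trigZ (-1) hF) => y; rewrite mulN1r.
apply: trigD => //; case: i {h} => [|i]; first exact: trig_cst.
exact: trigM.
Qed.

Definition sine_coord (l : R) (j : 'I_k) y : R := (1 + sin (y 0 j / l)) / 2.

Lemma trig_sine_coord l j : trig (sine_coord l j).
Proof.
have h := trig_cos (fun i => if i == j then l^-1 else 0) (- (pi / 2)).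
apply: trig_eq (trigZ (1 / 2) (trigD (trig_cst 1) h)) => y.
rewrite (bigD1 j)//= eqxx big1 ?addr0 => [|i /negbTE ->]; last by rewrite mul0r.
by rewrite cosBpihalf /sine_coord (mulrC l^-1); field.
Qed.

Lemma sine_coord01 l j y : 0 <= sine_coord l j y <= 1.
Proof.
rewrite /sine_coord; have := sin_le1 (y 0 j / l); have := sin_geN1 (y 0 j / l).
by move=> *; apply/andP; split; lra.
Qed.

(* The approximant is the Bernstein polynomial in the variables
   (1 + sin (y_j / l)) / 2, which is bounded by [B] on the whole space. *)
Lemma trig_approx f (B L e : R) : continuous f -> (forall y, `|f y| <= B) ->
  0 < L -> 0 < e -> exists2 F, trig F &
  (forall y, `|F y| <= B) /\
  (forall y, `|f y - F y| <= e + 2 * B / L ^+ 2 * \sum_j y 0 j ^+ 2).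
Proof.
(* With l = 2 L, a point of the box has y_j / l in [-1/2, 1/2], as [sin_gap] requires. *)
move=> cf fB L0 e0; pose l := 2 * L; have l0 : 0 < l by rewrite mulr_gt0.
have B0 : 0 <= B by rewrite (le_trans _ (fB 0)).
have e20 : 0 < e / 2 by rewrite divr_gt0.
have [eta eta0 heta] := continuous_box L cf e20.
have [c c0 hc] := sin_gap (divr_gt0 eta0 l0).
(* Read off the final estimate: the Chebyshev term 2 B (4 / (N^2 c^2)) k N is at most e / 2 for this
   N. *)
pose N := (Num.Def.truncn (2 * B * k%:R * 4 / (c ^+ 2 * (e / 2)))).+1.
have N0 : (0 : R) < N%:R by rewrite ltr0n.
(* The node at which the j-th variable (1 + sin (y_j / l)) / 2 equals [ph j] / N. *)
pose pt (ph : {ffun 'I_k -> 'I_N.+1}) : 'rV[R]_k :=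
  \row_j (l * asin (2 * (ph j)%:R / N%:R - 1)).
pose X y j := sine_coord l j y.
have W0 (ph : {ffun 'I_k -> 'I_N.+1}) y : 0 <= mbern ph (X y).
  by apply: mbern_ge0 => j; exact: sine_coord01.
exists (fun y => \sum_(ph : {ffun 'I_k -> 'I_N.+1}) f (pt ph) * mbern ph (X y)).
  apply: trig_sum => ph; apply: trigZ; apply: trig_prod => j.
  by apply: trig_bern; exact: trig_sine_coord.
split=> y.
  rewrite (le_trans (ler_norm_sum _ _ _))//.
  rewrite -[leRHS]mulr1 -(mbern_sum N (X y)) mulr_sumr ler_sum// => ph _.
  by rewrite normrM (ger0_norm (W0 _ _)) ler_wpM2r.
set F := \sum_ph _.
have FB : `|F| <= B.
  rewrite (le_trans (ler_norm_sum _ _ _))//.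
  rewrite -[leRHS]mulr1 -(mbern_sum N (X y)) mulr_sumr ler_sum// => ph _.
  by rewrite normrM (ger0_norm (W0 _ _)) ler_wpM2r.
have S0 : 0 <= \sum_j y 0 j ^+ 2 by apply: sumr_ge0 => j _; exact: sqr_ge0.
have BL0 : 0 <= 2 * B / L ^+ 2 by rewrite divr_ge0 ?exprn_ge0 ?mulr_ge0// ltW.
(* Off the box some y_j^2 exceeds L^2, and the crude bound 2 B is paid by the quadratic term. *)
have [/forallP hy|] := boolP [forall j, `|y 0 j| <= L]; last first.
  rewrite negb_forall => /existsP[j]; rewrite -ltNge => Ly.
  rewrite (le_trans (ler_normB _ _))//.
  rewrite (@le_trans _ _ (2 * B / L ^+ 2 * L ^+ 2))//.
    rewrite divfK ?mulr_natl ?mulr2n ?lerD// lt0r_neq0// exprn_gt0//.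
  rewrite (@le_trans _ _ (2 * B / L ^+ 2 * \sum_j y 0 j ^+ 2))//; last first.
    by rewrite lerDr ltW.
  rewrite ler_wpM2l// (bigD1 j)//= -[leLHS]addr0 lerD//.
    by rewrite -[leRHS]real_normK ?num_real// lerXn2r// ?nnegrE ltW.
  by apply: sumr_ge0 => i _; exact: sqr_ge0.
rewrite (@le_trans _ _ e)//; last by rewrite lerDl mulr_ge0.
have -> : f y - F = \sum_(ph : {ffun 'I_k -> 'I_N.+1}) (f y - f (pt ph)) * mbern ph (X y).
  rewrite /F -[X in X - _]mulr1 -(mbern_sum N (X y)) mulr_sumr -sumrB.
  by apply: eq_bigr => ph _; rewrite mulrBl.
pose D (ph : {ffun 'I_k -> 'I_N.+1}) j := (ph j)%:R - N%:R * X y j.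
(* Chebyshev's dichotomy: either the node is close to y in every coordinate and continuity applies,
   or some |D ph j| is at least c N / 2 and the crude bound 2 B is charged to its square. *)
have key (ph : {ffun 'I_k -> 'I_N.+1}) : `|f y - f (pt ph)| <=
    e / 2 + 2 * B * (4 / (N%:R ^+ 2 * c ^+ 2)) * \sum_j D ph j ^+ 2.
  have sinpt j : sin (pt ph 0 j / l) = 2 * (ph j)%:R / N%:R - 1.
    rewrite mxE mulrC mulKf ?gt_eqF// asinK// in_itv/=.
    have h : 0 <= ((ph j)%:R / N%:R : R) <= 1.
      by rewrite divr_ge0//= ler_pdivrMr// mul1r ler_nat -ltnS ltn_ord.
    by move: h => /andP[? ?]; apply/andP; split; lra.
  have DE j : sin (pt ph 0 j / l) - sin (y 0 j / l) = 2 / N%:R * D ph j.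
    rewrite sinpt /D /X /sine_coord; field; exact: lt0r_neq0.
  have Dsum : 0 <= \sum_j D ph j ^+ 2 by apply: sumr_ge0 => j _; exact: sqr_ge0.
  have K0 : 0 <= 2 * B * (4 / (N%:R ^+ 2 * c ^+ 2)).
    by rewrite !mulr_ge0// invr_ge0 mulr_ge0// sqr_ge0.
  have [/forallP hD|] := boolP [forall j, `|2 / N%:R * D ph j| < c].
    rewrite (@le_trans _ _ (e / 2))//; last by rewrite lerDl mulr_ge0.
    rewrite distrC; apply: heta => // j.
    have := hc (y 0 j / l) (pt ph 0 j / l).
    have hl z : `|z / l| = `|z| / l by rewrite normrM [`|l^-1|]gtr0_norm ?invr_gt0.
    rewrite DE -mulrBl (hl (_ - _)) ltr_pM2r ?invr_gt0//; apply => //.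
      by rewrite hl ler_pdivrMr// (le_trans (hy j))// /l; lra.
    rewrite mxE mulrC mulKf ?gt_eqF//.
    have h : -1 <= (2 * (ph j)%:R / N%:R - 1 : R) <= 1.
      by rewrite -sinpt sin_geN1 sin_le1.
    by rewrite ler_norml asin_geNpi2// asin_lepi2.
  rewrite negb_forall => /existsP[j]; rewrite -leNgt => cD.
  rewrite (@le_trans _ _ (2 * B))//.
    by rewrite (le_trans (ler_normB _ _))// mulr_natl mulr2n lerD.
  rewrite (@le_trans _ _ (2 * B * (4 / (N%:R ^+ 2 * c ^+ 2)) * \sum_j D ph j ^+ 2))//;
    last by rewrite lerDr ltW.
  rewrite -mulrA -[leLHS]mulr1 ler_wpM2l ?mulr_ge0//.
  have h1 : D ph j ^+ 2 <= \sum_j D ph j ^+ 2.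
    rewrite (bigD1 j)//= lerDl; apply: sumr_ge0 => i _; exact: sqr_ge0.
  have h2 : c ^+ 2 <= (2 / N%:R * D ph j) ^+ 2.
    by rewrite -[leRHS]real_normK ?num_real// lerXn2r// ?nnegrE ltW.
  rewrite (@le_trans _ _ (4 / (N%:R ^+ 2 * c ^+ 2) * D ph j ^+ 2))//; last first.
    by rewrite ler_wpM2l// divr_ge0// mulr_ge0// sqr_ge0.
  rewrite (_ : 4 / _ * _ = (2 / N%:R * D ph j) ^+ 2 / c ^+ 2).
    by rewrite ler_pdivlMr ?exprn_gt0// mul1r.
  by field; rewrite !gt_eqF.
rewrite (le_trans (ler_norm_sum _ _ _))//.
apply: (@le_trans _ _ (\sum_(ph : {ffun 'I_k -> 'I_N.+1})
   (e / 2 + 2 * B * (4 / (N%:R ^+ 2 * c ^+ 2)) * \sum_j D ph j ^+ 2) * mbern ph (X y))).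
  by apply: ler_sum => ph _; rewrite normrM (ger0_norm (W0 _ _)) ler_wpM2r.
under eq_bigr do rewrite mulrDl.
rewrite big_split /= -mulr_sumr mbern_sum mulr1.
under eq_bigr do rewrite -mulrA.
rewrite -mulr_sumr; under eq_bigr do rewrite mulr_suml.
rewrite exchange_big /=.
have hv j : \sum_(ph : {ffun 'I_k -> 'I_N.+1}) D ph j ^+ 2 * mbern ph (X y) <= N%:R.
  under eq_bigr do rewrite mulrC; rewrite mbern_var ler_piMr//.
  have /andP[? ?] := sine_coord01 l j y; rewrite /X; nra.
rewrite [leRHS](splitr e) lerD2l.
rewrite (@le_trans _ _ (2 * B * (4 / (N%:R ^+ 2 * c ^+ 2)) * (k%:R * N%:R)))//.
  rewrite ler_wpM2l//; first by rewrite !mulr_ge0// invr_ge0 mulr_ge0// sqr_ge0.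
  rewrite (le_trans (ler_sum _ (fun j _ => hv j)))//.
  by rewrite sumr_const card_ord -[_ *+ k]mulr_natl.
have hN : 2 * B * k%:R * 4 / (c ^+ 2 * (e / 2)) <= N%:R.
  by rewrite ltW// /N truncnS_gt.
rewrite (_ : _ * (k%:R * N%:R) = 2 * B * k%:R * 4 / c ^+ 2 / N%:R); last first.
  by field; rewrite !gt_eqF.
rewrite ler_pdivrMr//; move: hN; rewrite ler_pdivrMr ?mulr_gt0 ?exprn_gt0//.
rewrite [X in _ -> X <= _]mulrC ler_pdivrMl ?exprn_gt0//.
by congr (_ <= _); ring.
Qed.

End trigonometric_approximation.

Section measurable_continuous.
Context {d : measure_display} {T : measurableType d} {R : realType} {k : nat}.
Variable Z : T -> 'rV[R]_k.
Hypothesis mZ : forall j, measurable_fun setT (fun w => Z w 0 j).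

Lemma measurable_trig F : trig F -> measurable_fun setT (F \o Z).
Proof.
elim=> [u th|c {}F G _ IF _ IG].
  apply: (@measurable_cosD _ _ _ (fun w => \sum_i u i * Z w 0 i)).
  by apply: measurable_sum => i; exact: measurable_funM.
by apply: measurable_funD => //; exact: measurable_funM.
Qed.

(** A pointwise limit of trigonometric polynomials, with L = n + 1 and e = 1 / (n + 1) in
    [trig_approx]. The topology of row vectors is thus never compared with the product
    sigma-algebra. *)
Lemma measurable_continuous_row (f : 'rV[R]_k -> R) (B : R) : continuous f ->
  (forall y, `|f y| <= B) -> measurable_fun setT (f \o Z).
Proof.
move=> cf fB.
have ex n : exists F, trig F /\
    (forall y, `|f y - F y| <= n.+1%:R^-1 + 2 * B / n.+1%:R ^+ 2 * \sum_j y 0 j ^+ 2).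
  have n0 : (0 : R) < n.+1%:R by [].
  have n1 : (0 : R) < n.+1%:R^-1 by rewrite invr_gt0.
  have [F tF [_ hF]] := trig_approx cf fB n0 n1.
  by exists F.
have [F hF] := choice ex.
apply: (measurable_fun_cvg (h := fun n => F n \o Z)) => //.
  by move=> n; apply: measurable_trig; case: (hF n).
move=> w _; apply/cvgrPdist_le => e e0.
have B0 : 0 <= B by rewrite (le_trans _ (fB 0)).
have S0 : 0 <= \sum_j Z w 0 j ^+ 2 by apply: sumr_ge0 => j _; exact: sqr_ge0.
pose C := 1 + 2 * B * \sum_j Z w 0 j ^+ 2.
have C0 : 0 < C by rewrite ltr_pwDl// !mulr_ge0.
exists (Num.Def.truncn (C / e)) => // n /= hn.
have n0 : (0 : R) < n.+1%:R by [].
have [_ /(_ (Z w)) h] := hF n.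
rewrite (le_trans h)// (@le_trans _ _ (C / n.+1%:R))//; last first.
  rewrite ler_pdivrMr// mulrC -ler_pdivrMr// ltW// (lt_le_trans (truncnS_gt _))//.
  by rewrite ler_nat ltnS.
rewrite /C [leRHS]mulrDl [X in _ <= X + _]mul1r lerD2l mulrAC ler_wpM2l ?mulr_ge0//.
by rewrite lef_pV2 ?posrE ?exprn_gt0// expr2 ler_peMl// ler1n.
Qed.

End measurable_continuous.

Section levy.
Context {d : measure_display} {T : measurableType d} {R : realType} {k : nat}.
Variable P : probability T R.
Local Notation Ex := (Ex P).
Local Notation has_moments := (has_moments P).
Variables (Y : nat -> T -> 'rV[R]_k) (G : T -> 'rV[R]_k) (C : R).
Hypothesis mY : forall n j, has_moments (fun w => Y n w 0 j).
Hypothesis mG : forall j, has_moments (fun w => G w 0 j).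
Hypothesis YC : forall n j, Ex (fun w => Y n w 0 j ^+ 2) <= C.
Hypothesis GC : forall j, Ex (fun w => G w 0 j ^+ 2) <= C.
Hypothesis cos_cvg : forall (u : 'I_k -> R) (th : R),
  (fun n => Ex (fun w => cos (\sum_i u i * Y n w 0 i + th))) @ \oo -->
    Ex (fun w => cos (\sum_i u i * G w 0 i + th)).

Lemma trig_moments (Z : T -> 'rV[R]_k) F :
  (forall j, has_moments (fun w => Z w 0 j)) -> trig F -> has_moments (F \o Z).
Proof.
move=> mZ; elim=> [u th|c {}F K _ IF _ IK] /=; last first.
  apply: has_momentsD => //; exact: has_momentsZ.
apply: (@has_moments_cos _ _ _ P (fun w => \sum_i u i * Z w 0 i)).
apply: has_moments_measurable; apply: has_moments_sum => i _.
exact: has_momentsZ.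
Qed.

Lemma trig_cvg F : trig F -> (fun n => Ex (F \o Y n)) @ \oo --> Ex (F \o G).
Proof.
elim=> [u th|c {}F K tF IF tK IK]; first exact: cos_cvg.
have mFG := trig_moments mG tF; have mKG := trig_moments mG tK.
have -> : Ex ((fun y => c * F y + K y) \o G) = c * Ex (F \o G) + Ex (K \o G).
  by rewrite -ExZ// -ExD//; exact: has_momentsZ.
rewrite (_ : (fun n => _) = fun n => c * Ex (F \o Y n) + Ex (K \o Y n)).
  by apply: cvgD => //; apply: cvgM => //; exact: cvg_cst.
apply/funext => n; have mF := trig_moments (mY n) tF.
have mK := trig_moments (mY n) tK.
by rewrite -ExZ// -ExD//; exact: has_momentsZ.
Qed.

Lemma bounded_row_moments (Z : T -> 'rV[R]_k) (f : 'rV[R]_k -> R) (B : R) :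
  continuous f -> (forall y, `|f y| <= B) ->
  (forall j, has_moments (fun w => Z w 0 j)) -> has_moments (f \o Z).
Proof.
move=> cf fB mZ; apply: (@has_moments_bounded _ _ _ _ _ B) => [|w]; last exact: fB.
apply: measurable_continuous_row cf fB => j.
exact: has_moments_measurable (mZ j).
Qed.

(** The error of [trig_approx] grows like (2 B / L^2) |y|^2, so the uniform bound [C] on second
    moments takes care of the tails. *)
Lemma levy_continuity (f : 'rV[R]_k -> R) (B : R) :
  continuous f -> (forall y, `|f y| <= B) ->
  (fun n => Ex (f \o Y n)) @ \oo --> Ex (f \o G).
Proof.
move=> cf fB; apply/cvgrPdist_le => e e0.
have B0 : 0 <= B by rewrite (le_trans _ (fB 0)).
pose K := 2 * B * (k%:R * `|C|).
have K0 : 0 <= K by rewrite !mulr_ge0.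
(* As L >= 1, one has K / (e / 8) <= L <= L^2, whence K / L^2 <= e / 8. *)
pose L := 1 + K / (e / 8).
have L1 : 1 <= L by rewrite lerDl divr_ge0// divr_ge0// ltW.
have L0 : 0 < L by rewrite (lt_le_trans ltr01).
have e8 : 0 < e / 8 by rewrite divr_gt0.
have [F tF [FB hF]] := trig_approx cf fB L0 e8.
have KL : K / L ^+ 2 <= e / 8.
  rewrite ler_pdivrMr ?exprn_gt0// mulrC -ler_pdivrMr//.
  rewrite (@le_trans _ _ L)//; first by rewrite lerDr.
  by rewrite expr2 ler_peMl// ltW.
have dist (Z : T -> 'rV[R]_k) : (forall j, has_moments (fun w => Z w 0 j)) ->
    (forall j, Ex (fun w => Z w 0 j ^+ 2) <= C) ->
    `|Ex (f \o Z) - Ex (F \o Z)| <= e / 4.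
  move=> mZ ZC; have mf := bounded_row_moments cf fB mZ.
  have mF := trig_moments mZ tF.
  have mZ2 : has_moments (fun w => \sum_j Z w 0 j ^+ 2).
    by apply: has_moments_sum => j _; apply: has_momentsX; exact: mZ.
  have mb : has_moments (fun w => e / 8 + 2 * B / L ^+ 2 * \sum_j Z w 0 j ^+ 2).
    by hm.
  rewrite -ExB//; apply: (@le_trans _ _ (Ex (fun w => e / 8 + 2 * B / L ^+ 2 * \sum_j Z w 0 j ^+ 2))).
    apply: Ex_norm_le => //; first by apply: has_momentsB.
    by move=> w; exact: hF.
  rewrite ExD ?ExZ ?Ex_cst; [|by hm..].
  rewrite (_ : e / 4 = e / 8 + e / 8); last by field.
  rewrite lerD2l (le_trans _ KL)// /K mulrAC; apply: ler_wpM2r.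
    by rewrite invr_ge0 exprn_ge0// ltW.
  apply: ler_wpM2l; first by rewrite mulr_ge0.
  rewrite Ex_sum => [|j _]; last by apply: has_momentsX; exact: mZ.
  apply: (@le_trans _ _ (\sum_(j < k) `|C|)).
    by apply: ler_sum => j _; rewrite (le_trans (ZC j))// ler_norm.
  by rewrite sumr_const card_ord -[_ *+ k]mulr_natl.
have e2 : 0 < e / 2 by rewrite divr_gt0.
have /cvgrPdist_le /(_ _ e2) := trig_cvg tF.
apply: filterS => n hn.
have h1 := dist _ (mY n) (YC n); have h2 := dist _ mG GC.
rewrite (_ : _ - _ = (Ex (f \o G) - Ex (F \o G)) +
  ((Ex (F \o G) - Ex (F \o Y n)) - (Ex (f \o Y n) - Ex (F \o Y n)))); last by ring.
rewrite (le_trans (ler_normD _ _))// (_ : e = e / 4 + (e / 2 + e / 4)); last by field.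
by rewrite lerD// (le_trans (ler_normB _ _))// lerD.
Qed.

End levy.

(** * Traces of powers of power-law kernels *)

Section kernel_power_bounds.
Context {R : realType} {I : finType}.
Variables (N kap : I -> I -> R) (theta rho c0 : R).
Hypothesis kap0 : forall a b, 0 <= kap a b.
Hypothesis theta0 : 0 <= theta.
Hypothesis Nkap : forall a b, `|N a b| <= theta * kap a b.
Hypothesis rowsum : forall a, \sum_b kap a b <= rho.
Hypothesis kap2 : forall a b, \sum_c kap a c * kap c b <= c0.

(** Among the r + 2 factors, the last two are summed together by [kap2], and each of the r others
    costs one row sum. *)
Lemma kpow_bound r a b : `|kpow N r.+1 a b| <= theta ^+ r.+2 * c0 * rho ^+ r.
Proof.
have step s x y : `|kpow N s.+1 x y| <= \sum_c theta * kap x c * `|kpow N s c y|.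
  rewrite /= (le_trans (ler_norm_sum _ _ _))//; apply: ler_sum => c _.
  by rewrite normrM ler_wpM2r.
have c00 : 0 <= c0.
  by apply: le_trans (kap2 a b); apply: sumr_ge0 => c _; rewrite mulr_ge0.
have rho0 : 0 <= rho by apply: le_trans (rowsum a); exact: sumr_ge0.
elim: r a b => [|r IH] a b; apply: le_trans (step _ _ _) _.
  rewrite expr0 mulr1; apply: (@le_trans _ _ (\sum_c theta ^+ 2 * (kap a c * kap c b))).
    apply: ler_sum => c _; rewrite expr2 mulrACA ler_wpM2l// ?mulr_ge0//.
  by rewrite -mulr_sumr ler_wpM2l// exprn_ge0.
apply: (@le_trans _ _ (\sum_c theta * kap a c * (theta ^+ r.+2 * c0 * rho ^+ r))).
  by apply: ler_sum => c _; rewrite ler_wpM2l ?mulr_ge0// IH.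
rewrite -mulr_suml -mulr_sumr.
rewrite (_ : theta ^+ r.+3 * c0 * rho ^+ r.+1 =
  theta * rho * (theta ^+ r.+2 * c0 * rho ^+ r)); last by rewrite !exprS; ring.
apply: ler_wpM2r; last exact: ler_wpM2l.
by apply: mulr_ge0; [apply: mulr_ge0|]; rewrite ?exprn_ge0.
Qed.

Lemma ktrace_bound r :
  `|ktrace N r.+1| <= #|I|%:R * (theta ^+ r.+2 * c0 * rho ^+ r).
Proof.
rewrite (le_trans (ler_norm_sum _ _ _))//.
apply: (@le_trans _ _ (\sum_(a : I) theta ^+ r.+2 * c0 * rho ^+ r)).
  by apply: ler_sum => a _; exact: kpow_bound.
by rewrite sumr_const [leRHS]mulr_natl.
Qed.

End kernel_power_bounds.

Section power_kernel.
Context {R : realType}.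
Implicit Types (b q : R) (n m i j : nat).

Lemma is_derive_powR (x q : R) : 0 < x ->
  is_derive x 1 (@powR R ^~ q) (q * x `^ (q - 1)).
Proof.
move=> x0; have xin : x \in `]0, +oo[%R by rewrite in_itv/= x0.
have := powR_derive1 q xin => <-.
by rewrite derive1E; apply: derivableP; exact: derivable_powR.
Qed.

(** Comparison of a sum with an integral, by the mean value theorem. Dividing by [q] keeps one
    statement for q = 1 + b > 0 (row sums) and q = 1 + 2 b < 0 (sums of squares). *)
Lemma powR_sub_ge n q : q < 1 -> q != 0 -> (0 < n)%N ->
  n.+1%:R `^ (q - 1) <= (n.+1%:R `^ q - n%:R `^ q) / q.
Proof.
move=> q1 q0 n0; have n0R : (0 : R) < n%:R by rewrite ltr0n.
have [|||x] := @MVT_segment R (@powR R ^~ q) (fun x => q * x `^ (q - 1)) n%:R n.+1%:R.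
- by rewrite ler_nat.
- move=> x /[!in_itv]/= /andP[nx _]; apply: is_derive_powR; exact: lt_trans nx.
- apply: derivable_within_continuous => x /[!in_itv]/= /andP[nx _].
  by have [] := is_derive_powR q (lt_le_trans n0R nx).
rewrite in_itv/= => /andP[nx xn] ->.
rewrite (_ : n.+1%:R - _ = 1) ?mulr1 1?mulrC ?mulKf//; last first.
  by rewrite -(natr1 n) addrC addKr.
have x0 : 0 < x by exact: lt_le_trans nx.
rewrite -(opprB 1) !powRN lef_pV2 ?posrE ?powR_gt0// ?nat1r//.
by rewrite ge0_ler_powR// ?nnegrE ?(ltW x0)// ?subr_ge0 ?(ltW q1)// natr1.
Qed.

Lemma sum_powR_le n q : q < 1 -> q != 0 ->
  \sum_(1 <= m < n.+2) m%:R `^ (q - 1) <= 1 + (n.+1%:R `^ q - 1) / q.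
Proof.
move=> q1 q0; elim: n => [|n IH].
  by rewrite big_nat1 powR1 subrr mul0r addr0.
rewrite big_nat_recr//= (le_trans (lerD IH (powR_sub_ge q1 q0 _)))//.
rewrite -addrA lerD2l -mulrDl.
by rewrite addrC addrA subrK.
Qed.

(** Since 0 to a nonzero power is 0, a plain power would force diagonal entries to vanish;
    truncating at 1 gives them weight 1. *)
Definition kap b m : R := (maxn 1 m)%:R `^ b.

Lemma kap_ge0 b m : 0 <= kap b m.
Proof. exact: powR_ge0. Qed.

Lemma kap_sum_le b n : -1 < b < 0 ->
  \sum_(m < n) kap b m <= 1 + n%:R `^ (1 + b) / (1 + b).
Proof.
move=> /andP[b1 b0]; have b10 : 0 < 1 + b by lra.
case: n => [|n]; first by rewrite big_ord0 addr_ge0// divr_ge0 ?powR_ge0// ltW.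
rewrite big_ord_recl /kap powR1 lerD2l.
case: n => [|n].
  by rewrite big_ord0 divr_ge0 ?powR_ge0// ltW.
rewrite -(big_mkord xpredT (fun i => (maxn 1 i.+1)%:R `^ b)).
have h := @sum_powR_le n (1 + b); rewrite big_add1 /= in h.
rewrite (eq_bigr (fun i : nat => i.+1%:R `^ (1 + b - 1))); last first.
  by move=> i _; rewrite maxnSS max0n addrC addKr.
rewrite (le_trans (h _ _))//; [lra|by rewrite gt_eqF|].
rewrite mulrBl mul1r [leLHS]addrCA -lerBrDl.
apply: (@le_trans _ _ 0); first by rewrite subr_le0 invf_ge1//; lra.
rewrite subr_ge0 ler_wpM2r ?invr_ge0 ?(ltW b10)//.
by rewrite ge0_ler_powR ?nnegrE ?(ltW b10)// ler_nat.
Qed.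

(** As 2 b < -1 the squares are summable, uniformly in n, whereas the bound of [kap_sum_le] grows
    like n^(1 + b). *)
Lemma kap2_sum_le b n : b < - (1 / 2) ->
  \sum_(m < n) kap b m ^+ 2 <= 2 + (- (1 + 2 * b))^-1.
Proof.
move=> b1; have q0 : 0 < - (1 + 2 * b) by lra.
have iq0 : 0 < (- (1 + 2 * b))^-1 by rewrite invr_gt0.
case: n => [|n]; first by rewrite big_ord0; lra.
rewrite big_ord_recl /kap powR1 expr1n.
case: n => [|n]; first by rewrite big_ord0; lra.
rewrite -(big_mkord xpredT (fun i => ((maxn 1 i.+1)%:R `^ b) ^+ 2)).
have h := @sum_powR_le n (1 + 2 * b); rewrite big_add1 /= in h.
rewrite (eq_bigr (fun i : nat => i.+1%:R `^ (1 + 2 * b - 1))); last first.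
  by move=> i _; rewrite maxnSS max0n addrC addKr mulrC powRrM powR_mulrn ?powR_ge0.
have {}h := h _ _; rewrite (le_trans (lerD (lexx 1) (h _ _)))//; [lra| |].
  by rewrite -oppr_eq0 gt_eqF.
rewrite addrA lerD2l -[X in _ <= X]mul1r -[X in X <= _]opprK -mulrN -mulNr opprB -invrN.
by rewrite ler_wpM2r ?(ltW iq0)// gerBl powR_ge0.
Qed.

Definition ndist i j := (i - j + (j - i))%N.

Lemma ndistC i j : ndist i j = ndist j i.
Proof. by rewrite /ndist addnC. Qed.

(** Every distance is reached at most twice, once on each side of i. *)
Lemma sum_ndist_le (g : nat -> R) i n : (forall m, 0 <= g m) -> (i < n)%N ->
  \sum_(j < n) g (ndist i j) <= 2 * \sum_(m < n) g m.
Proof.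
move=> g0 iN; rewrite -(big_mkord xpredT (fun j => g (ndist i j))).
rewrite -(big_mkord xpredT g).
rewrite (big_cat_nat (n := i.+1))//= mulr_natl mulr2n lerD//.
  rewrite big_nat_rev /= add0n.
  rewrite (eq_big_nat _ _ (F2 := g)); last first.
    by move=> j /andP[_ ji]; rewrite subSS /ndist subKn// (eqP (leq_subr _ _)) addn0.
  rewrite [leRHS](big_cat_nat (n := i.+1))//= lerDl.
  exact: sumr_ge0.
rewrite -{1}[i.+1]add0n big_addn (eq_big_nat _ _ (F2 := g \o succn)); last first.
  move=> j _; rewrite /ndist addnS (eqP (_ : (i <= _)%N)) ?add0n; last first.
    by rewrite leqW// leq_addl.
  by rewrite subSn ?leq_addl// addnK.
case: n iN => // n iN; rewrite subSS.
rewrite [leRHS]big_nat_recl//= ler_wpDl//.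
rewrite [leRHS](big_cat_nat (n := (n - i)%N)) ?leq_subr//= lerDl.
exact: sumr_ge0.
Qed.

Lemma cvg_expn (u : nat -> R) (l : R) (p : nat) :
  u @ \oo --> l -> (fun n => u n ^+ p) @ \oo --> l ^+ p.
Proof.
move=> ul; elim: p => [|p IH]; first exact: cvg_cst.
rewrite exprS (_ : (fun n => _) = fun n => u n * u n ^+ p); first exact: cvgM.
by apply/funext => n; rewrite exprS.
Qed.

Lemma powRN_cvg0 (p : R) : 0 < p ->
  (fun n : nat => n%:R `^ (- p)) @ \oo --> (0 : R).
Proof.
move=> p0; apply/cvgrPdist_le => e e0.
exists (Num.Def.truncn (e `^ (- p^-1))).+1 => // n /= hn.
rewrite sub0r normrN ger0_norm ?powR_ge0// powRN.
have n0 : (0 : R) < n%:R by rewrite ltr0n (leq_trans _ hn).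
rewrite invf_ple ?posrE ?powR_gt0//.
have h : e `^ (- p^-1) <= n%:R.
  by rewrite ltW// (lt_le_trans (truncnS_gt _))// ler_nat.
rewrite (_ : e^-1 = (e `^ (- p^-1)) `^ p); last first.
  by rewrite -powRrM mulNr mulVf ?gt_eqF// powR_inv1// ltW.
by rewrite ge0_ler_powR ?nnegrE ?powR_ge0// ltW.
Qed.

(** The trace of the power r + 3 has k n diagonal terms, and two of the factors n^(-1/2) absorb n.
    There remain r + 1 factors, each a row sum over n^(1/2), hence of order n^(-1/2) + n^(b + 1/2),
    which tends to 0 as b < -1/2. *)
Lemma ktrace_power_kernel_cvg (k : nat) (K b : R)
    (N : forall n, 'I_k * 'I_n -> 'I_k * 'I_n -> R) :
  -1 < b < - (1 / 2) ->
  (\forall n \near \oo, forall x y : 'I_k * 'I_n,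
     `|N n x y| <= K / n%:R `^ (1 / 2) * kap b (ndist x.2 y.2)) ->
  forall r, (fun n => ktrace (N n) r.+2) @ \oo --> (0 : R).
Proof.
move=> /andP[b1 b2] hN r; have b10 : 0 < 1 + b by lra.
have b20 : 0 < - (1 + 2 * b) by lra.
pose K0 := `|K|; pose c0 := k%:R * (2 * (2 + (- (1 + 2 * b))^-1)).
pose rho n : R := k%:R * (2 * (1 + n%:R `^ (1 + b) / (1 + b))).
pose u n : R := k%:R * (K0 ^+ r.+3 * c0) * (rho n / n%:R `^ (1 / 2)) ^+ r.+1.
have cu : u @ \oo --> (0 : R).
  rewrite (_ : 0 = k%:R * (K0 ^+ r.+3 * c0) *
      (k%:R * (2 * (0 + 0 / (1 + b)))) ^+ r.+1); last first.
    by rewrite mul0r addr0 !mulr0 expr0n mulr0.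
  apply: cvgM; first exact: cvg_cst.
  apply: cvg_expn.
  pose v n : R := k%:R * (2 * (n%:R `^ (- (1 / 2)) + n%:R `^ (- (- (1 / 2) - b)) / (1 + b))).
  apply: (@cvg_trans _ (v n @[n --> \oo])).
    apply: near_eq_cvg; exists 1%N => // n /= n0.
    have n0R : (n%:R : R) != 0 by rewrite pnatr_eq0 -lt0n.
    rewrite /v /rho -mulrA -mulrA; congr (_ * (_ * _)).
    rewrite [RHS]mulrDl -powRN; congr (_ + _); first by rewrite [RHS]mul1r.
    rewrite mulrAC -powRD ?n0R ?implybT//.
    by congr (_ `^ _ / _); field.
  apply: cvgM; first exact: cvg_cst.
  apply: cvgM; first exact: cvg_cst.
  apply: cvgD; first by apply: powRN_cvg0; lra.
  by apply: cvgM; [apply: powRN_cvg0; lra|exact: cvg_cst].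
apply/cvgrPdist_le => e e0.
have /cvgrPdist_le /(_ e e0) := cu; apply: filter_app.
have n1 : \forall n \near \oo, (0 < n)%N by exists 1%N.
move: n1; apply: filter_app; apply: filterS hN => n {}hN n0.
rewrite !sub0r !normrN => hu.
apply: le_trans (le_trans (ler_norm _) hu).
have s0 : (0 : R) < n%:R `^ (1 / 2) by rewrite powR_gt0// ltr0n.
have hb0 : -1 < b < 0 by rewrite b1 /=; lra.
pose kp (x y : 'I_k * 'I_n) := kap b (ndist x.2 y.2).
have pairs (g : nat -> R) (x : 'I_k * 'I_n) : (forall m, 0 <= g m) ->
    \sum_(y : 'I_k * 'I_n) g (ndist x.2 y.2) <= k%:R * (2 * \sum_(m < n) g m).
  move=> g0; rewrite -(pair_bigA _ (fun (_ : 'I_k) (j : 'I_n) => g (ndist x.2 j)))/=.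
  rewrite sumr_const card_ord -[_ *+ k]mulr_natl ler_wpM2l//.
  exact: sum_ndist_le.
have := @ktrace_bound R _ (N n) kp (K0 / n%:R `^ (1 / 2)) (rho n) c0 _ _ _ _ _ r.+1.
rewrite card_prod !card_ord => h.
apply: le_trans (h _ _ _ _ _) _.
- by move=> x y; exact: kap_ge0.
- by rewrite divr_ge0 ?normr_ge0 ?powR_ge0.
- move=> x y; rewrite (le_trans (hN x y))// ler_wpM2r ?kap_ge0//.
  by rewrite ler_wpM2r ?invr_ge0 ?powR_ge0// ler_norm.
- move=> x; rewrite (le_trans (pairs _ _ (kap_ge0 b)))// ler_wpM2l// ler_wpM2l//.
  exact: kap_sum_le.
(* The inequality 2 u v <= u^2 + v^2 replaces Cauchy-Schwarz. *)
- move=> x y; apply: (@le_trans _ _ (\sum_z (1 / 2 * kp x z ^+ 2 + 1 / 2 * kp y z ^+ 2))).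
    apply: ler_sum => z _; rewrite /kp (ndistC z.2).
    have := sqr_ge0 (kap b (ndist x.2 z.2) - kap b (ndist y.2 z.2)).
    by rewrite sqrrB; lra.
  rewrite big_split /= -!mulr_sumr.
  have h2 z : \sum_i kp z i ^+ 2 <= c0.
    rewrite (le_trans (pairs (fun m => kap b m ^+ 2) _ (fun m => sqr_ge0 _)))//.
    by rewrite ler_wpM2l// ler_wpM2l// kap2_sum_le.
  by have := h2 x; have := h2 y; lra.
rewrite /u; set sg := n%:R `^ (1 / 2) in s0 *.
have sg2 : n%:R = sg ^+ 2.
  rewrite /sg -powR_mulrn ?powR_ge0// -powRrM (_ : 1 / 2 * 2%:R = 1) ?powRr1//.
  by field.
rewrite natrM {1}sg2 !expr_div_n.
rewrite (_ : _ * (_ * c0 * _) = k%:R * (K0 ^+ r.+3 * c0) * (rho n ^+ r.+1 / sg ^+ r.+1))//.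
rewrite (exprD sg 2 r.+1 : sg ^+ r.+3 = _); field.
by rewrite expf_neq0 ?gt_eqF.
Qed.

End power_kernel.

(** * Decay of the covariances of the differences *)

Section difference_filters.
Context {R : realType}.
Implicit Types (a b : seq R) (c de x y : R) (V : R -> R).

Definition annihilates a (M : nat) : Prop :=
  forall l : nat, (l < M)%N -> \sum_(j < size a) a`_j * j%:R ^+ l = 0.

Lemma annihilates_shift a M c l : annihilates a M -> (l < M)%N ->
  \sum_(j < size a) a`_j * (c + j%:R) ^+ l = 0.
Proof.
move=> aM lM.
under eq_bigr do rewrite exprDn mulr_sumr.
rewrite exchange_big big1//= => i _.
rewrite (eq_bigr (fun j : 'I_(size a) => (c ^+ (l - i) *+ 'C(l, i)) * (a`_j * j%:R ^+ i))).
  by rewrite -mulr_sumr aM ?mulr0// (leq_ltn_trans _ lM)// -ltnS ltn_ord.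
by move=> j _; rewrite -mulr_natr -[in RHS]mulr_natr; ring.
Qed.

(** In the binomial expansion of degree l < Ma + Mb, each term has a power of j' below Mb or a power
    of c + j below Ma. The orders of two filters thus add up. *)
Lemma annihilates_pair a b Ma Mb c l : annihilates a Ma -> annihilates b Mb ->
  (l < Ma + Mb)%N ->
  \sum_(j < size a) \sum_(j' < size b)
    a`_j * b`_j' * (c + j%:R - j'%:R) ^+ l = 0.
Proof.
move=> ha hb lM.
transitivity (\sum_(i < l.+1) (\sum_(j < size a) a`_j * (c + j%:R) ^+ (l - i)) *
    ((-1) ^+ i *+ 'C(l, i) * \sum_(j' < size b) b`_j' * j'%:R ^+ i)).
  under [RHS]eq_bigr do rewrite mulr_suml.
  rewrite [RHS]exchange_big /=; apply: eq_bigr => j _.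
  under [RHS]eq_bigr do rewrite mulr_sumr mulr_sumr.
  rewrite [RHS]exchange_big /=; apply: eq_bigr => j' _.
  rewrite exprDn mulr_sumr; apply: eq_bigr => i _.
  rewrite (exprNn j'%:R) !mulrnAl !mulrnAr; congr (_ *+ _).
  by move: ((-1) ^+ i) (j'%:R ^+ i) (_ ^+ (l - i)) => *; ring.
apply: big1 => i _; have [iMb|iMb] := ltnP i Mb; first by rewrite hb// !mulr0.
rewrite (annihilates_shift c ha) ?mul0r//.
by have := ltn_ord i; clear -lM iMb; lia.
Qed.

Definition l1norm a : R := \sum_(j < size a) `|a`_j|.

Lemma l1norm_ge0 a : 0 <= l1norm a. Proof. by apply: sumr_ge0. Qed.

(** Subtracting a polynomial of degree below q changes nothing, so only the distance of [v] to that
    polynomial enters. *)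
Lemma pair_sum_bound a b Ma Mb q c de (al : nat -> R) (v : nat -> nat -> R) (E : R) :
  annihilates a Ma -> annihilates b Mb -> (q <= Ma + Mb)%N ->
  (forall j j' : nat, (j < size a)%N -> (j' < size b)%N ->
    `|v j j' - \sum_(l < q) al l * ((c + j%:R - j'%:R) * de) ^+ l| <= E) ->
  `|\sum_(j < size a) \sum_(j' < size b) a`_j * b`_j' * v j j'| <=
    l1norm a * l1norm b * E.
Proof.
move=> ha hb qM hv.
pose p (j j' : nat) := \sum_(l < q) al l * ((c + j%:R - j'%:R) * de) ^+ l.
have p0 : \sum_(j < size a) \sum_(j' < size b) a`_j * b`_j' * p j j' = 0.
  under eq_bigr do under eq_bigr do rewrite mulr_sumr.
  under eq_bigr do rewrite exchange_big /=.
  rewrite exchange_big big1//= => l _.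
  transitivity (al l * de ^+ l * \sum_(j < size a) \sum_(j' < size b)
    a`_j * b`_j' * (c + j%:R - j'%:R) ^+ l).
    rewrite mulr_sumr; apply: eq_bigr => j _.
    by rewrite mulr_sumr; apply: eq_bigr => j' _; rewrite exprMn; ring.
  rewrite (annihilates_pair c ha hb) ?mulr0//.
  by rewrite (leq_trans (ltn_ord l)).
rewrite -[X in `|X|]subr0 -[X in _ - X]p0 -sumrB (le_trans (ler_norm_sum _ _ _))//.
rewrite /l1norm -mulrA mulr_suml; apply: ler_sum => j _.
rewrite -sumrB (le_trans (ler_norm_sum _ _ _))// mulr_suml mulr_sumr.
apply: ler_sum => j' _; rewrite -mulrBr normrM normrM -mulrA.
by rewrite ler_wpM2l// ler_wpM2l// hv.
Qed.

Lemma powR_le_neg x y (e : R) : 0 < x -> x <= y -> e <= 0 -> y `^ e <= x `^ e.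
Proof.
move=> x0 xy e0; have y0 : 0 < y by exact: lt_le_trans xy.
rewrite -(opprK e) (powRN y) (powRN x) lef_pV2 ?posrE ?powR_gt0//.
by rewrite ge0_ler_powR ?oppr_ge0// nnegrE ltW.
Qed.

(** For zero-sum filters this is minus the covariance of two differences ([cov_a_difference]). *)
Definition varsum V a b de (i i' : nat) : R :=
  \sum_(j < size a) \sum_(j' < size b)
    a`_j * b`_j' * V ((i + j)%:R * de - (i' + j')%:R * de).

Lemma is_derive_derive1n V l y : derivable (V^`(l)%classic) y 1 ->
  is_derive y 1 (V^`(l)%classic) (V^`(l.+1)%classic y).
Proof. by move=> dV; rewrite derive1nS derive1E; exact: derivableP. Qed.

(** When i - i' >= L all arguments of V are positive, and V can be expanded at (i - i') de to order
    q. The two powers of y stand for the main term h^s and for the remainder r. The arguments stay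
    below (n - 1) de because i' >= 1 and the last index is at most n. *)
Lemma varsum_far V a b Ma Mb q (L n i i' : nat) de (C1 C2 e1 e2 : R) :
  smooth_on_pos V -> annihilates a Ma -> annihilates b Mb -> (q <= Ma + Mb)%N ->
  (size a <= L)%N -> (size b <= L)%N -> (0 < L)%N -> 0 < de ->
  (i' + L <= i)%N -> (0 < i')%N -> (i + size a <= n.+1)%N ->
  0 <= C1 -> 0 <= C2 -> e1 <= 0 -> e2 <= 0 ->
  (forall y, 0 < y -> y <= (n%:R - 1) * de ->
    `|V^`(q)%classic y| <= C1 * y `^ e1 + C2 * y `^ e2) ->
  `|varsum V a b de i i'| <= l1norm a * l1norm b *
    ((C1 * ((i - i')%:R / L%:R * de) `^ e1 + C2 * ((i - i')%:R / L%:R * de) `^ e2) *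
     (L%:R * de) ^+ q / q`!%:R).
Proof.
move=> sV ha hb qM aL bL L0 de0 iL i0 ian C10 C20 e10 e20 hV.
have L0R : (0 : R) < L%:R by rewrite ltr0n.
pose m : R := (i - i')%:R; have mE : m = i%:R - i'%:R.
  by rewrite /m natrB//; clear -iL; lia.
pose x0 := m * de; pose lo := (i - i')%:R / L%:R * de.
have mL : L%:R <= m by rewrite /m ler_nat; clear -iL; lia.
have lo0 : 0 < lo by rewrite mulr_gt0// divr_gt0// -/m (lt_le_trans L0R).
have L1 : (1 : R) <= L%:R by rewrite ler1n.
(* The inequality (m - L)(L - 1) >= 0 rewrites as m / L <= m - L + 1, and m - L + 1 is a lower bound
   for all the gaps m + j - j'. *)
have lolow : lo <= (m - L%:R + 1) * de.
  rewrite /lo -/m ler_wpM2r ?(ltW de0)// ler_pdivrMr//.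
  have : 0 <= (m - L%:R) * (L%:R - 1) by rewrite mulr_ge0// subr_ge0.
  by move: (L%:R : R) => l; rewrite mulrBr mulrBl mulr1; lra.
apply: (@pair_sum_bound _ _ Ma Mb q 0 de (fun l => V^`(l)%classic x0 / l`!%:R)
  (fun j j' => V ((i + j)%:R * de - (i' + j')%:R * de))) => // j j' ja jb.
pose x := (i + j)%:R * de - (i' + j')%:R * de.
have xx0 : x - x0 = (0 + j%:R - j'%:R) * de.
  by rewrite /x /x0 mE !natrD; ring.
have j'L : (j'%:R : R) + 1 <= L%:R by rewrite natr1 ler_nat; exact: leq_trans bL.
have jL : (j%:R : R) + 1 <= L%:R by rewrite natr1 ler_nat; exact: leq_trans aL.
have j0 : (0 : R) <= j%:R by []. have j'0 : (0 : R) <= j'%:R by [].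
have seg y : Num.min x0 x <= y <= Num.max x0 x -> lo <= y <= (n%:R - 1) * de.
  have xlo : lo <= x.
    rewrite (le_trans lolow)// (_ : x = (m + j%:R - j'%:R) * de); last first.
      by rewrite /x mE !natrD; ring.
    by rewrite ler_wpM2r ?(ltW de0)//; lra.
  have x0lo : lo <= x0.
    by rewrite (le_trans lolow)// /x0 ler_wpM2r ?(ltW de0)//; lra.
  have i0R : (1 : R) <= i'%:R by rewrite ler1n.
  have hn : i%:R + j%:R <= (n%:R : R).
    by rewrite -natrD ler_nat; clear -ian ja; lia.
  have xhi : x <= (n%:R - 1) * de.
    by rewrite /x -mulrBl ler_wpM2r ?(ltW de0)// !natrD; lra.
  have x0hi : x0 <= (n%:R - 1) * de.
    by rewrite /x0 ler_wpM2r ?(ltW de0)// mE; lra.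
  move=> /andP[h1 h2]; apply/andP; split.
    by apply: le_trans h1; rewrite le_min x0lo.
  by apply: (le_trans h2); rewrite ge_max x0hi.
have hder l y : (l < q)%N -> Num.min x0 x <= y <= Num.max x0 x ->
    is_derive y 1 (V^`(l)%classic) (V^`(l.+1)%classic y).
  move=> _ /seg/andP[y0 _]; apply: is_derive_derive1n; apply: sV.
  exact: lt_le_trans y0.
have hbd y : Num.min x0 x <= y <= Num.max x0 x ->
    `|V^`(q)%classic y - 0| <= C1 * lo `^ e1 + C2 * lo `^ e2.
  move=> /seg/andP[y0 y1]; rewrite subr0 (le_trans (hV _ _ y1))//.
    exact: lt_le_trans y0.
  by rewrite lerD// ler_wpM2l// powR_le_neg.
have := taylor_bound hder hbd.
rewrite !mul0r addr0 xx0 => h.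
have -> : \sum_(l < q) V^`(l)%classic x0 / l`!%:R * ((0 + j%:R - j'%:R) * de) ^+ l =
  \sum_(l < q) V^`(l)%classic x0 * ((0 + j%:R - j'%:R) * de) ^+ l / l`!%:R.
  by apply: eq_bigr => l _; rewrite mulrAC.
apply: (le_trans h); rewrite ler_wpM2r ?invr_ge0// ler_wpM2l//.
  by rewrite addr_ge0// mulr_ge0// powR_ge0.
rewrite lerXn2r// ?nnegrE ?mulr_ge0// ?(ltW de0)//.
rewrite normrM (gtr0_norm de0) ler_wpM2r ?(ltW de0)// add0r ler_norml.
by apply/andP; split; lra.
Qed.

(** For close indices the arguments may have any sign, so the expansion is made at 0, with [c] in
    place of the last derivative. The polynomial has degree q itself, hence the strict inequality
    [q < Ma + Mb]. *)
Lemma varsum_near V a b Ma Mb q (L i i' : nat) de (c C s eta : R) :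
  times_differentiable q V -> annihilates a Ma -> annihilates b Mb ->
  (q < Ma + Mb)%N -> (size a <= L)%N -> (size b <= L)%N -> 0 < de ->
  (i' <= i)%N -> (i <= i' + L)%N -> 0 <= C -> 0 <= s ->
  (forall y, `|y| <= eta -> `|V^`(q)%classic y - c| <= C * `|y| `^ s) ->
  2 * L%:R * de <= eta ->
  `|varsum V a b de i i'| <= l1norm a * l1norm b *
    (C * (2 * L%:R * de) `^ s * (2 * L%:R * de) ^+ q / q`!%:R).
Proof.
move=> dV ha hb qM aL bL de0 i'i iL C0 s0 hV heta.
pose m : R := (i - i')%:R; have mE : m = i%:R - i'%:R by rewrite /m natrB.
have m0 : 0 <= m by [].
have mL : m <= L%:R by rewrite /m ler_nat; clear -iL; lia.
apply: (@pair_sum_bound _ _ Ma Mb q.+1 m de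
  (fun l => (if (l < q)%N then V^`(l)%classic 0 else c) / l`!%:R)
  (fun j j' => V ((i + j)%:R * de - (i' + j')%:R * de))) => // j j' ja jb.
rewrite (_ : (m + j%:R - j'%:R) * de = (i + j)%:R * de - (i' + j')%:R * de); last first.
  by rewrite mE !natrD; ring.
pose x := (i + j)%:R * de - (i' + j')%:R * de; rewrite -/x.
have xE : x = (m + j%:R - j'%:R) * de by rewrite /x mE !natrD; ring.
have j'L : (j'%:R : R) <= L%:R by rewrite ler_nat; exact: ltnW (leq_trans jb bL).
have jL : (j%:R : R) <= L%:R by rewrite ler_nat; exact: ltnW (leq_trans ja aL).
have j0 : (0 : R) <= j%:R by []. have j'0 : (0 : R) <= j'%:R by [].
have xL : `|x| <= 2 * L%:R * de.
  rewrite xE normrM (gtr0_norm de0) ler_wpM2r ?(ltW de0)// ler_norml.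
  by apply/andP; split; lra.
have seg y : Num.min 0 x <= y <= Num.max 0 x -> `|y| <= `|x|.
  by case: (leP 0 x) => x0 /andP[y1 y2]; [rewrite !ger0_norm|rewrite !ler0_norm]; lra.
have hder l y : (l < q)%N -> Num.min 0 x <= y <= Num.max 0 x ->
    is_derive y 1 (V^`(l)%classic) (V^`(l.+1)%classic y).
  by move=> lq _; apply: is_derive_derive1n; exact: dV.
have hbd y : Num.min 0 x <= y <= Num.max 0 x ->
    `|V^`(q)%classic y - c| <= C * (2 * L%:R * de) `^ s.
  move=> /seg yx; have yL := le_trans yx xL.
  rewrite (le_trans (hV _ (le_trans yL heta)))// ler_wpM2l//.
  by rewrite ge0_ler_powR// nnegrE (le_trans _ yL).
have := taylor_bound hder hbd; rewrite subr0 => h.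
rewrite big_ord_recr /= ltnn.
have -> : \sum_(l < q) (if (l < q)%N then V^`(l)%classic 0 else c) / l`!%:R * x ^+ l =
   \sum_(l < q) V^`(l)%classic 0 * x ^+ l / l`!%:R.
  by apply: eq_bigr => l _; rewrite ltn_ord mulrAC.
rewrite (mulrAC c); apply: (le_trans h).
rewrite ler_wpM2r ?invr_ge0// ler_wpM2l ?mulr_ge0 ?powR_ge0//.
by rewrite lerXn2r// nnegrE (le_trans _ xL).
Qed.

End difference_filters.

Section mesh.
Context {R : realType}.
Implicit Types alpha : R.

Lemma mesh_gt0 alpha n : (0 < n)%N -> 0 < mesh alpha n.
Proof. by move=> n0; rewrite powR_gt0// ltr0n. Qed.

Lemma mesh_le1 alpha n : 0 < alpha -> (0 < n)%N -> mesh alpha n <= 1.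
Proof.
move=> a0 n0; rewrite /mesh powRN invf_le1 ?powR_gt0 ?ltr0n//.
by rewrite -[leLHS](powRr0 n%:R); apply: ler_powR; rewrite ?ler1n// ltW.
Qed.

Lemma mesh_cvg0 alpha : 0 < alpha -> mesh alpha @ \oo --> (0 : R).
Proof. exact: powRN_cvg0. Qed.

End mesh.

Section covariance_decay.
Context {R : realType}.
Variables (V r : R -> R) (D : nat) (C s : R) (d : nat) (beta K' : R).
Hypothesis V_smooth : smooth_on_pos V.
Hypothesis V_expansion : forall h : R,
  V^`(2 * D)%classic h = V^`(2 * D)%classic 0 + C * (-1) ^+ D * `|h| `^ s + r h.

Let c := C * (-1) ^+ D.
(** The falling factorial s (s - 1) ... (s - n + 1), coefficient of the n-th derivative of h^s. *)
Let ff (n : nat) : R := \prod_(i < n) (s - i%:R).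

(** The hypotheses bound a derivative of [r], while the expansion needs one of V. On h > 0, [r] is
    V^(2D) minus explicit terms, which are derived one by one; the factor [(n == 0%N)%:R] removes
    the constant after one derivation. *)
Lemma remainder_derive n h : 0 < h ->
  r^`(n)%classic h = V^`(2 * D + n)%classic h -
    (n == 0%N)%:R * V^`(2 * D)%classic 0 - c * ff n * h `^ (s - n%:R).
Proof.
elim: n h => [|n IH] h h0.
  rewrite derive1n0 addn0 mul1r /ff big_ord0 mulr1 subr0.
  by rewrite V_expansion (gtr0_norm h0) /c; ring.
pose g x := V^`(2 * D + n)%classic x -
  ((n == 0%N)%:R * V^`(2 * D)%classic 0) - (c * ff n) * x `^ (s - n%:R).
have dg : is_derive h 1 g (V^`(2 * D + n.+1)%classic h - 0 -
    (c * ff n) * ((s - n%:R) * h `^ (s - n%:R - 1))).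
  have d1 : is_derive h 1 (V^`(2 * D + n)%classic) (V^`(2 * D + n.+1)%classic h).
    by rewrite addnS; apply: is_derive_derive1n; exact: V_smooth.
  have d2 := is_derive_powR (s - n%:R) h0.
  have d3 := is_derive_cst ((n == 0%N)%:R * V^`(2 * D)%classic 0 : R) h 1.
  have d4 := is_deriveZ (c * ff n) d2.
  exact: (is_deriveB (is_deriveB d1 d3) d4).
have nr : \forall x \near h, g x = r^`(n)%classic x.
  near=> x; rewrite IH//; near: x; exact: lt_nbhsr.
have dr : is_derive h 1 (r^`(n)%classic) (V^`(2 * D + n.+1)%classic h - 0 -
    (c * ff n) * ((s - n%:R) * h `^ (s - n%:R - 1))).
  exact: near_eq_is_derive dg.
rewrite derive1nS derive1E (@derive_val _ _ _ _ _ _ _ dr) mul0r.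
rewrite /ff big_ord_recr /= -/(ff n) -[n.+1%:R]natr1 opprD addrA.
by ring.
Unshelve. all: by end_near.
Qed.

Lemma derive_bound h : 0 < h -> (0 < d)%N ->
  `|r^`(d)%classic h| <= K' * `|h| `^ beta ->
  `|V^`(2 * D + d)%classic h| <=
    `|c * ff d| * h `^ (s - d%:R) + `|K'| * h `^ beta.
Proof.
move=> h0 d0; rewrite remainder_derive// (gtr0_norm h0).
rewrite -[(d == 0)%N]negbK -lt0n d0 mul0r subr0 => hr.
set A := V^`(_)%classic h in hr *; set B := c * _ * _ in hr.
rewrite (_ : A = B + (A - B)); last by ring.
rewrite (le_trans (ler_normD _ _))// lerD//.
  by rewrite /B normrM [`|h `^ _|]ger0_norm ?powR_ge0.
by rewrite (le_trans hr)// ler_wpM2r ?powR_ge0// ler_norm.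
Qed.

Variable alpha : R.
Hypothesis alpha0 : 0 < alpha.
Hypothesis alpha1 : alpha <= 1.
Hypothesis V_diff : times_differentiable (2 * D) V.
Hypothesis C0 : 0 < C.
Hypothesis s0 : 0 < s.
Hypothesis r_small : \forall h \near (0:R), `|r h| <= `|h| `^ s.
Hypothesis d0 : (0 < d)%N.
Hypothesis beta_gt : s - d%:R < beta.
Hypothesis rd1 : alpha = 1 ->
  forall h : R, 0 < `|h| -> `|h| < 1 -> `|r^`(d)%classic h| <= K' * `|h| `^ beta.
Hypothesis rdlt1 : alpha < 1 ->
  forall h : R, h != 0 -> `|r^`(d)%classic h| <= K' * `|h| `^ beta.

(** For alpha = 1 the bound on r^(d) holds on (0, 1) only, and (n - 1) / n < 1 keeps [h] inside. For
    alpha < 1 the times spread out and the global bound is used. *)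
Lemma derive_bound_mesh n h : (0 < n)%N -> 0 < h ->
  h <= (n%:R - 1) * mesh alpha n ->
  `|V^`(2 * D + d)%classic h| <=
    `|c * ff d| * h `^ (s - d%:R) + `|K'| * h `^ beta.
Proof.
move=> n0 h0 hn; apply: derive_bound => //.
move: alpha1; rewrite le_eqVlt => /orP[/eqP a1|a1]; last first.
  by apply: rdlt1 => //; rewrite gt_eqF.
apply: rd1; rewrite ?gtr0_norm//; apply: (le_lt_trans hn).
rewrite /mesh a1 powR_inv1// ltr_pdivrMr ?ltr0n// mul1r; lra.
Qed.

Variables (a b : seq R) (Ma Mb : nat) (gam : R).
Hypothesis ha : annihilates a Ma.
Hypothesis hb : annihilates b Mb.
Hypothesis q_le : (2 * D + d <= Ma + Mb)%N.
Hypothesis beta_gam : beta <= gam.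
Hypothesis gam0 : gam <= 0.

Let L := (maxn 1 (maxn (size a) (size b))).
Let L0 : (0 < L)%N. Proof. by rewrite /L leq_max. Qed.
Let aL : (size a <= L)%N. Proof. by rewrite /L !leq_max leqnn orbT. Qed.
Let bL : (size b <= L)%N. Proof. by rewrite /L !leq_max leqnn !orbT. Qed.
Let L0R : (0 : R) < L%:R. Proof. by rewrite ltr0n. Qed.
Let q := (2 * D + d)%N.
Let e := 2 * D%:R + s.

(** As [de <= 1] and w + q >= e, lowering the exponent of [de] to [e] can only increase the power;
    as m >= 1 and w <= gam, also m^w <= m^gam. *)
Lemma scale_power (m : nat) (de w : R) : (0 < m)%N -> 0 < de -> de <= 1 ->
  s - d%:R <= w -> w <= gam ->
  (m%:R / L%:R * de) `^ w * (L%:R * de) ^+ q <=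
  L%:R `^ (- w) * L%:R ^+ q * (de `^ e * m%:R `^ gam).
Proof.
move=> m0 de0 de1 sw wg; have m0R : (0 : R) < m%:R by rewrite ltr0n.
rewrite powRM ?divr_ge0 ?(ltW de0)// powRM ?invr_ge0// exprMn.
rewrite -[L%:R^-1]powR_inv1// -powRrM mulN1r.
rewrite -[de ^+ q]powR_mulrn ?(ltW de0)//.
rewrite (_ : _ * _ = L%:R `^ (- w) * L%:R ^+ q * ((de `^ w * de `^ q%:R) * m%:R `^ w)); last by ring.
rewrite ler_wpM2l ?mulr_ge0 ?powR_ge0 ?exprn_ge0//.
rewrite -powRD ?(gt_eqF de0) ?implybT// ler_pM ?powR_ge0//.
  rewrite ger_powR ?de0// /e /q natrD natrM; move: sw; lra.
by rewrite ler_powR// ler1n.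
Qed.

(** The range is split at i - i' = L: [Kf] is the constant of [varsum_far] with order 2D + d, [Kn]
    that of [varsum_near] with order 2D. *)
Theorem varsum_bound : exists K n0, 0 <= K /\ forall n i i', (n0 <= n)%N ->
  (i' <= i)%N -> (0 < i')%N -> (i + size a <= n.+1)%N ->
  `|varsum V a b (mesh alpha n) i i'| <=
    K * mesh alpha n `^ e * kap gam (i - i').
Proof.
have [eta /= eta0 heta] := r_small.
pose Kf := l1norm a * l1norm b * ((`|c * ff d| * L%:R `^ (- (s - d%:R)) +
   `|K'| * L%:R `^ (- beta)) * L%:R ^+ q / q`!%:R).
pose Kn := l1norm a * l1norm b * ((C + 1) * (2 * L%:R) `^ s * (2 * L%:R) ^+ (2 * D) /
   (2 * D)`!%:R) * L%:R `^ (- gam).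
have Kf0 : 0 <= Kf.
  rewrite mulr_ge0 ?mulr_ge0 ?l1norm_ge0// invr_ge0 ?exprn_ge0//.
have Kn0 : 0 <= Kn.
  rewrite !mulr_ge0 ?l1norm_ge0 ?powR_ge0 ?exprn_ge0 ?invr_ge0 ?mulr_ge0//.
  by rewrite addr_ge0// ltW.
(* From n1 on, 2 L de <= eta / 2, so that the arguments at close indices fall where |r h| <=
   |h|^s. *)
have /cvgrPdist_le /(_ (eta / (4 * L%:R))) := mesh_cvg0 alpha0.
rewrite divr_gt0 ?mulr_gt0// => /(_ isT) [n1 _ hn1].
exists (Kf + Kn), (maxn 1 n1); split=> [|n i i']; first by rewrite addr_ge0.
rewrite geq_max => /andP[n0 n1n] i'i i'0 ian.
have de0 := mesh_gt0 alpha n0; have de1 := mesh_le1 alpha0 n0.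
set de := mesh alpha n in de0 de1 *.
have deL : 2 * L%:R * de < eta.
  have := hn1 n n1n; rewrite /= sub0r normrN (gtr0_norm de0).
  rewrite ler_pdivlMr ?mulr_gt0// => h.
  have : 0 < L%:R * de by rewrite mulr_gt0.
  by move: h; rewrite -/de; move: (L%:R) => l; lra.
have e_de : 0 <= de `^ e * kap gam (i - i') by rewrite mulr_ge0 ?powR_ge0.
rewrite -mulrA; have [iL|iL] := leqP (i' + L) i.
  have m0 : (0 < i - i')%N by clear -iL L0; lia.
  have kapE : kap gam (i - i') = (i - i')%:R `^ gam.
    by rewrite /kap; congr (_%:R `^ _); apply/maxn_idPr.
  have e1 : s - d%:R <= 0 by move: beta_gt beta_gam gam0; lra.
  have e2 : beta <= 0 by move: beta_gam gam0; lra.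
  have hV y : 0 < y -> y <= (n%:R - 1) * de -> `|V^`(q)%classic y| <=
      `|c * ff d| * y `^ (s - d%:R) + `|K'| * y `^ beta.
    exact: derive_bound_mesh.
  have := varsum_far V_smooth ha hb q_le aL bL L0 de0 iL i'0 ian
    (normr_ge0 _) (normr_ge0 _) e1 e2 hV.
  move=> h; apply: (le_trans h); apply: (@le_trans _ _ (Kf * (de `^ e * kap gam (i - i')))).
    rewrite kapE; set X := l1norm a * l1norm b.
    set A := `|c * ff d|; set m : R := (i - i')%:R.
    have X0 : 0 <= X / q`!%:R by rewrite divr_ge0 ?mulr_ge0 ?l1norm_ge0.
    rewrite [leLHS](_ : _ = X / q`!%:R *
      (A * ((m / L%:R * de) `^ (s - d%:R) * (L%:R * de) ^+ q) +
       `|K'| * ((m / L%:R * de) `^ beta * (L%:R * de) ^+ q))); last first.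
      by rewrite -/q; ring.
    rewrite [leRHS](_ : _ = X / q`!%:R *
      (A * (L%:R `^ (- (s - d%:R)) * L%:R ^+ q * (de `^ e * m `^ gam)) +
       `|K'| * (L%:R `^ (- beta) * L%:R ^+ q * (de `^ e * m `^ gam)))); last first.
      by rewrite /Kf -/X -/A; ring.
    apply: ler_wpM2l => //; apply: lerD; apply: ler_wpM2l; rewrite ?normr_ge0//.
      by apply: scale_power => //; move: beta_gt beta_gam; lra.
    by apply: scale_power => //; exact: ltW.
  by rewrite ler_wpM2r// lerDl.
have qM : (2 * D < Ma + Mb)%N by clear -q_le d0; lia.
have hV y : `|y| <= 2 * L%:R * de ->
   `|V^`(2 * D)%classic y - V^`(2 * D)%classic 0| <= (C + 1) * `|y| `^ s.
  move=> yL; rewrite V_expansion (_ : _ - _ = C * (-1) ^+ D * `|y| `^ s + r y); last by ring.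
  rewrite (le_trans (ler_normD _ _))// mulrDl mul1r lerD//.
    rewrite normrM normrM normrX normrN1 expr1n mulr1 (gtr0_norm C0).
    by rewrite ger0_norm ?powR_ge0.
  by apply: heta => /=; rewrite sub0r normrN (le_lt_trans yL).
have iL' : (i <= i' + L)%N by exact: ltnW.
have C10 : 0 <= C + 1 by rewrite addr_ge0// ltW.
have := varsum_near V_diff ha hb qM aL bL de0 i'i iL' C10 (ltW s0) hV (lexx _).
move=> h; apply: (le_trans h); apply: (@le_trans _ _ (Kn * (de `^ e * kap gam (i - i')))); last first.
  by rewrite ler_wpM2r// lerDr.
(* Here i - i' <= L, so the kernel is at least L^gam; hence the factor L^(-gam) in [Kn]. *)
have kL : 1 <= L%:R `^ (- gam) * kap gam (i - i').
  rewrite powRN mulrC ler_pdivlMr ?powR_gt0// mul1r powR_le_neg//.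
  by rewrite ler_nat; clear -iL L0 i'i; lia.
rewrite /Kn (_ : (2 * L%:R * de) `^ s = (2 * L%:R) `^ s * de `^ s); last first.
  by rewrite powRM ?mulr_ge0// ltW.
rewrite (_ : (2 * L%:R * de) ^+ (2 * D) = (2 * L%:R) ^+ (2 * D) * de ^+ (2 * D)); last first.
  by rewrite exprMn.
have deE : de `^ e = de ^+ (2 * D) * de `^ s.
  by rewrite -powR_mulrn ?(ltW de0)// -powRD ?(gt_eqF de0) ?implybT// /e natrM.
set X := l1norm a * l1norm b; set Y := (2 * L%:R) `^ s; set Z := (2 * L%:R) ^+ (2 * D).
rewrite (_ : X * _ = X * ((C + 1) * Y * Z / (2 * D)`!%:R) * de `^ e * 1); last first.
  by rewrite deE; ring.
rewrite (_ : _ * (de `^ e * _) = X * ((C + 1) * Y * Z / (2 * D)`!%:R) * de `^ e *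
  (L%:R `^ (- gam) * kap gam (i - i'))); last by ring.
rewrite ler_wpM2l//.
by rewrite !mulr_ge0 ?l1norm_ge0 ?powR_ge0 ?exprn_ge0 ?invr_ge0 ?mulr_ge0.
Qed.

End covariance_decay.

(** * The Gaussian space of a Gaussian process *)

Section normal_variables.
Context {d : measure_display} {T : measurableType d} {R : realType}.
Variable P : probability T R.
Local Notation Ex := (Ex P).
Implicit Types f : T -> R.

(** The standard deviation supplied by the Gaussian hypothesis has no prescribed sign, whereas the
    limit law is stated with a square root. *)
Lemma normal_law_normr (m s : R) : normal_law m `|s| = normal_law m s.
Proof.
rewrite /normal_law normr_eq0; case: eqP => [//|_].
rewrite /normal_prob (_ : normal_pdf m `|s| = normal_pdf m s); first by [].
apply/funext => x; rewrite /normal_pdf normr_eq0; case: eqP => [//|_].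
by rewrite /normal_fun /normal_peak real_normK ?num_real.
Qed.

Lemma is_normal_mgf f (m s t : R) : measurable_fun setT f -> is_normal P f m s ->
  (\int[P]_w (expR (t * f w))%:E = (expR (t * m + t ^+ 2 * s ^+ 2 / 2))%:E)%E.
Proof.
move=> mf nf.
have mexp : measurable_fun setT (fun x : R => (expR (t * x))%:E).
  apply/measurable_EFinP; apply: (measurableT_comp (@measurable_expR _)).
  exact: mulrl_measurable.
have [s0|s0] := eqVneq s 0.
  transitivity (\int[pushforward P f]_x (expR (t * x))%:E)%E.
    by rewrite ge0_integral_pushforward// => x _; rewrite lee_fin expR_ge0.
  rewrite (@eq_measure_integral _ _ _ _ (dirac m)); last first.
    by move=> A mA _; have := nf A mA; rewrite /normal_law s0 eqxx.
  by rewrite integral_dirac// diracT mul1e s0 expr0n mulr0 mul0r addr0.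
transitivity (\int[pushforward P (f : T -> measurableTypeR R)]_x (expR (t * x))%:E)%E.
  by rewrite ge0_integral_pushforward// => x _; rewrite lee_fin expR_ge0.
rewrite -normal_prob_mgf//; apply: eq_measure_integral => A mA _.
by have := nf A mA; rewrite /normal_law (negbTE s0).
Qed.

(** The line spanned by f - m is a Gaussian space, so moments and mean come from the general
    theory. *)
Lemma mgf_mean f (m v : R) : measurable_fun setT f ->
  (forall t, \int[P]_w (expR (t * f w))%:E = (expR (t * m + t ^+ 2 * v / 2))%:E)%E ->
  has_moments P f /\ Ex f = m.
Proof.
move=> mf hf.
pose H (g : T -> R) := exists c, g = fun w => c * (f w - m).
have gsH : gaussian_space P H.
  split.
  - by exists 0; apply/funext => w; rewrite mul0r.
  - move=> c _ _ [a ->] [b ->]; exists (c * a + b).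
    by apply/funext => w; ring.
  - move=> _ [c ->]; apply: measurable_funM => //.
    by apply: measurable_funB.
  - move=> _ [c ->]; exists (c ^+ 2 * v) => t.
    transitivity (\int[P]_w ((expR (- (t * c * m)))%:E * (expR ((t * c) * f w))%:E))%E.
      apply: eq_integral => w _; rewrite -EFinM -expRD; congr (expR _)%:E; ring.
    rewrite ge0_integralZl//.
    + by rewrite hf -EFinM -expRD; congr (expR _)%:E; field.
    + apply/measurable_EFinP; apply: (measurableT_comp (@measurable_expR _)).
      exact: measurable_funM.
have H1 : H (fun w => f w - m).
  by exists 1; apply/funext => w; rewrite mul1r.
have m1 := gs_moments gsH H1; have e1 := gs_mean gsH H1.
have mf' : has_moments P f.
  have := has_momentsD m1 (has_moments_cst P m).
  by under eq_fun do rewrite subrK.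
split => //; move: e1; rewrite ExB ?Ex_cst//; last exact: has_moments_cst.
by move=> /eqP; rewrite subr_eq0 => /eqP.
Qed.

End normal_variables.

Section process.
Context {d : measure_display} {T : measurableType d} {R : realType}.
Variables (P : probability T R) (X : R -> {RV P >-> R}).
Hypothesis X_gaussian : gaussian_process X.
Hypothesis X_centered : centered X.
Local Notation Ex := (Ex P).
Local Notation cov := (cov P).

Definition gspan (f : T -> R) : Prop := exists (m : nat) (c t : 'I_m -> R),
  f = fun w => \sum_(i < m) c i * X (t i) w.

Lemma gspan_process t : gspan (X t).
Proof.
exists 1%N, (fun=> 1), (fun=> t).
by apply/funext => w; rewrite big_ord1 mul1r.
Qed.

Lemma gspan_measurable f : gspan f -> measurable_fun setT f.
Proof.
move=> [m [c [t ->]]]; apply: measurable_sum => i.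
exact: measurable_funM.
Qed.

Lemma process_moments t : has_moments P (X t).
Proof.
have [m [c [u hX]]] := gspan_process t.
have [mean [s ns]] := X_gaussian c u; rewrite -hX in ns.
have mX := gspan_measurable (gspan_process t).
by have [] := mgf_mean mX (fun z => is_normal_mgf z mX ns).
Qed.

Lemma process_mean t : Ex (X t) = 0.
Proof.
have := X_centered t; rewrite (expectation_Ex (process_moments t)).
by move=> [].
Qed.

Lemma gspan_normal f : gspan f -> exists s, is_normal P f 0 s.
Proof.
move=> hf; have [m [c [t fE]]] := hf.
have [mean [s ns]] := X_gaussian c t; rewrite -fE in ns; exists s.
have mf := gspan_measurable hf.
have [_ Em] := mgf_mean mf (fun z => is_normal_mgf z mf ns).
suff <- : mean = 0 by [].
rewrite -Em fE Ex_sum => [|i _]; last by apply: has_momentsZ; exact: process_moments.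
by apply: big1 => i _; rewrite ExZ ?process_mean ?mulr0//; exact: process_moments.
Qed.

Lemma gspan_gaussian_space : gaussian_space P gspan.
Proof.
split.
- exists 0%N, (fun=> 0), (fun=> 0); by apply/funext => w; rewrite big_ord0.
- move=> c _ _ [m1 [c1 [t1 ->]]] [m2 [c2 [t2 ->]]].
  exists (m1 + m2)%N,
    (fun i : 'I_(m1 + m2) => match fintype.split i with inl j => c * c1 j | inr j => c2 j end),
    (fun i : 'I_(m1 + m2) => match fintype.split i with inl j => t1 j | inr j => t2 j end).
  apply/funext => w; rewrite big_split_ord /= mulr_sumr; congr (_ + _).
    apply: eq_bigr => i _; have := unsplitK (inl i : 'I_m1 + 'I_m2) => /= ->.
    by rewrite mulrA.
  by apply: eq_bigr => i _; have := unsplitK (inr i : 'I_m1 + 'I_m2) => /= ->.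
- exact: gspan_measurable.
- move=> f hf; have [s ns] := gspan_normal hf; exists (s ^+ 2) => t.
  by rewrite (is_normal_mgf _ (gspan_measurable hf) ns) mulr0 add0r.
Qed.

Lemma gspan_normal_cov f : gspan f -> is_normal P f 0 (Num.sqrt (cov f f)).
Proof.
move=> hf; have [s ns] := gspan_normal hf.
have gs := gspan_gaussian_space; have mf := gspan_measurable hf.
have -> : cov f f = s ^+ 2.
  have [_ /(_ 1)] := gs_var_mgf gs hf.
  have := is_normal_mgf 1 mf ns; rewrite /Ex /Rintegral => -> /=.
  rewrite mulr0 add0r => /expR_inj; rewrite expr1n !mul1r => h.
  have {}h : s ^+ 2 = \int[P]_w (f w ^+ 2) by move: h; rewrite /Rintegral; lra.
  by rewrite h; apply: eq_Ex => w; rewrite expr2.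
by rewrite sqrtr_sqr => A mA; rewrite normal_law_normr; exact: ns.
Qed.

Variable V : R -> R.
Hypothesis V_semi : is_semivariogram X V.

Lemma cov_process t u :
  cov (X t) (X u) = (cov (X t) (X t) + cov (X u) (X u)) / 2 - V (t - u).
Proof.
have mt := process_moments t; have mu := process_moments u.
have := V_semi u (t - u); rewrite subrKC.
rewrite (@expectation_Ex _ _ _ P (fun w => (X t w - X u w) ^+ 2)); last by hm.
rewrite -EFinM => -[->].
have -> : Ex (fun w => (X t w - X u w) ^+ 2) =
    cov (X t) (X t) + cov (X u) (X u) - 2 * cov (X t) (X u).
  rewrite -ExZ -?ExD -?ExB; [|by hm..].
  by apply: eq_Ex => w; ring.
by field.
Qed.

Lemma a_difference_gspan (de : R) (a : seq R) i : gspan (a_difference X de a i).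
Proof.
by exists (size a), (fun j => a`_j), (fun j => (i + j)%:R * de).
Qed.

(** By [cov_process], the covariance of X t and X u is a function of t plus a function of u minus V
    (t - u); the zero sums of the filters kill the first two. *)
Lemma cov_a_difference (de : R) (a b : seq R) i i' :
  \sum_(x <- a) x = 0 -> \sum_(x <- b) x = 0 ->
  cov (a_difference X de a i) (a_difference X de b i') =
  - varsum V a b de i i'.
Proof.
move=> a0 b0; have mX := process_moments.
have {}a0 : \sum_(j < size a) a`_j = 0 by rewrite -[RHS]a0 (big_nth 0) big_mkord.
have {}b0 : \sum_(j < size b) b`_j = 0 by rewrite -[RHS]b0 (big_nth 0) big_mkord.
transitivity (\sum_(j < size a) \sum_(j' < size b) a`_j * b`_j' *
    cov (X ((i + j)%:R * de)) (X ((i' + j')%:R * de))).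
  transitivity (Ex (fun w => \sum_(j < size a) \sum_(j' < size b) a`_j * b`_j' *
    (X ((i + j)%:R * de) w * X ((i' + j')%:R * de) w))).
    apply: eq_Ex => w; rewrite /a_difference mulr_suml; apply: eq_bigr => j _.
    by rewrite mulr_sumr; apply: eq_bigr => j' _; ring.
  have hj j j' : has_moments P (fun w => a`_j * b`_j' *
      (X ((i + j)%:R * de) w * X ((i' + j')%:R * de) w)).
    have := mX ((i + j)%:R * de); have := mX ((i' + j')%:R * de) => *; hm.
  rewrite Ex_sum => [|j _]; last by apply: has_moments_sum => j' _; exact: hj.
  apply: eq_bigr => j _; rewrite Ex_sum => [|j' _]; last exact: hj.
  by apply: eq_bigr => j' _; rewrite ExZ//; exact: has_momentsM.
under eq_bigr do under eq_bigr do rewrite cov_process.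
pose ca j := cov (X ((i + j)%:R * de)) (X ((i + j)%:R * de)).
pose cb j := cov (X ((i' + j)%:R * de)) (X ((i' + j)%:R * de)).
transitivity (\sum_(j < size a) (a`_j * (ca j / 2) * \sum_(j' < size b) b`_j' +
   a`_j * \sum_(j' < size b) b`_j' * (cb j' / 2)) - varsum V a b de i i').
  rewrite /varsum -sumrB; apply: eq_bigr => j _.
  rewrite !mulr_sumr -big_split -sumrB /=; apply: eq_bigr => j' _.
  by rewrite /ca /cb; ring.
by rewrite big_split /= -!mulr_suml a0 b0 mulr0 mul0r addr0 sub0r.
Qed.

End process.

(** * Existence of the limit vector *)

Section cholesky.
Context {R : realType}.

Definition posdef (k : nat) (S : 'M[R]_k) : Prop :=
  S^T = S /\ forall u : 'rV[R]_k, u != 0 -> 0 < (u *m S *m u^T) 0 0.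

(** Induction on the size by the Schur complement [W1]. Evaluating the form at (t, y) with t = -
    x^-1 y v^T completes the square, which shows that [W1] is again positive definite. *)
Lemma cholesky (k : nat) (S : 'M[R]_k) : posdef S -> exists B : 'M[R]_k, S = B *m B^T.
Proof.
elim: k S => [|k IH] S [symS posS].
  by exists 0; apply/matrixP => -[].
pose S1 : 'M[R]_(1 + k) := S.
pose s := ulsubmx S1; pose v := ursubmx S1; pose W := drsubmx S1.
have dlE : dlsubmx S1 = v^T by rewrite /v trmx_ursub [S1^T]symS.
have SE : S1 = block_mx s v v^T W by rewrite -dlE submxK.
pose x := s 0 0; have sE : s = x%:M by rewrite [s]mx11_scalar.
have W_sym : W^T = W by rewrite /W trmx_drsub [S1^T]symS.
have form (t : 'M[R]_1) (y : 'rV[R]_k) :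
    row_mx t y *m S1 *m (row_mx t y)^T =
    t *m s *m t^T + y *m v^T *m t^T + (t *m v *m y^T + y *m W *m y^T).
  by rewrite SE mul_row_block tr_row_mx mul_row_col !mulmxDl.
have x0 : 0 < x.
  have := posS (row_mx 1%:M 0 : 'rV[R]_(1 + k)).
  rewrite -/S1 form trmx0 !mulmx0 !mul0mx !addr0 mul1mx trmx1 mulmx1.
  apply; apply/eqP => h.
  have := congr1 (fun M : 'rV[R]_(1 + k) => lsubmx M 0 0) h.
  by rewrite row_mxKl !mxE => /eqP; rewrite oner_eq0.
pose W1 := W - x^-1 *: (v^T *m v).
have [|B1 hB1] := IH W1.
  split=> [|y y0].
    by rewrite /W1 linearB /= linearZ /= trmx_mul trmxK W_sym.
  pose t : 'M[R]_1 := - x^-1 *: (y *m v^T).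
  have := posS (row_mx t y : 'rV[R]_(1 + k)); rewrite -/S1 form.
  have -> : t *m s *m t^T + y *m v^T *m t^T + (t *m v *m y^T + y *m W *m y^T) =
     y *m W1 *m y^T.
    have -> : t *m s = - (y *m v^T).
      by rewrite /t sE mul_mx_scalar scalerA mulrN divff ?gt_eqF// scaleN1r.
    rewrite mulNmx addNr add0r /t /W1 mulmxBr mulmxBl -!scalemxAl -scalemxAr.
    by rewrite -scalemxAl scaleNr addrC !mulmxA.
  apply; apply: contra_neq y0 => h.
  have := congr1 (fun M : 'rV[R]_(1 + k) => rsubmx M) h.
  by rewrite row_mxKr => ->; apply/rowP => j; rewrite !mxE.
pose B : 'M[R]_(1 + k) := block_mx (Num.sqrt x)%:M 0 ((Num.sqrt x)^-1 *: v^T) B1.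
exists B; have sx : Num.sqrt x * Num.sqrt x = x by rewrite -expr2 sqr_sqrtr// ltW.
have sx0 : Num.sqrt x != 0 by rewrite gt_eqF// sqrtr_gt0.
suff : S1 = @mulmx _ (1 + k) (1 + k) (1 + k) B (@trmx _ (1 + k) (1 + k) B) by [].
rewrite SE /B tr_block_mx mulmx_block !trmx0 !mulmx0 !mul0mx !addr0.
congr block_mx.
- by rewrite tr_scalar_mx -scalar_mxM sx.
- rewrite linearZ /= trmxK mul_scalar_mx scalerA divff// scale1r.
  by [].
- by rewrite tr_scalar_mx mul_mx_scalar scalerA mulfV// scale1r.
- rewrite linearZ /= trmxK -scalemxAl -scalemxAr scalerA -invfM sx -hB1 /W1.
  by rewrite addrC subrK.
Qed.

(** A null vector u of a semidefinite form lies in its kernel, since the form at w + t u is affine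
    in t and bounded below. Invertibility then gives u = 0. *)
Lemma psd_unit_posdef (k : nat) (S : 'M[R]_k) : S^T = S -> S \in unitmx ->
  (forall u : 'rV[R]_k, 0 <= (u *m S *m u^T) 0 0) -> posdef S.
Proof.
move=> symS uS psd; split => // u u0; rewrite lt_neqAle psd andbT.
apply: contra_neq u0 => /esym q0.
have lin (w : 'rV[R]_k) : (u *m S *m w^T) 0 0 = 0.
  set y := (u *m S *m w^T) 0 0; set z := (w *m S *m w^T) 0 0.
  have wu : (w *m S *m u^T) 0 0 = y.
    rewrite /y; transitivity ((u *m S *m w^T)^T 0 0); last by rewrite mxE.
    by rewrite !trmx_mul trmxK symS mulmxA.
  have key (t : R) : 0 <= z + t * y * 2.
    have := psd (w + t *: u).
    have -> : (w + t *: u) *m S *m (w + t *: u)^T = w *m S *m w^T +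
        t *: (w *m S *m u^T) + (t *: (u *m S *m w^T) + t *: (t *: (u *m S *m u^T))).
      by rewrite linearD linearZ /= !mulmxDr !mulmxDl -!scalemxAr -!scalemxAl addrACA addrA.
    have eD (E F : 'M[R]_1) : (E + F) 0 0 = E 0 0 + F 0 0 by rewrite mxE.
    have eZ (b : R) (E : 'M[R]_1) : (b *: E) 0 0 = b * E 0 0 by rewrite mxE.
    by rewrite !eD !eZ q0 wu -/y -/z; lra.
  apply/eqP/negPn/negP => y0.
  have := key (- (z + 1) / (2 * y)).
  rewrite (_ : z + _ = -1); last by field.
  by rewrite ler0N1.
have uS0 : u *m S = 0.
  apply/rowP => j; have := lin (delta_mx 0 j).
  by rewrite trmx_delta -colE !mxE.
by rewrite -(mulmxK uS u) uS0 mul0mx.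
Qed.

End cholesky.

(** * Traces of powers of matrices of bounded rank *)

Section trace_inequality.
Context {R : realType}.

(** Regrouping the factors as B^T A moves the powers of A B^T to the index type [J], which stays
    fixed while [I] grows. *)
Lemma kpow_factor (I J : finType) (A B : I -> J -> R) r x y :
  let M j j' := \sum_x B x j * A x j' in
  kpow (fun x y => \sum_j A x j * B y j) r.+1 x y =
  \sum_j \sum_j' A x j * kpow M r j j' * B y j'.
Proof.
move=> M; set N := fun x y => _.
have shift (g : J -> R) z : \sum_c N z c * (\sum_j A c j * g j) =
    \sum_j A z j * \sum_j' M j j' * g j'.
  rewrite /N; under eq_bigr do rewrite mulr_suml.
  rewrite exchange_big /=; apply: eq_bigr => j _; rewrite mulr_sumr.
  under [RHS]eq_bigr do rewrite /M mulr_suml mulr_sumr.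
  rewrite [RHS]exchange_big /=; apply: eq_bigr => c _.
  by rewrite mulr_sumr; apply: eq_bigr => j' _; ring.
elim: r x => [|r IH] x.
  rewrite /= shift; apply: eq_bigr => j _; rewrite mulr_sumr.
  by apply: eq_bigr => j' _; rewrite mulrA.
rewrite [LHS]/=.
transitivity (\sum_c N x c * (\sum_j A c j * \sum_j' kpow M r j j' * B y j')).
  apply: eq_bigr => c _; congr (_ * _); rewrite -[LHS]/(kpow N r.+1 c y) IH.
  apply: eq_bigr => j _; rewrite mulr_sumr; apply: eq_bigr => j' _.
  by rewrite mulrA.
rewrite shift; apply: eq_bigr => j _.
under eq_bigr do rewrite mulr_sumr.
rewrite exchange_big mulr_sumr /=; apply: eq_bigr => j' _.
by rewrite -mulrA; congr (_ * _); rewrite mulr_suml; apply: eq_bigr => c _; rewrite mulrA.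
Qed.

Lemma ktrace_factor (I J : finType) (A B : I -> J -> R) r :
  ktrace (fun x y => \sum_j A x j * B y j) r.+1 =
  ktrace (fun j j' => \sum_x B x j * A x j') r.+1.
Proof.
rewrite /ktrace; under eq_bigr do rewrite kpow_factor.
rewrite exchange_big /=; under eq_bigr do rewrite exchange_big /=.
rewrite exchange_big /=; apply: eq_bigr => j _; apply: eq_bigr => j' _.
by rewrite mulr_suml; apply: eq_bigr => x _; ring.
Qed.

(** Cauchy-Schwarz on the diagonal of M^2; its squared entries sum to at most those of the whole of
    M^2, which give tr (M^4) by symmetry. *)
Lemma ktrace_sym_le (J : finType) (M : J -> J -> R) :
  (forall j j', M j j' = M j' j) ->
  ktrace M 1 ^+ 2 <= #|J|%:R * ktrace M 3.
Proof.
move=> symM; pose M2 j j' := \sum_c M j c * M c j'.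
have symM2 j j' : M2 j j' = M2 j' j.
  by apply: eq_bigr => c _; rewrite mulrC symM (symM j).
have t3 : ktrace M 3 = \sum_j \sum_c M2 j c ^+ 2.
  rewrite /ktrace; apply: eq_bigr => j _ /=.
  under eq_bigr do rewrite mulr_sumr.
  rewrite exchange_big /=; apply: eq_bigr => c _.
  rewrite expr2 {2}symM2 {1}/M2 mulr_suml; apply: eq_bigr => c' _.
  by rewrite mulrA.
have t1 : ktrace M 1 = \sum_j M2 j j by [].
have diag : \sum_j M2 j j ^+ 2 <= ktrace M 3.
  rewrite t3; apply: ler_sum => j _; rewrite (bigD1 j)//= lerDl.
  by apply: sumr_ge0 => c _; exact: sqr_ge0.
apply: le_trans (_ : #|J|%:R * \sum_j M2 j j ^+ 2 <= _); last by rewrite ler_wpM2l.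
rewrite t1.
have -> : (\sum_j M2 j j) ^+ 2 = \sum_j \sum_j' M2 j j * M2 j' j'.
  by rewrite expr2 mulr_suml; apply: eq_bigr => j _; rewrite mulr_sumr.
apply: (@le_trans _ _ (\sum_(j : J) \sum_(j' : J) (1 / 2 * M2 j j ^+ 2 + 1 / 2 * M2 j' j' ^+ 2))).
  apply: ler_sum => j _; apply: ler_sum => j' _.
  by have := sqr_ge0 (M2 j j - M2 j' j'); rewrite sqrrB; lra.
under eq_bigr do rewrite big_split /= sumr_const -mulr_sumr.
rewrite big_split /= sumr_const sumrMnl -mulr_sumr -mulrnDl [leRHS]mulr_natl.
by rewrite -mulrDl (_ : 1 / 2 + 1 / 2 = 1) ?mul1r//; field.
Qed.

End trace_inequality.

Section orthonormal_families.
Context {d : measure_display} {T : measurableType d} {R : realType}.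
Variables (P : probability T R) (H : (T -> R) -> Prop).
Hypothesis gsH : gaussian_space P H.
Local Notation Ex := (Ex P).
Local Notation cov := (cov P).
Implicit Types f g h : T -> R.

Lemma cov_linl (c : R) f g h : H f -> H g -> H h ->
  cov (fun w => c * f w + g w) h = c * cov f h + cov g h.
Proof.
move=> Hf Hg Hh; have mf := gs_moments gsH Hf; have mg := gs_moments gsH Hg.
have mh := gs_moments gsH Hh; rewrite /cov -ExZ -?ExD; [|by hm..].
by apply: eq_Ex => w; ring.
Qed.

Lemma cov_suml (I : Type) (s : seq I) (c : I -> R) (f : I -> T -> R) h :
  (forall i, H (f i)) -> H h ->
  cov (fun w => \sum_(i <- s) c i * f i w) h = \sum_(i <- s) c i * cov (f i) h.
Proof.
move=> Hf Hh; elim: s => [|i s IH].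
  rewrite big_nil /cov; under eq_fun do rewrite big_nil mul0r.
  exact: Ex_cst.
under eq_fun do rewrite big_cons; rewrite big_cons cov_linl ?IH//.
by apply: (gs_sum gsH) => j _; exact: gs_scale gsH _ _ (Hf j).
Qed.

Lemma cov_ge0 f : 0 <= cov f f.
Proof. by apply: Ex_ge0 => w; rewrite -expr2 sqr_ge0. Qed.

(** The variance of t f + g would be affine in t, and the chosen t would give it the value -1. *)
Lemma cov_null f g : H f -> H g -> cov f f = 0 -> cov f g = 0.
Proof.
move=> Hf Hg f0; apply/eqP/negPn/negP => fg0.
pose t := - (cov g g + 1) / (2 * cov f g).
have Hh : H (fun w => t * f w + g w) by exact: gs_lin gsH _ _ _ Hf Hg.
have := cov_ge0 (fun w => t * f w + g w).
rewrite cov_linl// (covC _ f) (covC _ g (fun w => _)) !cov_linl// f0 (covC _ g f).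
rewrite (_ : _ + _ = -1) ?ler0N1//; rewrite /t; field.
by [].
Qed.

Definition orthonormal (m : nat) (xi : 'I_m -> T -> R) : Prop :=
  (forall i, H (xi i)) /\ forall i j, cov (xi i) (xi j) = (i == j)%:R.

(** Gram-Schmidt: either some residual has positive variance and, once normalized, extends the
    family, or all residuals have variance 0 and Parseval's identity holds. *)
Lemma orthonormal_extend m (xi : 'I_m -> T -> R) : orthonormal xi ->
  (exists xi' : 'I_m.+1 -> T -> R, orthonormal xi') \/
  (forall f g, H f -> H g ->
     cov f g = \sum_j cov f (xi j) * cov g (xi j)).
Proof.
move=> [Hxi oxi].
pose pr f w := \sum_j cov f (xi j) * xi j w.
have Hpr f : H (pr f).
  by apply: (gs_sum gsH) => j _; exact: gs_scale gsH _ _ (Hxi j).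
pose res f w := -1 * pr f w + f w.
have Hres f : H f -> H (res f) by move=> Hf; exact: gs_lin gsH _ _ _ (Hpr f) Hf.
have cov_pr f i : cov (pr f) (xi i) = cov f (xi i).
  rewrite cov_suml// (bigD1 i)//= oxi eqxx mulr1 big1 ?addr0// => j ji.
  by rewrite oxi (negbTE ji) mulr0.
have res_xi f i : H f -> cov (res f) (xi i) = 0.
  by move=> Hf; rewrite /res cov_linl// cov_pr; ring.
have [[f [Hf f0]]|nex] := pselect (exists f, H f /\ cov (res f) (res f) != 0).
  left; pose sg := Num.sqrt (cov (res f) (res f)).
  have c0 : 0 < cov (res f) (res f) by rewrite lt_neqAle eq_sym f0 cov_ge0.
  have sg0 : sg != 0 by rewrite gt_eqF// sqrtr_gt0.
  have sg2 : sg ^+ 2 = cov (res f) (res f) by rewrite sqr_sqrtr// ltW.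
  pose e w := sg^-1 * res f w.
  have He : H e by apply: (gs_scale gsH); exact: Hres.
  have e_l g : H g -> cov e g = sg^-1 * cov (res f) g.
    move=> Hg; have := cov_linl sg^-1 (Hres f Hf) (gs_zero gsH) Hg.
    rewrite (_ : (fun w => _) = e); last by apply/funext => w; rewrite addr0.
    move=> ->; rewrite [X in _ + X](_ : _ = 0) ?addr0//.
    by rewrite /cov; under eq_fun do rewrite mul0r; rewrite Ex_cst.
  have ee : cov e e = 1.
    rewrite e_l// covC e_l; last exact: Hres.
    by rewrite -sg2; field.
  have ex i : cov e (xi i) = 0 by rewrite e_l// res_xi ?mulr0.
  exists (fun i => if unlift ord0 i is Some j then xi j else e); split=> [i|i j].
    by case: unliftP.
  case: (unliftP ord0 i) => [i' ->|->]; case: (unliftP ord0 j) => [j' ->|->].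
  - by rewrite oxi (inj_eq lift_inj).
  - by rewrite covC ex.
  - by rewrite ex.
  - by rewrite ee.
right=> f g Hf Hg.
have r0 : cov (res f) (res f) = 0.
  by apply/eqP/negPn/negP => c0; apply: nex; exists f.
have := cov_null (Hres f Hf) Hg r0; rewrite /res cov_linl// cov_suml//.
move=> h; transitivity (\sum_j cov f (xi j) * cov (xi j) g); first by lra.
by apply: eq_bigr => j _; rewrite (covC _ (xi j)).
Qed.

(* If the process had an orthonormal basis of [m] elements, [N] would factor
   through dimension [m] and [tr (N^2)^2 <= m tr (N^4)] would fail in the limit. *)
Lemma orthonormal_exists (I : nat -> finType) (z : forall n, I n -> T -> R)
    (wt : forall n, I n -> R) (v : R) :
  (forall n x, H (z n x)) -> v != 0 ->
  (fun n => ktrace (wcov P (z n) (wt n)) 1) @ \oo --> v ->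
  (fun n => ktrace (wcov P (z n) (wt n)) 3) @ \oo --> (0 : R) ->
  forall m, exists xi : 'I_m -> T -> R, orthonormal xi.
Proof.
move=> Hz v0 t1 t3; elim=> [|m [xi oxi]].
  by exists (fun=> fun=> 0); split=> -[].
have [//|full] := orthonormal_extend oxi.
have le n : ktrace (wcov P (z n) (wt n)) 1 ^+ 2 <=
    m%:R * ktrace (wcov P (z n) (wt n)) 3.
  (* By Parseval, [wcov] is A B^T with A = diag(wt) B. It need not be symmetric, but B^T A = B^T
     diag(wt) B is, whatever the signs of the weights. *)
  pose B x j := cov (z n x) (xi j); pose A x j := wt n x * B x j.
  have -> : wcov P (z n) (wt n) = fun x y => \sum_j A x j * B y j.
    apply/funext => x; apply/funext => y; rewrite /wcov full// mulr_sumr.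
    by apply: eq_bigr => j _; rewrite mulrA.
  rewrite (ktrace_factor A B 0) (ktrace_factor A B 2).
  have := @ktrace_sym_le R _ (fun j j' => \sum_x B x j * A x j').
  rewrite card_ord; apply => j j'.
  by apply: eq_bigr => x _; rewrite /A; ring.
exfalso; have : v ^+ 2 <= m%:R * 0.
  have c1 := cvg_expn (p := 2) t1.
  have c3 : (fun n => m%:R * ktrace (wcov P (z n) (wt n)) 3) @ \oo --> m%:R * (0 : R).
    by apply: cvgM => //; exact: cvg_cst.
  have hn : \forall n \near \oo, ktrace (wcov P (z n) (wt n)) 1 ^+ 2 <=
    m%:R * ktrace (wcov P (z n) (wt n)) 3 by exact: nearW.
  exact: ler_cvg_to c1 c3 hn.
by rewrite mulr0 leNgt exprn_even_gt0//= v0.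
Qed.

Lemma gaussian_vector_exists (k : nat) (S : 'M[R]_k) :
  (exists xi : 'I_k -> T -> R, orthonormal xi) -> posdef S ->
  exists G : 'I_k -> T -> R, (forall i, H (G i)) /\
    forall i j, cov (G i) (G j) = S i j.
Proof.
move=> [xi [Hxi oxi]] /cholesky[B ->].
exists (fun i w => \sum_j B i j * xi j w); split=> [i|i j].
  by apply: (gs_sum gsH) => l _; exact: gs_scale gsH _ _ (Hxi l).
have HG : H (fun w => \sum_l B j l * xi l w).
  by apply: (gs_sum gsH) => l _; exact: gs_scale gsH _ _ (Hxi l).
rewrite cov_suml// mxE; apply: eq_bigr => l _; rewrite mxE covC cov_suml//.
rewrite (bigD1 l)//= oxi eqxx mulr1 big1 ?addr0// => l' l'l.
by rewrite oxi (negbTE l'l) mulr0.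
Qed.

Lemma gaussian_moments f : H f ->
  forall p, Ex (fun w => f w ^+ p) = gauss_moment (cov f f) p.
Proof.
move=> Hf p; have mf := gs_moments gsH Hf.
elim/ltn_ind: p => -[|[|p]] IH /=.
- by under eq_fun do rewrite expr0; rewrite Ex_cst.
- by under eq_fun do rewrite expr1; rewrite (gs_mean gsH Hf).
rewrite -IH//; transitivity (Ex (fun w => f w * f w ^+ p.+1)).
  by apply: eq_Ex => w; rewrite exprS.
rewrite (wder_ibp gsH Hf (wderX p.+1 (wder_id P f Hf))) -ExZ; last by hm.
by apply: eq_Ex => w /=; ring.
Qed.

End orthonormal_families.

Lemma convergent_bounded (R : realType) (u : nat -> R) (l : R) :
  u @ \oo --> l -> exists C, forall n, u n <= C.
Proof.
move=> /cvgrPdist_le/(_ 1 ltr01)[N _ hN].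
exists (\sum_(i < N) `|u i| + (`|l| + 1)) => n.
have [nN|nN] := ltnP n N.
  rewrite (le_trans (ler_norm _))// (bigD1 (Ordinal nN))//= -addrA lerDl.
  by rewrite addr_ge0 ?sumr_ge0// addr_ge0.
have := hN n nN; rewrite distrC ler_norml => /andP[_ h].
rewrite (le_trans (_ : u n <= `|l| + 1))//; last by rewrite lerDr sumr_ge0.
by have := ler_norm l; lra.
Qed.

(** * The central limit theorem *)

Section quadratic_variations.
Context {R : realType} {d0 : measure_display} {T : measurableType d0}.
Variables (P : probability T R) (X : R -> {RV P >-> R}) (V : R -> R).
Hypothesis X_gaussian : gaussian_process X.
Hypothesis X_centered : centered X.
Hypothesis V_semivariogram : is_semivariogram X V.
Variables (alpha e : R) (k : nat) (a : 'I_k -> seq R).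
Hypothesis size_a : forall i, (0 < size (a i))%N.
Hypothesis a_sum0 : forall i, \sum_(x <- a i) x = 0.
Local Notation Ex := (Ex P).
Local Notation cov := (cov P).
Local Notation W i n := (quad_variation X alpha (a i) n).

Let gsH := gspan_gaussian_space X_gaussian X_centered.

Definition scale (n : nat) : R := n%:R `^ (1 / 2) * mesh alpha n `^ e.

(* Padding with zeros lets all the filters share the index type ['I_k * 'I_n]. *)
Definition diffs (n : nat) (x : 'I_k * 'I_n) : T -> R :=
  if (x.2 + size (a x.1) <= n)%N
  then a_difference X (mesh alpha n) (a x.1) x.2.+1 else fun=> 0.

Definition weights (u : 'I_k -> R) (n : nat) (x : 'I_k * 'I_n) : R :=
  u x.1 / scale n.

Lemma diffs_gspan n x : gspan X (@diffs n x).
Proof.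
rewrite /diffs; case: ifP => _; last exact: gs_zero gsH.
exact: a_difference_gspan.
Qed.

Lemma quad_variationE i n w :
  W i n w = \sum_(j < n) diffs (i, j) w ^+ 2.
Proof.
rewrite /quad_variation big_add1 /= big_mkord.
(* Widening the range to n needs n + 1 - size <= n, hence the positive sizes. The passage from
   indices starting at 1 to indices starting at 0 sits in [x.2.+1]. *)
rewrite (big_ord_widen n (fun j => a_difference X (mesh alpha n) (a i) j.+1 w ^+ 2)).
  rewrite big_mkcond /=; apply: eq_bigr => j _; rewrite /diffs /=.
  have -> : (j < n.+1 - size (a i))%N = (j + size (a i) <= n)%N by lia.
  by case: ifP => //; rewrite expr0n.
by have := size_a i; lia.
Qed.

Lemma quad_variation_moments i n : has_moments P (W i n).
Proof.
rewrite (_ : W i n = fun w => \sum_(j < n) diffs (i, j) w ^+ 2); last first.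
  by apply/funext => w; exact: quad_variationE.
apply: has_moments_sum => j _; apply: has_momentsX.
exact: gs_moments gsH _ (diffs_gspan _).
Qed.

Lemma quad_variation_mean i n :
  Ex (W i n) = \sum_(j < n) cov (@diffs n (i, j)) (@diffs n (i, j)).
Proof.
rewrite (_ : W i n = fun w => \sum_(j < n) diffs (i, j) w ^+ 2); last first.
  by apply/funext => w; exact: quad_variationE.
rewrite Ex_sum => [|j _]; last first.
  by apply: has_momentsX; exact: gs_moments gsH _ (diffs_gspan _).
by apply: eq_bigr => j _; apply: eq_Ex => w; rewrite expr2.
Qed.

Definition normalized (n : nat) (w : T) : 'rV[R]_k :=
  \row_(i < k) ((W i n w - fine 'E_P[W i n]%E) / scale n).

Lemma normalized_moments n i : has_moments P (fun w => normalized n w 0 i).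
Proof.
under eq_fun do rewrite mxE.
have mW := quad_variation_moments i n.
by apply: has_momentsM; hm.
Qed.

Lemma normalized_qform (u : 'I_k -> R) n w :
  \sum_i u i * normalized n w 0 i = qform P (@diffs n) (@weights u n) w.
Proof.
rewrite /qform -(pair_bigA _ (fun i j => weights u (i, j) *
  (@diffs n (i, j) w ^+ 2 - cov (@diffs n (i, j)) (@diffs n (i, j)))))/=.
apply: eq_bigr => i _; rewrite mxE fine_expectation quad_variation_mean.
rewrite quad_variationE -sumrB mulr_suml mulr_sumr; apply: eq_bigr => j _.
by rewrite /weights /=; ring.
Qed.

Lemma normalized_cov n i j :
  Ex (fun w => normalized n w 0 i * normalized n w 0 j) =
  fine (covariance P (W i n) (W j n)) / scale n ^+ 2.
Proof.
have mi := quad_variation_moments i n; have mj := quad_variation_moments j n.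
rewrite unlock fine_expectation !fine_expectation mulrC -ExZ; last first.
  have h : has_moments P (fun w => (W i n w - Ex (W i n)) * (W j n w - Ex (W j n))).
    by hm.
  exact: h.
apply: eq_Ex => w; rewrite !mxE !fine_expectation.
transitivity ((scale n ^+ 2)^-1 *
  ((W i n w - Ex (W i n)) * (W j n w - Ex (W j n)))); last by [].
by rewrite expr2 (invfM (scale n)); move: (scale n)^-1 => s; ring.
Qed.

Lemma scale_sqr n : scale n ^+ 2 = n%:R * mesh alpha n `^ (2 * e).
Proof.
have sq (x p : R) : (x `^ p) ^+ 2 = x `^ (2 * p).
  by rewrite -powR_mulrn ?powR_ge0// -powRrM mulrC.
rewrite exprMn !sq; congr (_ * _).
by rewrite (_ : 2 * (1 / 2) = 1) ?powRr1//; field.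
Qed.

Section limits.
Variables (K gam : R).
Hypothesis gam_bounds : -1 < gam < - (1 / 2).
Hypothesis cov_decay : \forall n \near \oo, forall (i j : 'I_k) (p q : nat),
  (q <= p)%N -> (0 < q)%N -> (p + size (a i) <= n.+1)%N ->
  `|varsum V (a i) (a j) (mesh alpha n) p q| <=
    K * mesh alpha n `^ e * kap gam (p - q).
Hypothesis K0 : 0 <= K.
Variable Lambda : 'M[R]_k.
Hypothesis Lambda_unit : Lambda \in unitmx.
Hypothesis cov_cvg : forall i j,
  (fun n => Ex (fun w => normalized n w 0 i * normalized n w 0 j)) @ \oo -->
    Lambda i j.

Lemma diffs_cov_bound : \forall n \near \oo, forall x y : 'I_k * 'I_n,
  `|cov (diffs x) (diffs y)| <=
    K * mesh alpha n `^ e * kap gam (ndist x.2 y.2).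
Proof.
apply: filterS cov_decay => n hn.
suff h (x y : 'I_k * 'I_n) : (y.2 <= x.2)%N -> `|cov (diffs x) (diffs y)| <=
    K * mesh alpha n `^ e * kap gam (ndist x.2 y.2).
  move=> x y; have [yx|/ltnW xy] := leqP y.2 x.2; first exact: h.
  by rewrite covC ndistC; exact: h.
move=> yx; rewrite /diffs.
have R0 : 0 <= K * mesh alpha n `^ e * kap gam (ndist x.2 y.2).
  by rewrite !mulr_ge0 ?powR_ge0 ?kap_ge0.
have cov0 f : cov (fun=> 0) f = 0.
  by rewrite /cov; under eq_fun do rewrite mul0r; rewrite Ex_cst.
case: ifPn => vx; last by rewrite cov0 normr0.
case: ifPn => vy; last by rewrite covC cov0 normr0.
rewrite (cov_a_difference X_gaussian V_semivariogram)// normrN.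
rewrite (_ : ndist x.2 y.2 = (x.2.+1 - y.2.+1)%N); last first.
  by rewrite /ndist subSS; clear -yx; lia.
by apply: hn => //; rewrite addSn ltnS.
Qed.

(** The factor mesh^e of the covariances cancels against [scale], which leaves n^(-1/2). *)
Lemma wcov_bound u : exists C : R, \forall n \near \oo,
  forall x y : 'I_k * 'I_n,
  `|wcov P (@diffs n) (@weights u n) x y| <=
    C / n%:R `^ (1 / 2) * kap gam (ndist x.2 y.2).
Proof.
exists ((\sum_i `|u i|) * K); apply: filter_app diffs_cov_bound.
exists 1%N => // n /= n0 hn x y; rewrite /wcov /weights normrM.
have m0 : 0 < mesh alpha n `^ e by rewrite powR_gt0// mesh_gt0.
have n2 : (0 : R) < n%:R `^ (1 / 2) by rewrite powR_gt0// ltr0n.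
have s0 : 0 < scale n by rewrite mulr_gt0.
have ux : `|u x.1| <= \sum_i `|u i| by rewrite (bigD1 x.1)//= lerDl sumr_ge0.
rewrite normrM [`|(scale n)^-1|]gtr0_norm ?invr_gt0//.
apply: (@le_trans _ _ ((\sum_i `|u i|) / scale n *
    (K * mesh alpha n `^ e * kap gam (ndist x.2 y.2)))).
  apply: ler_pM => //; first by rewrite divr_ge0// ltW.
  by rewrite ler_wpM2r// invr_ge0 ltW.
rewrite le_eqVlt; apply/orP; left; apply/eqP; rewrite /scale; field.
by rewrite !gt_eqF.
Qed.

Definition lform (u : 'I_k -> R) : R := \sum_i \sum_j u i * u j * Lambda i j.

Lemma qform_var_cvg u :
  (fun n => Ex (fun w => qform P (@diffs n) (@weights u n) w ^+ 2)) @ \oo -->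
    lform u.
Proof.
rewrite (_ : (fun n => _) = fun n => \sum_i \sum_j u i * u j *
    Ex (fun w => normalized n w 0 i * normalized n w 0 j)).
  apply: cvg_sumR => i; apply: cvg_sumR => j.
  by apply: cvgM; [exact: cvg_cst|exact: cov_cvg].
apply/funext => n; have mN := normalized_moments n.
transitivity (Ex (fun w => \sum_i \sum_j u i * u j *
    (normalized n w 0 i * normalized n w 0 j))).
  apply: eq_Ex => w; rewrite -normalized_qform expr2 mulr_suml.
  by apply: eq_bigr => i _; rewrite mulr_sumr; apply: eq_bigr => j _; ring.
have mij i j : has_moments P (fun w => u i * u j *
    (normalized n w 0 i * normalized n w 0 j)).
  by apply: has_momentsZ; apply: has_momentsM.
rewrite Ex_sum => [|i _]; last by apply: has_moments_sum => j _; exact: mij.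
apply: eq_bigr => i _; rewrite Ex_sum => [|j _]; last exact: mij.
by apply: eq_bigr => j _; rewrite ExZ//; apply: has_momentsM.
Qed.

(** For p = 1, [Ex_qformXS] reads E Q^2 = 2 tr (N^2). *)
Lemma qform_ktrace1_cvg u :
  (fun n => ktrace (wcov P (@diffs n) (@weights u n)) 1) @ \oo --> lform u / 2.
Proof.
have := cvgM (cvg_cst (1 / 2 : R)) (@qform_var_cvg u) => /(_ _ _ _).
rewrite (_ : 1 / 2 * lform u = lform u / 2); last by field.
rewrite (_ : cst (1 / 2) \* _ = fun n => ktrace (wcov P (@diffs n) (@weights u n)) 1).
  exact.
apply/funext => n /=.
rewrite (Ex_qformXS gsH _ (@diffs_gspan n) 1) big_ord1 /=.
under eq_fun do rewrite expr0.
by rewrite Ex_cst expn1 ffactn1 muln1; field.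
Qed.

Lemma qform_ktrace_cvg u r :
  (fun n => ktrace (wcov P (@diffs n) (@weights u n)) r.+2) @ \oo --> (0 : R).
Proof.
have [C hC] := wcov_bound u.
exact: (ktrace_power_kernel_cvg gam_bounds hC).
Qed.

Lemma qform_moments_cvg u p :
  (fun n => Ex (fun w => qform P (@diffs n) (@weights u n) w ^+ p)) @ \oo -->
    gauss_moment (lform u) p.
Proof.
apply: (cumulant_cvg (e := fun n p => Ex (fun w => qform P (@diffs n) (@weights u n) w ^+ p))
  (tr := fun n r => ktrace (wcov P (@diffs n) (@weights u n)) r)).
- by move=> n; under eq_fun do rewrite expr0; rewrite Ex_cst.
- by move=> n q; rewrite (Ex_qformXS gsH (@weights u n) (@diffs_gspan n) q).
- exact: qform_ktrace1_cvg.
- exact: qform_ktrace_cvg.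
Qed.

Lemma lformE (u : 'rV[R]_k) : lform (u 0) = (u *m Lambda *m u^T) 0 0.
Proof.
rewrite mxE /lform exchange_big /=; apply: eq_bigr => j _.
rewrite !mxE mulr_suml; apply: eq_bigr => i _; ring.
Qed.

(** A limit of covariance matrices is symmetric and semidefinite; invertibility makes it
    definite. *)
Lemma Lambda_posdef : posdef Lambda.
Proof.
apply: psd_unit_posdef => // [|u].
  apply/matrixP => i j; rewrite mxE.
  have h1 := @cov_cvg j i; have h2 := @cov_cvg i j.
  have E : (fun n => Ex (fun w => normalized n w 0 j * normalized n w 0 i)) =
      fun n => Ex (fun w => normalized n w 0 i * normalized n w 0 j).
    by apply/funext => n; apply: eq_Ex => w; rewrite mulrC.
  by rewrite E in h1; exact: cvg_unique h1 h2.
rewrite -lformE; apply: (ler_cvg_to (cvg_cst (0 : R)) (@qform_var_cvg (u 0))).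
by apply: nearW => n; apply: Ex_ge0 => w; exact: sqr_ge0.
Qed.

Lemma limit_vector_exists : exists G : 'I_k -> T -> R,
  (forall i, gspan X (G i)) /\ forall i j, cov (G i) (G j) = Lambda i j.
Proof.
apply: (gaussian_vector_exists gsH) Lambda_posdef.
(* For k = 0 there is no direction u with positive limit variance, and the empty family serves. *)
case: (posnP k) => [k0|k0].
  by exists (fun i => fun=> 0); split=> i; have := ltn_ord i; rewrite [X in (_ < X)%N]k0.
pose u : 'rV[R]_k := delta_mx 0 (Ordinal k0).
have u0 : u != 0.
  apply/eqP => /matrixP /(_ 0 (Ordinal k0)); rewrite !mxE !eqxx.
  by move/eqP; rewrite oner_eq0.
have v0 : lform (u 0) / 2 != 0.
  by rewrite mulf_neq0 ?invr_eq0// lformE gt_eqF// Lambda_posdef.2.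
exact: (orthonormal_exists gsH (fun n => @diffs_gspan n) v0
  (@qform_ktrace1_cvg (u 0)) (@qform_ktrace_cvg (u 0) 1)).
Qed.

Section limit_vector.
Variable G : 'I_k -> T -> R.
Hypothesis HG : forall i, gspan X (G i).
Hypothesis covG : forall i j, cov (G i) (G j) = Lambda i j.

Definition limit_tuple (w : T) : k.-tuple R := [tuple G i w | i < k].

Lemma limit_tuple_measurable : measurable_fun setT limit_tuple.
Proof.
apply/measurable_fun_tnthP => i.
rewrite (_ : _ \o _ = G i); first exact: gspan_measurable.
by apply/funext => w /=; rewrite tnth_mktuple.
Qed.

Definition limit_rv : {mfun T >-> k.-tuple R} :=
  HB.pack limit_tuple (isMeasurableFun.Build _ _ _ _ _ limit_tuple_measurable).

Definition limit_law : probability (k.-tuple R) R := distribution P limit_rv.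

Definition limit_form (u : 'I_k -> R) w : R := \sum_i u i * G i w.

Lemma limit_form_gspan u : gspan X (limit_form u).
Proof. by apply: (gs_sum gsH) => i _; exact: gs_scale gsH _ _ (HG i). Qed.

Lemma limit_form_cov u : cov (limit_form u) (limit_form u) = lform u.
Proof.
rewrite (cov_suml gsH _ _ HG (limit_form_gspan u)).
apply: eq_bigr => i _; rewrite covC (cov_suml gsH _ _ HG (HG i)) mulr_sumr.
by apply: eq_bigr => j _; rewrite covC covG mulrA.
Qed.

Lemma limit_law_normal : is_mvnormal 0 Lambda limit_law.
Proof.
move=> u A mA; rewrite trmx0 mulmx0 mxE -lformE -limit_form_cov.
rewrite -(gspan_normal_cov X_gaussian X_centered (limit_form_gspan (u 0)) mA).
rewrite /limit_law /distribution /pushforward /=; congr (P _).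
apply/funext => w; rewrite /preimage /= /limit_form.
by congr (A _); apply: eq_bigr => i _; rewrite tnth_mktuple.
Qed.

Lemma normalized_cvg : cvg_in_distribution P normalized limit_law.
Proof.
move=> f cf [B fB]; pose Gr w : 'rV[R]_k := \row_i G i w.
have mG j : has_moments P (fun w => Gr w 0 j).
  by under eq_fun do rewrite mxE; exact: gs_moments gsH _ (HG j).
have fG := bounded_row_moments cf fB mG.
have fY n := bounded_row_moments cf fB (normalized_moments n).
have mrow : measurable_fun setT (fun z : k.-tuple R => f (\row_(i < k) tnth z i)).
  apply: (@measurable_continuous_row _ _ _ _ (fun z : k.-tuple R => \row_(i < k) tnth z i) _ f B) => // j.
  by under eq_fun do rewrite mxE; exact: measurable_tnth.
have -> : (\int[limit_law]_z (f (\row_(i < k) tnth z i))%:E)%E = (Ex (f \o Gr))%:E.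
  rewrite -(integral_Ex fG) integral_pushforward//.
  - rewrite preimage_setT; apply: eq_integral => w _ /=; congr (f _)%:E.
    by apply/rowP => i; rewrite !mxE tnth_mktuple.
  - exact/measurable_EFinP.
  - rewrite preimage_setT (_ : _ \o _ = EFin \o (f \o Gr)); last first.
      apply/funext => w /=; congr (f _)%:E.
      by apply/rowP => i; rewrite !mxE tnth_mktuple.
    exact: has_moments_integrable.
rewrite (_ : (fun n => 'E_P[f \o normalized n]%E) = fun n => (Ex (f \o normalized n))%:E);
  last by apply/funext => n; exact: expectation_Ex.
apply: cvg_EFin; first exact: nearW.
have [C hC] : exists C : 'I_k -> R, forall i n,
    Ex (fun w => normalized n w 0 i ^+ 2) <= C i.
  suff /choice[C hC] : forall i, exists C : R, forall n,
      Ex (fun w => normalized n w 0 i ^+ 2) <= C by exists C.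
  by move=> i; exact: convergent_bounded (@cov_cvg i i).
(* One constant for all coordinates: the second moments of [normalized] are bounded as convergent
   sequences, those of the limit are the diagonal of [Lambda]. *)
pose C0 := \sum_i (`|C i| + `|Lambda i i|).
have C0i i : `|C i| + `|Lambda i i| <= C0.
  by rewrite /C0 (bigD1 i)//= lerDl sumr_ge0// => j _; rewrite addr_ge0.
apply: (@levy_continuity _ _ _ _ P normalized Gr C0 normalized_moments mG _ _ _ f B) => //.
- move=> n j; rewrite (le_trans (hC j n))// (le_trans _ (C0i j))//.
  by rewrite (le_trans (ler_norm _))// lerDl.
- move=> j; rewrite (le_trans _ (C0i j))//.
  rewrite (_ : Ex _ = Lambda j j); first by rewrite (le_trans (ler_norm _))// lerDr.
  by rewrite -covG; apply: eq_Ex => w; rewrite mxE expr2.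
- move=> u th.
  have := @moments_cvg_cos _ _ _ P (fun n => qform P (@diffs n) (@weights u n))
    (limit_form u) (lform u) th _ _ _ (@qform_moments_cvg u).
  have -> : (fun w => cos (\sum_i u i * Gr w 0 i + th)) =
      fun w => cos (limit_form u w + th).
    apply/funext => w; congr (cos (_ + _)).
    by apply: eq_bigr => i _; rewrite mxE.
  have -> : (fun n => Ex (fun w => cos (\sum_i u i * normalized n w 0 i + th))) =
      fun n => Ex (fun w => cos (qform P (@diffs n) (@weights u n) w + th)).
    apply/funext => n; apply: eq_Ex => w; by rewrite normalized_qform.
  apply=> [n||p].
  - exact: (qform_moments gsH (@weights u n) (@diffs_gspan n)).
  - exact: (gs_moments gsH (limit_form_gspan u)).
  - by rewrite -limit_form_cov (gaussian_moments gsH (limit_form_gspan u)).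
Qed.

End limit_vector.

Theorem quadratic_variation_clt : exists mu : probability (k.-tuple R) R,
  is_mvnormal 0 Lambda mu /\ cvg_in_distribution P normalized mu.
Proof.
have [G [HG covG]] := limit_vector_exists.
exists (limit_law HG); split; first exact: limit_law_normal.
exact: normalized_cvg.
Qed.

End limits.
End quadratic_variations.

Theorem corollary3p6 (R : realType) (d0 : measure_display)
  (T : measurableType d0) (P : probability T R)
  (X : R -> {RV P >-> R}) (V : R -> R) (alpha : R)
  (X_gaussian : gaussian_process X)
  (X_centered : centered X)
  (X_stat_incr : stationary_increments X)
  (V_semivariogram : is_semivariogram X V)
  (alpha_gt0 : 0 < alpha) (alpha_le1 : alpha <= 1)
  (V_smooth : smooth_on_pos V)
  (D : nat) (C s : R) (r : R -> R)
  (V_diff : times_differentiable (2 * D) V)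
  (C_gt0 : 0 < C) (s_gt0 : 0 < s) (s_lt2 : s < 2)
  (V_expansion : forall h : R,
     V^`(2 * D)%classic h = V^`(2 * D)%classic 0 + C * (-1) ^+ D * `|h| `^ s + r h)
  (r_littleo :
     (r : R -> R^o) =o_ (0 : R) (fun h : R => `|h| `^ s : R^o))
  (r_bound : alpha < 1 ->
     exists K : R, forall h : R, 1 < `|h| -> `|r h| <= K * `|h| `^ s)
  (d : nat) (d_def : d = if s < 3 / 2 then 2%N else 3%N)
  (beta K' : R) (beta_gt : s - d%:R < beta) (beta_lt : beta < - (1 / 2))
  (rd_bound_eq1 : alpha = 1 ->
     forall h : R, 0 < `|h| -> `|h| < 1 -> `|r^`(d)%classic h| <= K' * `|h| `^ beta)
  (rd_bound_lt1 : alpha < 1 ->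
     forall h : R, h != 0 -> `|r^`(d)%classic h| <= K' * `|h| `^ beta)
  (k : nat) (a : 'I_k -> seq R) (M : 'I_k -> nat)
  (a_seq : forall i, is_difference_sequence (a i))
  (a_sum0 : forall i, \sum_(x <- a i) x = 0)
  (a_order : forall i, has_order (a i) (M i))
  (a_order_gt : forall i, D%:R + s / 2 + 1 / 4 < (M i)%:R)
  (Lambda : 'M[R]_k) (Lambda_inv : Lambda \in unitmx)
  (cov_cvg :
     (\matrix_(i < k, j < k)
        (fine (covariance P (quad_variation X alpha (a i) n)
                            (quad_variation X alpha (a j) n))
         / (n%:R * mesh alpha n `^ (4 * D%:R + 2 * s))))
       @[n --> \oo] --> Lambda) :
  exists mu : probability (k.-tuple R) R,
    is_mvnormal 0 Lambda mu /\
    cvg_in_distribution P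
      (fun (n : nat) (w : T) => \row_(i < k)
         ((quad_variation X alpha (a i) n w
           - fine 'E_P[quad_variation X alpha (a i) n]%E)
          / (n%:R `^ (1 / 2) * mesh alpha n `^ (2 * D%:R + s))))
      mu.
Proof.
set e := 2 * D%:R + s.
have ann i : annihilates (a i) (M i) by have [] := a_order i.
have size_a i : (0 < size (a i))%N.
  by have [+ _] := a_seq i; case: (a i) => //=; rewrite eqxx.
(* M > D gives M >= D + 1; if s >= 3/2, then s / 2 + 1 / 4 >= 1, so M > D + 1 and M >= D + 2. *)
have M_ge i : (D + (if (s < 3 / 2)%R then 1 else 2) <= M i)%N.
  have := a_order_gt i; case: ifP => hs h; rewrite leqNgt; apply/negP => hM.
    have : (M i)%:R <= (D%:R : R) by rewrite ler_nat; clear -hM; lia.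
    by lra.
  have : (M i)%:R <= (D.+1%:R : R) by rewrite ler_nat; clear -hM; lia.
  by rewrite -natr1; move/negbT: hs; rewrite -leNgt; lra.
have q_le i j : (2 * D + d <= M i + M j)%N.
  have := M_ge i; have := M_ge j; rewrite d_def.
  by case: ifP => _; move: (M i) (M j) => m m'; clear; lia.
have d_gt0 : (0 < d)%N by rewrite d_def; case: ifP.
have r_small : \forall h \near (0 : R), `|r h| <= `|h| `^ s.
  have /eqoP /(_ 1 ltr01) := r_littleo.
  apply: filterS => h; rewrite mul1r => /le_trans; apply.
  by rewrite ger0_norm ?powR_ge0.
(* Replacing beta by a larger exponent weakens the decay harmlessly as long as it stays below -1/2,
   and [kap_sum_le] needs an exponent above -1; -3/4 is one value in between. *)
pose gam := Num.max beta (- (3 / 4)).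
have beta_gam : beta <= gam by rewrite le_max lexx.
have gam_bounds : -1 < gam < - (1 / 2).
  rewrite /gam lt_max gt_max beta_lt /=; apply/andP; split; last lra.
  by apply/orP; right; lra.
have gam0 : gam <= 0 by move: gam_bounds => /andP[]; lra.
have bound i j := varsum_bound V_smooth V_expansion alpha_gt0 alpha_le1 V_diff C_gt0
  s_gt0 r_small d_gt0 beta_gt rd_bound_eq1 rd_bound_lt1 (ann i) (ann j) (q_le i j)
  beta_gam gam0.
have [K [K0 decay]] : exists K : R, 0 <= K /\
    \forall n \near \oo, forall (i j : 'I_k) (p q : nat),
    (q <= p)%N -> (0 < q)%N -> (p + size (a i) <= n.+1)%N ->
    `|varsum V (a i) (a j) (mesh alpha n) p q| <=
      K * mesh alpha n `^ e * kap gam (p - q).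
  (* The k^2 bounds are made uniform by adding the constants and taking the largest threshold. *)
  have [K hK] := choice (fun x : 'I_k * 'I_k => bound x.1 x.2).
  have [N hN] := choice hK.
  exists (\sum_x K x); split; first by apply: sumr_ge0 => x _; case: (hN x).
  exists (\max_x N x)%N => // n /= Nn i j p q qp q0 pn.
  have [Kx hx] := hN (i, j).
  have Nx : (N (i, j) <= n)%N by rewrite (leq_trans _ Nn)// leq_bigmax.
  rewrite (le_trans (hx n p q Nx qp q0 pn))//.
  rewrite ler_wpM2r ?kap_ge0// ler_wpM2r ?powR_ge0//.
  by rewrite (bigD1 (i, j))//= lerDl sumr_ge0// => x _; case: (hN x).
have cov_cvg' i j :
    (fun n => Ex P (fun w => normalized X alpha e a n w 0 i *
      normalized X alpha e a n w 0 j)) @ \oo --> Lambda i j.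
  (* Convergence of matrices is read entrywise; the normalizations agree because 2 e = 4 D + 2 s. *)
  have := cvg_comp _ _ cov_cvg (@coord_continuous _ _ _ i j Lambda).
  apply: cvg_trans; apply: near_eq_cvg; apply: nearW => n /=.
  rewrite mxE (normalized_cov X_gaussian X_centered)// scale_sqr.
  by congr (_ / (_ * _ `^ _)); rewrite /e; ring.
have [mu [normal_mu cvg_mu]] := quadratic_variation_clt X_gaussian X_centered
  V_semivariogram size_a a_sum0 gam_bounds decay K0 Lambda_inv cov_cvg'.
by exists mu.
Qed.
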